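(* Let $\mu=(\mu_n)_{n\geq 0}$ be an increasing sequence of positive integers. Let $(\alpha_n)_{n\geq 0}$ be a sequence of non-zero complex numbers and let $R\in[0,+\infty]$ be the radius of convergence of the power series $\sum_{n\geq 0}\frac{z^n}{n!|\alpha_n|}$. There exists a function $f\in\mathcal{H}(\mathbb{D}_R)$ such that, for every compact subset $K$ of $\mathbb{C}$ with $K^c$ connected, and every function $h$ continuous on $K$ and holomorphic in the interior of $K$, there exists an increasing subsequence $(\lambda_n)_n\subset\mu$ such that $$\sup_{z\in K}\left|\alpha_{\lambda_n}S_{\lambda_n}(f^{(\lambda_n)})(z)-h(z)\right|\rightarrow 0\quad\text{as }n\rightarrow+\infty.$$ Moreover, the set $\mathcal{W}_R^{(\mu)}(\alpha_n)$ of such functions is a dense $G_\delta$ subset of $\mathcal{H}(\mathbb{D}_R)$ and contains, apart from $0$, a dense subspace and an infinite-dimensional closed subspace of $\mathcal{H}(\mathbb{D}_R)$.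
   Context: For $r\in(0,+\infty]$, $\mathbb{D}_r=\{z\in\mathbb{C}:|z|<r\}$ (with $\mathbb{D}_\infty=\mathbb{C}$) and $\mathcal{H}(\mathbb{D}_r)$ is the Fréchet space of holomorphic functions on $\mathbb{D}_r$ (uniform convergence on compact sets). By convention $\mathcal{H}(\mathbb{D}_0)$ is the space of formal power series, i.e. $\mathbb{C}^{\mathbb{N}}$ with the Cartesian (product) topology. $S_n(g)(z)$ is the $n$-th partial sum (degree at most $n$) of the Taylor development of $g$ at $0$; thus for $f=\sum_k a_kz^k$ (convergent or formal, with formal derivatives in the latter case), $S_n(f^{(n)})(z)=\sum_{k=n}^{2n}a_k\frac{k!}{(k-n)!}z^{k-n}$. $K^c=\mathbb{C}\setminus K$. A set contains a subspace apart from $0$ if it contains all its non-zero elements. *)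

(* Defs.v *)
From HB Require Import structures.
From mathcomp Require Import all_boot all_order all_algebra.
From mathcomp Require Import all_classical all_reals all_analysis borel_hierarchy.
From mathcomp.real_closed Require Import complex.

Set Implicit Arguments.
Unset Strict Implicit.
Unset Printing Implicit Defensive.

Import Order.TTheory GRing.Theory Num.Theory numFieldNormedType.Exports.
Local Open Scope classical_set_scope.
Local Open Scope ring_scope.

(* R[i] bundled as a numClosedFieldType: MathComp-Analysis infers the topology
   and the normed module structure from that structure, not from the bare type
   R[i].  The norm `|z| is C-valued; its real value is [modulus z]. *)
Definition Cplx (R : realType) : numClosedFieldType := R[i].

Section Spaces.
Variable R : realType.
Local Notation C := (Cplx R).

Definition modulus (z : C) : R := complex.Re `|z|.

Definition disc (r : \bar R) : set C := [set z | ((modulus z)%:E < r)%E].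

(* [derivable f z 1] is complex differentiability at z, since the increments
   range over the scalar field C. *)
Definition holomorphic_on (D : set C) (f : C -> C) : Prop :=
  forall z, D z -> derivable f z 1.

Definition radius_of_convergence (a : nat -> C) : \bar R :=
  ereal_sup [set (modulus z)%:E |
    z in [set z : C | cvgn (series (fun n => a n * z ^+ n))]].

(* A function on D_r is represented by its extension by 0 to C, so that two
   elements are equal exactly when they agree on D_r. *)
Definition hol_set (r : \bar R) : set (C -> C) :=
  [set f | holomorphic_on (disc r) f /\ forall z, ~ disc r z -> f z = 0].

Definition hol_pred (r : \bar R) : pred (C -> C) := fun f => f \in hol_set r.

Fact hol_submod_closed (r : \bar R) : subsemimod_closed (hol_pred r).
Proof.
apply: GRing.submod_closed_semi; split.
  by apply/mem_set; split=> // z _; exact: derivable_cst.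
move=> a f g /set_mem[hf f0] /set_mem[hg g0]; apply/mem_set; split=> z Dz.
  by apply: derivableD; [apply: derivableZ; exact: hf|exact: hg].
have -> : (a *: f + g) z = a *: f z + g z by [].
by rewrite (f0 z Dz) (g0 z Dz) scaler0 addr0.
Qed.

(* The space H(D_r), for r > 0. *)
Definition hol (r : \bar R) : Type := {f : C -> C | hol_pred r f}.

HB.instance Definition _ r :=
  SubChoice.copy (hol r) {f : C -> C | hol_pred r f}.
HB.instance Definition _ r := GRing.SubChoice_isSubLmodule.Build C (C -> C)
  (hol_pred r) (hol r) (hol_submod_closed r).

Definition compact_convergence (r : \bar R) : uniformType :=
  {family [set K | compact K /\ K `<=` disc r], C -> C}.

HB.instance Definition _ r := Uniform.copy (hol r)
  (initial_topology (\val : hol r -> compact_convergence r)).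

(* The space H(D_0) of formal power series, given by their coefficients. *)
Definition fps : Type := nat -> C.

HB.instance Definition _ := GRing.Lmodule.copy fps (nat -> C).
HB.instance Definition _ := Uniform.copy fps {ptws nat -> C}.

Definition taylor_sum (n : nat) (g : C -> C) (z : C) : C :=
  \sum_(k < n.+1) derive1n k g 0 / k`!%:R * z ^+ k.

Definition hol_S (r : \bar R) (n : nat) (f : hol r) : C -> C :=
  taylor_sum n (derive1n n (\val f)).

Definition fps_deriv (a : fps) : fps := fun k => a k.+1 *+ k.+1.

Definition fps_sum (n : nat) (a : fps) (z : C) : C :=
  \sum_(k < n.+1) a k * z ^+ k.

Definition fps_S (n : nat) (a : fps) : C -> C :=
  fps_sum n (iter n fps_deriv a).

(* The set W^(mu)(alpha), for a space V in which [S n f] stands for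
   S_n(f^(n)).  The supremum is that of a bounded set, as K is compact and the
   function continuous on K; it is 0 if K is empty. *)
Definition universal_set (V : Type) (S : nat -> V -> C -> C)
    (mu : nat -> nat) (alpha : nat -> C) : set V :=
  [set f | forall (K : set C) (h : C -> C),
    compact K -> connected (~` K) ->
    {within K, continuous h} -> holomorphic_on K^° h ->
    exists lam : nat -> nat,
      [/\ increasing_seq lam, range lam `<=` range mu &
          sup [set modulus (alpha (lam n) * S (lam n) f z - h z) | z in K]
            @[n --> \oo] --> (0 : R)]].

Definition infinite_dimensional (V : lmodType C) (F : set V) : Prop :=
  ~ exists n (v : 'I_n -> V), (forall i, F (v i)) /\
      forall u, F u -> exists c : 'I_n -> C, u = \sum_(i < n) c i *: v i.

Definition large_set (V : preTopologicalLmodType C) (W : set V) : Prop :=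
  [/\ dense W /\ Gdelta W,
      exists D : set V, [/\ submod_closed (mem D), dense D & D `\ 0 `<=` W] &
      exists F : set V, [/\ submod_closed (mem F), closed F,
        infinite_dimensional F & F `\ 0 `<=` W]].

End Spaces.

(* Main.v *)
(* Enumerate the polynomials with coefficients in Q(i) as p_0, p_1, ..., each
   one infinitely often, and let B_i be the polynomial, with coefficients
   between the indices n_i and 2 n_i, such that
   alpha_{n_i} S_{n_i}(B_i^(n_i)) = p_i.  As the terms r^n / (n! |alpha_n|)
   tend to 0 for r < R, one may choose the n_i in mu so sparse that the
   supports of the B_i are disjoint and that the sum of the B_i over any set of
   indices converges in H(D_R).  Since S_n(f^(n)) only reads the coefficients
   with indices in [n, 2n], such a sum is universal for polynomial
   approximation on closed discs as soon as the p_i, for i in the set, are dense.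
   Splitting the indices into infinitely many such classes, sums with one
   coefficient per class form an infinite-dimensional closed subspace, and
   polynomials plus one sum per class generate a dense subspace.

   The passage from polynomials on discs to continuous functions on K is
   Mergelyan's theorem.  Let f be a continuous, compactly supported extension of
   h, and let k_z(w) be 1 / (w - z), capped near its pole.  Summing over the
   squares Q of a grid of mesh d, the integrals of f k_z along the boundaries
   dQ add up to 0 and those of k_z to 2 pi i, so that -2 pi i f(z) is the sum of
   the integrals of (f(w) - f(z)) k_z(w) along the dQ.  For z far from Q such a
   term vanishes by Goursat's theorem if Q lies well inside K.  Otherwise it
   is matched to third order at infinity by a polynomial in a kernel built from
   a branch of sqrt((z - p) / (z - c)) with p and c off K, itself a uniform limit
   of polynomials on K; this branch plays the role usually given to the Koebe
   one-quarter theorem.  The errors are summable over the grid. *)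
Require Import Defs.
From mathcomp Require Import all_boot all_order all_algebra all_field all_solvable.
From mathcomp Require Import all_classical all_reals all_analysis.
From mathcomp Require Import ring lra zify.
From mathcomp.real_closed Require Import complex.
Set Implicit Arguments.
Unset Strict Implicit.
Unset Printing Implicit Defensive.
Import Order.TTheory GRing.Theory Num.Theory numFieldNormedType.Exports.
Local Open Scope classical_set_scope.
Local Open Scope ring_scope.

(** Why third order: about n cells lie at distance about n d from z, so a planar sum of (d / D)^2
    grows logarithmically as the mesh shrinks, whereas that of (d / D)^3 stays bounded. The total
    error is then an absolute constant times the oscillation of f at scale d, and tends to 0 with d.
    Capping the kernel makes every integrand continuous on the whole plane; the identities survive
    because each z in K stays away from the outer boundary of the grid. Mergelyan's theorem serves
    twice. It reduces universality to polynomial targets on closed discs and, applied to discs of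
    radius below r, it makes every element of H(D_r) a uniform limit of polynomials. Taylor
    coefficients are then controlled by passing to the limit in estimates for polynomials, which
    come from averages over roots of unity. Formal series and H(D_r) share one argument, carried out
    in an abstract space seen mainly through its coefficient functionals. *)

Section Modulus.
Variable R : realType.
Local Notation C := (Cplx R).

(** * The topology of C and derivatives through the real-valued modulus *)

Definition cpl (x y : R) : C := Complex x y.
Definition re (z : C) : R := complex.Re z.
Definition im (z : C) : R := complex.Im z.

Lemma reD (x y : C) : re (x + y) = re x + re y. Proof. by case: x; case: y. Qed.
Lemma imD (x y : C) : im (x + y) = im x + im y. Proof. by case: x; case: y. Qed.
Lemma reN (x : C) : re (- x) = - re x. Proof. by case: x. Qed.
Lemma imN (x : C) : im (- x) = - im x. Proof. by case: x. Qed.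
Lemma reB (x y : C) : re (x - y) = re x - re y. Proof. by rewrite reD reN. Qed.
Lemma imB (x y : C) : im (x - y) = im x - im y. Proof. by rewrite imD imN. Qed.
Lemma reM (x y : C) : re (x * y) = re x * re y - im x * im y.
Proof. by case: x; case: y. Qed.
Lemma imM (x y : C) : im (x * y) = re x * im y + im x * re y.
Proof. by case: x => a b; case: y => c d /=. Qed.
Lemma C_eqP (x y : C) : re x = re y -> im x = im y -> x = y.
Proof. by case: x => a b; case: y => c d /= -> ->. Qed.

Lemma normC_modulus (z : C) : `|z| = cpl (modulus z) 0.
Proof. by rewrite /modulus normc_def. Qed.

Lemma modulusE (z : C) : modulus z = Num.sqrt (re z ^+ 2 + im z ^+ 2).
Proof. by rewrite /modulus normc_def. Qed.

Lemma ltr_cpl (a b : R) : (cpl a 0 < cpl b 0) = (a < b).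
Proof. exact: ltcR. Qed.

Lemma ler_cpl (a b : R) : (cpl a 0 <= cpl b 0) = (a <= b).
Proof. exact: lecR. Qed.

Lemma ltC_re_im (a b : C) : (a < b) = (im b == im a) && (re a < re b).
Proof. exact: ltcE. Qed.

Lemma modulus_ge0 (z : C) : 0 <= modulus z.
Proof. by rewrite modulusE sqrtr_ge0. Qed.

Lemma modulus0 : modulus (0 : C) = 0.
Proof. by rewrite /modulus normr0. Qed.

Lemma modulus1 : modulus (1 : C) = 1.
Proof. by rewrite /modulus normr1. Qed.

Lemma modulus_eq0 (z : C) : (modulus z == 0) = (z == 0).
Proof.
rewrite -[z == 0]normr_eq0 (normC_modulus z).
by apply/eqP/eqP => [->|[]].
Qed.

Lemma modulus_gt0 (z : C) : (0 < modulus z) = (z != 0).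
Proof. by rewrite lt_def modulus_ge0 andbT modulus_eq0. Qed.

Lemma modulusM (x y : C) : modulus (x * y) = modulus x * modulus y.
Proof.
have : `|x * y| = `|x| * `|y| by rewrite normrM.
rewrite (normC_modulus (x * y)) (normC_modulus x) (normC_modulus y).
by move=> /(congr1 re); rewrite reM /= mulr0 subr0.
Qed.

Lemma modulusD (x y : C) : modulus (x + y) <= modulus x + modulus y.
Proof.
have : `|x + y| <= `|x| + `|y| by exact: ler_normD.
rewrite (normC_modulus (x + y)) (normC_modulus x) (normC_modulus y).
have -> : cpl (modulus x) 0 + cpl (modulus y) 0 = cpl (modulus x + modulus y) 0.
  by rewrite /cpl; congr Complex; rewrite /= ?addr0.
by rewrite ler_cpl.
Qed.

Lemma modulusN (x : C) : modulus (- x) = modulus x.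
Proof. by rewrite /modulus normrN. Qed.

Lemma modulusC (x y : C) : modulus (x - y) = modulus (y - x).
Proof. by rewrite -modulusN opprB. Qed.

Lemma modulusB (x y : C) : modulus (x - y) <= modulus x + modulus y.
Proof. by rewrite -(modulusN y); exact: modulusD. Qed.

Lemma modulusV (x : C) : modulus x^-1 = (modulus x)^-1.
Proof.
have [->|x0] := eqVneq x 0; first by rewrite invr0 modulus0 invr0.
have m0 : modulus x != 0 by rewrite modulus_eq0.
by apply: (mulfI m0); rewrite -modulusM divff // modulus1 divff.
Qed.

Lemma modulusX (x : C) n : modulus (x ^+ n) = modulus x ^+ n.
Proof. by elim: n => [|n IH]; rewrite ?expr0 ?modulus1 // !exprS modulusM IH. Qed.

Lemma modulus_triangle (y x z : C) :
  modulus (x - z) <= modulus (x - y) + modulus (y - z).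
Proof.
have -> : x - z = (x - y) + (y - z) by ring.
exact: modulusD.
Qed.

Lemma modulus_geB (x y : C) : modulus x - modulus y <= modulus (x - y).
Proof.
rewrite lerBlDr; have {1}-> : x = (x - y) + y by ring.
exact: modulusD.
Qed.

Lemma modulus_sum (I : Type) (s : seq I) (P : pred I) (F : I -> C) :
  modulus (\sum_(i <- s | P i) F i) <= \sum_(i <- s | P i) modulus (F i).
Proof.
apply: (big_ind2 (fun a b => modulus a <= b)) => //; first by rewrite modulus0.
by move=> a b c d h1 h2; apply: le_trans (modulusD _ _) _; exact: lerD.
Qed.

Lemma cplE (z : C) : z = cpl (re z) (im z). Proof. by case: z. Qed.

Lemma modulus_sqr (z : C) : modulus z ^+ 2 = re z ^+ 2 + im z ^+ 2.
Proof. by rewrite modulusE sqr_sqrtr // addr_ge0 // sqr_ge0. Qed.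

Lemma re_le_modulus (z : C) : `|re z| <= modulus z.
Proof.
rewrite -ler_sqr ?nnegrE ?modulus_ge0 // modulus_sqr -normrX ger0_norm ?sqr_ge0 //.
by rewrite lerDl sqr_ge0.
Qed.

Lemma im_le_modulus (z : C) : `|im z| <= modulus z.
Proof.
rewrite -ler_sqr ?nnegrE ?modulus_ge0 // modulus_sqr -normrX ger0_norm ?sqr_ge0 //.
by rewrite lerDr sqr_ge0.
Qed.

Lemma modulus_le_re_im (z : C) : modulus z <= `|re z| + `|im z|.
Proof.
rewrite -ler_sqr ?nnegrE ?modulus_ge0 ?addr_ge0 // modulus_sqr sqrrD.
by rewrite -(real_normK (num_real (re z))) -(real_normK (num_real (im z))) addrAC lerDl mulrn_wge0 // mulr_ge0.
Qed.

Lemma modulus_cpl0 (x : R) : modulus (cpl x 0) = `|x|.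
Proof. by rewrite modulusE /= expr0n addr0 sqrtr_sqr. Qed.

Lemma modulus_nat n : modulus (n%:R : C) = n%:R.
Proof.
have -> : (n%:R : C) = cpl n%:R 0; last by rewrite modulus_cpl0 ger0_norm.
elim: n => // n IH; rewrite -addn1 natrD IH natrD.
by apply: C_eqP => /=; rewrite ?addr0.
Qed.

Lemma nbhs_modulusP (z : C) (A : set C) :
  nbhs z A <-> exists2 e : R, 0 < e & forall y, modulus (y - z) < e -> A y.
Proof.
split.
- move=> /nbhs_ballP[e /= e0 H].
  (* Radii of balls are elements of C; positivity in the order of C forces them to be real. *)
  have Ie : im e = 0 by move: (e0); rewrite ltC_re_im /= => /andP[/eqP -> _].
  have Re0 : 0 < re e by move: (e0); rewrite ltC_re_im /= => /andP[_].
  exists (re e) => // y yz; apply: H; rewrite /ball /=.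
  by rewrite (cplE e) Ie normC_modulus ltr_cpl modulusC.
- move=> [e e0 H]; apply/nbhs_ballP; exists (cpl e 0) => /=.
    by have := ltr_cpl 0 e; rewrite e0.
  by move=> y; rewrite /ball /= normC_modulus ltr_cpl modulusC => /H.
Qed.

Lemma open_modulusP (A : set C) :
  open A <-> forall z, A z -> exists2 e : R, 0 < e & forall y, modulus (y - z) < e -> A y.
Proof.
rewrite openE; split=> H z Az; first exact/nbhs_modulusP/H.
by apply/nbhs_modulusP/H.
Qed.

Lemma continuous_modulusP (f : C -> C) (z : C) :
  {for z, continuous f} <-> forall e : R, 0 < e -> exists2 d : R, 0 < d &
    forall y, modulus (y - z) < d -> modulus (f y - f z) < e.
Proof.
split.
- move=> H e e0.
  have /H : nbhs (f z) [set y | modulus (y - f z) < e] by apply/nbhs_modulusP; exists e.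
  by move=> /nbhs_modulusP.
- move=> H A /nbhs_modulusP[e e0 HA]; apply/nbhs_modulusP.
  have [d d0 Hd] := H e e0; exists d => // y /Hd; exact: HA.
Qed.

Lemma within_continuous_modulusP (K : set C) (f : C -> C) :
  {within K, continuous f} <-> forall z, K z -> forall e : R, 0 < e -> exists2 d : R, 0 < d &
    forall y, K y -> modulus (y - z) < d -> modulus (f y - f z) < e.
Proof.
split=> [/subspace_continuousP H z Kz e e0|H].
- have /(H z Kz) : nbhs (f z) [set y | modulus (y - f z) < e] by apply/nbhs_modulusP; exists e.
  rewrite /= /nbhs /= /within /= => /nbhs_modulusP[d d0 Hd].
  by exists d => // y Ky /Hd /(_ Ky).
- apply/subspace_continuousP => z Kz A /nbhs_modulusP[e e0 HA].
  have [d d0 Hd] := H z Kz e e0.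
  rewrite /= /nbhs /= /within /=; apply/nbhs_modulusP.
  by exists d => // y yz Ky; apply/HA/Hd.
Qed.

Lemma modulus_continuous : continuous (@modulus R).
Proof.
move=> z A /nbhs_ballP[e /= e0 HA]; apply/nbhs_modulusP; exists e => // y yz.
apply: HA; rewrite /ball /=; apply: le_lt_trans yz.
rewrite ler_norml; apply/andP; split.
  by rewrite lerNl opprB; exact: modulus_geB.
by rewrite modulusC; exact: modulus_geB.
Qed.

Lemma re_continuous : continuous re.
Proof.
move=> z A /nbhs_ballP[e /= e0 HA]; apply/nbhs_modulusP; exists e => // y yz.
apply: HA; rewrite /ball /= -reB modulusC in yz *; apply: le_lt_trans yz.
exact: re_le_modulus.
Qed.

Lemma im_continuous : continuous im.
Proof.
move=> z A /nbhs_ballP[e /= e0 HA]; apply/nbhs_modulusP; exists e => // y yz.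
apply: HA; rewrite /ball /= -imB modulusC in yz *; apply: le_lt_trans yz.
exact: im_le_modulus.
Qed.

Lemma compact_modulus_bounded (K : set C) : compact K ->
  exists2 M : R, 0 < M & forall z, K z -> modulus z <= M.
Proof.
move=> cK.
have /compact_bounded [N [_ HN]] : compact (@modulus R @` K).
  by apply: continuous_compact => //; apply: continuous_subspaceT; exact: modulus_continuous.
have N1 : N < `|N| + 1 by rewrite (le_lt_trans (ler_norm N)) // ltrDl.
exists (`|N| + 1) => [|z Kz]; first by rewrite ltr_wpDl.
apply: le_trans (ler_norm _) _.
by apply: (HN _ N1); exists z.
Qed.

Definition cdisc (m : R) : set C := [set z | modulus z <= m].

Lemma closed_cdisc m : closed (cdisc m).
Proof.
have -> : cdisc m = @modulus R @^-1` [set x | x <= m] by [].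
apply: closed_comp; last exact: closed_le.
by move=> x _; exact: modulus_continuous.
Qed.

Lemma compact_cdisc m : compact (cdisc m).
Proof.
pose f (p : R * R) : C := cpl p.1 p.2.
have cf : continuous f.
  move=> [a b] A /nbhs_modulusP[e e0 HA].
  have e2 : 0 < e / 2 by rewrite divr_gt0.
  exists (ball a (e/2), ball b (e/2)); first by split; exact: nbhsx_ballx.
  move=> [x y] [/= hx hy]; apply: HA.
  apply: le_lt_trans (modulus_le_re_im _) _; rewrite reB imB /=.
  rewrite /ball /= in hx hy.
  rewrite distrC [X in _ + X]distrC [ltRHS](splitr e); exact: ltrD.
apply: (@subclosed_compact _ _ (f @` (`[-m, m] `*` `[-m, m]))).
- exact: closed_cdisc.
- apply: continuous_compact; first exact: continuous_subspaceT.
  by apply: compact_setX; exact: segment_compact.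
- move=> z; rewrite /cdisc /= => zm; exists (re z, im z); last by case: z zm.
  split; rewrite /= in_itv /= -ler_norml (le_trans _ zm) //.
  + exact: re_le_modulus.
  + exact: im_le_modulus.
Qed.

Definition has_deriv (f : C -> C) (z l : C) :=
  forall e : R, 0 < e -> exists2 d : R, 0 < d &
    forall y, modulus (y - z) < d ->
      modulus (f y - f z - l * (y - z)) <= e * modulus (y - z).

Lemma has_deriv_cvg (f : C -> C) (z l : C) :
  has_deriv f z l <-> (fun h => h^-1 *: (f (h + z) - f z)) @ 0^' --> l.
Proof.
have E h : h != 0 -> modulus (h^-1 *: (f (h + z) - f z) - l) * modulus h
    = modulus (f (h + z) - f z - l * ((h + z) - z)).
  move=> h0; rewrite -modulusM; congr modulus.
  by rewrite /GRing.scale /=; field.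
split.
- move=> H A /nbhs_modulusP[e e0 HA].
  have [d d0 Hd] := H (e / 2) (divr_gt0 e0 (ltr0Sn _ 1)).
  rewrite /nbhs /= /dnbhs /within /=; apply/nbhs_modulusP; exists d => // h.
  rewrite subr0 => hd h0; apply: HA.
  have hp : 0 < modulus h by rewrite modulus_gt0.
  have := Hd (h + z); rewrite -E // addrK => /(_ hd).
  rewrite ler_pM2r // => /le_lt_trans; apply.
  by rewrite ltr_pdivrMr // ltr_pMr // ltr1n.
- move=> H e e0.
  have /H : nbhs l [set y | modulus (y - l) < e] by apply/nbhs_modulusP; exists e.
  rewrite /nbhs /= /dnbhs /within /= => /nbhs_modulusP[d d0 Hd]; exists d => // y yz.
  have [->|ne] := eqVneq y z.
    by rewrite !subrr mulr0 subr0 modulus0 mulr0.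
  have h0 : y - z != 0 by rewrite subr_eq0.
  have hp : 0 < modulus (y - z) by rewrite modulus_gt0.
  have := Hd (y - z); rewrite subr0 => /(_ yz h0) /ltW.
  by rewrite -(ler_pM2r hp) E // subrK.
Qed.

Lemma derivable_has_derivP (f : C -> C) (z : C) :
  derivable f z 1 <-> exists l : C, has_deriv f z l.
Proof.
have E : (fun h : C => h^-1 *: ((f \o shift z) (h *: (1 : C)) - f z)) =
    (fun h : C => h^-1 *: (f (h + z) - f z)).
  by apply/funext => h /=; rewrite /GRing.scale /= mulr1.
rewrite /derivable E; split.
- by move=> /cvg_ex[l /has_deriv_cvg H]; exists l.
- by move=> [l /has_deriv_cvg H]; apply/cvg_ex; exists l.
Qed.

Lemma has_deriv_derive1 (f : C -> C) (z l : C) :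
  has_deriv f z l -> derive1 f z = l.
Proof. by move=> /has_deriv_cvg /cvg_lim; apply. Qed.

Lemma has_deriv_continuous (f : C -> C) (z l : C) :
  has_deriv f z l -> {for z, continuous f}.
Proof.
move=> H; apply/continuous_modulusP => e e0.
have [d d0 Hd] := H 1 ltr01.
pose K := modulus l + 1.
have K0 : 0 < K by rewrite ltr_wpDl ?modulus_ge0.
exists (Num.min d (e / K)); first by rewrite lt_min d0 divr_gt0.
move=> y; rewrite lt_min => /andP[/Hd h1 h2].
rewrite ltr_pdivlMr // in h2; apply: le_lt_trans h2.
have -> : f y - f z = (f y - f z - l * (y - z)) + l * (y - z) by ring.
apply: le_trans (modulusD _ _) _; rewrite modulusM.
by rewrite /K; lra.
Qed.
End Modulus.

(** * Uniform approximation by polynomials *)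

Section PolyApprox.
Variable R : realType.
Local Notation C := (Cplx R).
Implicit Types (K : set C) (f g u : C -> C).

Lemma exp2_small (B e : R) : 0 < e -> exists n, B * 2^-1 ^+ n < e.
Proof.
move=> e0; pose n := Num.truncn (`|B| / e).
exists n.+1; rewrite exprVn ltr_pdivrMr ?exprn_gt0 //.
apply: le_lt_trans (ler_norm _) _.
rewrite mulrC -ltr_pdivrMr //.
apply: lt_le_trans (_ : n.+1%:R <= _).
  by have /andP[] := truncn_itv (divr_ge0 (normr_ge0 B) (ltW e0)).
by rewrite -natrX ler_nat ltnW // ltn_expl.
Qed.

Definition poly_approx K f := forall e : R, 0 < e ->
  exists p : {poly C}, forall z, K z -> modulus (p.[z] - f z) < e.

Lemma poly_approx_lim K f :
  (forall e : R, 0 < e -> exists g, poly_approx K g /\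
    forall z, K z -> modulus (g z - f z) < e) -> poly_approx K f.
Proof.
move=> H e e0; have e2 : 0 < e / 2 by rewrite divr_gt0.
have [g [/(_ _ e2)[p Hp] Hg]] := H _ e2; exists p => z Kz.
apply: le_lt_trans (modulus_triangle (g z) _ _) _.
by rewrite [ltRHS]splitr ltrD ?Hp ?Hg.
Qed.

Lemma poly_approx_ext K f g :
  (forall z, K z -> f z = g z) -> poly_approx K f -> poly_approx K g.
Proof. by move=> E H e /H[p Hp]; exists p => z Kz; rewrite -E ?Hp. Qed.

Lemma poly_approx_horner K (p : {poly C}) : poly_approx K (horner p).
Proof. by move=> e e0; exists p => z _; rewrite subrr modulus0. Qed.

Lemma poly_approx_cst K (c : C) : poly_approx K (fun=> c).
Proof.
apply: poly_approx_ext (poly_approx_horner K c%:P) => z _.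
by rewrite hornerC.
Qed.

Lemma poly_approx_id K : poly_approx K (fun z => z).
Proof.
by apply: poly_approx_ext (poly_approx_horner K 'X) => z _; rewrite hornerX.
Qed.

Lemma poly_approxD K f g : poly_approx K f -> poly_approx K g ->
  poly_approx K (fun z => f z + g z).
Proof.
move=> Hf Hg e e0; have e2 : 0 < e / 2 by rewrite divr_gt0.
have [p Hp] := Hf _ e2; have [q Hq] := Hg _ e2; exists (p + q) => z Kz.
rewrite hornerD.
have -> : p.[z] + q.[z] - (f z + g z) = (p.[z] - f z) + (q.[z] - g z) by ring.
apply: le_lt_trans (modulusD _ _) _.
by rewrite [ltRHS]splitr ltrD ?Hp ?Hq.
Qed.

Lemma horner_bounded (p : {poly C}) (m : R) : 0 <= m ->
  exists2 B : R, 0 < B & forall z : C, modulus z <= m -> modulus p.[z] <= B.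
Proof.
move=> m0; elim/poly_ind : p => [|p c [B B0 HB]].
  by exists 1 => // z _; rewrite horner0 modulus0.
exists (B * m + modulus c + 1) => [|z zm].
  by rewrite ltr_wpDl // addr_ge0 ?modulus_ge0 // mulr_ge0 // ltW.
rewrite hornerMXaddC; apply: le_trans (modulusD _ _) _; rewrite modulusM.
have := ler_pM (modulus_ge0 _) (modulus_ge0 z) (HB z zm) zm; lra.
Qed.

Lemma poly_approx_bounded K f m : (forall z, K z -> modulus z <= m) ->
  poly_approx K f -> exists2 B : R, 0 < B & forall z, K z -> modulus (f z) <= B.
Proof.
move=> Km /(_ _ ltr01)[p Hp].
have [B B0 HB] := horner_bounded p (normr_ge0 m).
exists (B + 1) => [|z Kz]; first by rewrite addr_gt0.
have h1 := HB z (le_trans (Km z Kz) (ler_norm m)).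
have h2 := Hp z Kz; rewrite modulusC in h2.
have := modulus_geB (f z) p.[z]; lra.
Qed.

Lemma poly_approxM K f g m : (forall z, K z -> modulus z <= m) ->
  poly_approx K f -> poly_approx K g -> poly_approx K (fun z => f z * g z).
Proof.
move=> Km Hf Hg e e0.
have [B B0 HB] := poly_approx_bounded Km Hg.
have eB : 0 < e / 2 / B by rewrite !divr_gt0.
have [p Hp] := Hf _ eB.
have [A A0 HA] := poly_approx_bounded Km (poly_approx_horner K p).
have eA : 0 < e / 2 / A by rewrite !divr_gt0.
have [q Hq] := Hg _ eA; exists (p * q) => z Kz.
rewrite hornerM.
have -> : p.[z] * q.[z] - f z * g z = p.[z] * (q.[z] - g z) + (p.[z] - f z) * g z.
  by ring.
apply: le_lt_trans (modulusD _ _) _; rewrite !modulusM.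
rewrite [ltRHS]splitr; apply: ltr_leD.
  apply: le_lt_trans (ler_wpM2r (modulus_ge0 _) (HA z Kz)) _.
  by rewrite mulrC -ltr_pdivlMr // Hq.
apply: le_trans (ler_wpM2l (modulus_ge0 _) (HB z Kz)) _.
by rewrite -ler_pdivlMr // ltW // Hp.
Qed.

Lemma poly_approx_sum K (I : Type) (s : seq I) (P : pred I) (F : I -> C -> C) :
  (forall i, P i -> poly_approx K (F i)) ->
  poly_approx K (fun z => \sum_(i <- s | P i) F i z).
Proof.
move=> H; elim: s => [|i s IH].
  by apply: poly_approx_ext (poly_approx_cst K 0) => z _; rewrite big_nil.
have [Pi|nPi] := boolP (P i); last first.
  by apply: poly_approx_ext IH => z _; rewrite big_cons (negbTE nPi).
apply: poly_approx_ext (poly_approxD (H i Pi) IH) => z _.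
by rewrite big_cons Pi.
Qed.

(** The map t -> 1 + u t has fixed point (1 - u)^-1 and contracts by 1/2. Iterated n times from 0 it
    gives a polynomial expression in u with error at most 2 * 2^-n. *)
Lemma poly_approx_geom K u m : (forall z, K z -> modulus z <= m) ->
  poly_approx K u -> (forall z, K z -> modulus (u z) <= 2^-1) ->
  poly_approx K (fun z => (1 - u z)^-1).
Proof.
move=> Km Hu u2; apply: poly_approx_lim => e e0.
have [n Hn] := exp2_small 2 e0.
pose y k z := iter k (fun t => 1 + u z * t) 0.
exists (y n); split.
  elim: (n) => [|k IH]; first exact: poly_approx_cst.
  by apply: poly_approxD; [exact: poly_approx_cst|exact: (poly_approxM Km)].
move=> z Kz; apply: le_lt_trans Hn.
have h1 : 2^-1 <= modulus (1 - u z).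
  by have := modulus_geB 1 (u z); rewrite modulus1; have := u2 z Kz; lra.
have n0 : 1 - u z != 0 by rewrite -modulus_gt0; lra.
elim: (n) => [|k IH].
  rewrite expr0 mulr1 /y /= sub0r modulusN modulusV invf_ple ?posrE //; first lra.
rewrite /y iterS -/(y k z).
have -> : 1 + u z * y k z - (1 - u z)^-1 = u z * (y k z - (1 - u z)^-1) by field.
rewrite modulusM exprS mulrCA.
by apply: ler_pM => //; [exact: modulus_ge0|exact: modulus_ge0|exact: u2].
Qed.

Lemma complex_sqrt (w : C) : exists2 s : C, s ^+ 2 = w & 0 <= re s.
Proof.
have [h|/ltW h] := leP 0 (re (sqrtC w)); first by exists (sqrtC w); rewrite ?sqrtCK.
by exists (- sqrtC w); rewrite ?sqrrN ?sqrtCK // reN oppr_ge0.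
Qed.

Lemma re1 : re (1 : C) = 1. Proof. by []. Qed.
Lemma re_le (z : C) : re z <= modulus z.
Proof. exact: le_trans (ler_norm _) (re_le_modulus z). Qed.
Lemma re_geN (z : C) : - modulus z <= re z.
Proof. by have := re_le_modulus z; rewrite ler_norml => /andP[]. Qed.

(** The root s with nonnegative real part has |s + 1| >= 1, whence |s - 1| <= |s^2 - 1| = |u|. Then
    s - 1 is a fixed point of t -> (u - t^2) / 2, whose iterates from 0 are polynomial expressions
    in u and stay in the disc of radius 1/2. *)
Lemma poly_approx_sqrt K u m : (forall z, K z -> modulus z <= m) ->
  poly_approx K u -> (forall z, K z -> modulus (u z) <= 2^-1) ->
  exists2 s, poly_approx K s &
    forall z, K z -> s z ^+ 2 = 1 + u z /\ modulus (s z - 1) <= 2^-1.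
Proof.
move=> Km Hu u2.
have /choice[s Hs] : forall z, exists s : C, s ^+ 2 = 1 + u z /\ 0 <= re s.
  by move=> z; have [s ? ?] := complex_sqrt (1 + u z); exists s.
have s1 z : K z -> modulus (s z - 1) <= 2^-1.
  move=> Kz; have [E r0] := Hs z.
  have h : (s z - 1) * (s z + 1) = u z.
    by apply: (@addIr _ 1); rewrite [RHS]addrC -E; ring.
  have := u2 z Kz; rewrite -h modulusM => h2.
  have h3 : 1 <= modulus (s z + 1).
    by apply: le_trans (re_le _); rewrite reD re1 lerDr.
  apply: le_trans h2; rewrite ler_peMr ?modulus_ge0 //.
exists s; last by move=> z Kz; split; [exact: (Hs z).1|exact: s1].
apply: poly_approx_lim => e e0.
have [n Hn] := exp2_small 1 e0.
pose y k z := iter k (fun t => (u z - t ^+ 2) / 2) (0 : C).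
have n2 : (2 : C) != 0 by rewrite pnatr_eq0.
have m2 : modulus (2^-1 : C) = 2^-1 by rewrite modulusV modulus_nat.
exists (fun z => 1 + y n z); split.
  apply: poly_approxD; first exact: poly_approx_cst.
  elim: (n) => [|k IH]; first exact: poly_approx_cst.
  have H := poly_approxM Km IH IH.
  have H2 := poly_approxM Km (poly_approxD Hu
     (poly_approxM Km (poly_approx_cst K (-1)) H)) (poly_approx_cst K 2^-1).
  by apply: poly_approx_ext H2 => z _; rewrite /y iterS -/(y k z); ring.
move=> z Kz; apply: le_lt_trans Hn; rewrite mul1r.
have [E _] := Hs z.
suff : modulus (1 + y n z - s z) <= 2^-1 ^+ n /\ modulus (y n z) <= 2^-1 by case.
elim: (n) => [|k [IH1 IH2]].
  rewrite /y /= modulus0 addr0 modulusC expr0; split; last by lra.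
  by apply: le_trans (s1 z Kz) _; lra.
rewrite /y iterS -/(y k z); split; last first.
  rewrite modulusM m2.
  have := modulusB (u z) (y k z ^+ 2); rewrite modulusX.
  have := u2 z Kz.
  have : modulus (y k z) ^+ 2 <= 2^-1 ^+ 2 by rewrite ler_sqr ?nnegrE ?modulus_ge0 //; lra.
  have -> : (2^-1 : R) ^+ 2 = 4^-1 by field.
  lra.
(* The factor (y + (s - 1)) / 2 has modulus at most 1/2, so each iteration halves the error. *)
have -> : 1 + (u z - y k z ^+ 2) / 2 - s z =
  - (1 + y k z - s z) * ((y k z + (s z - 1)) / 2).
  have -> : u z = s z ^+ 2 - 1 by rewrite E; ring.
  by field.
rewrite modulusM modulusN exprS mulrC; apply: ler_pM => //; try exact: modulus_ge0.
rewrite modulusM m2 ler_piMl //.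
by have := modulusD (y k z) (s z - 1); have := s1 z Kz; lra.
Qed.
End PolyApprox.

(** * Square roots and Cauchy kernels off a compact set *)

Section Kernel.
Variable R : realType.
Local Notation C := (Cplx R).
Implicit Types (K : set C).

(** Propagation by short steps: the first condition on steps makes X open, the second makes its
    complement in A open. *)
Lemma connected_clopen (A X : set C) : connected A -> open A -> X `<=` A -> X !=set0 ->
  (forall p, X p -> exists2 e : R, 0 < e & forall q, A q -> modulus (q - p) < e -> X q) ->
  (forall p, A p -> exists2 e : R, 0 < e & forall q, X q -> modulus (q - p) < e -> X p) ->
  X = A.
Proof.
move=> cA oA XA X0 HX HA; apply: cA => //.
- exists X; last by rewrite setIidr.
  apply/open_modulusP => p Xp; have [e e0 He] := HX p Xp.
  have /open_modulusP/(_ p (XA _ Xp))[d d0 Hd] := oA.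
  exists (Num.min d e) => [|q]; first by rewrite lt_min d0.
  by rewrite lt_min => /andP[/Hd Aq qe]; exact: He.
- exists (~` (A `\` X)); last first.
    apply/seteqP; split=> [x Xx|x [Ax]]; first by split; [exact: XA|case].
    by move=> /not_andP[//|/contrapT].
  apply: open_closedC; apply/open_modulusP => p [Ap nXp].
  have [e e0 He] := HA p Ap.
  have /open_modulusP/(_ p Ap)[d d0 Hd] := oA.
  exists (Num.min d e) => [|q]; first by rewrite lt_min d0.
  rewrite lt_min => /andP[/Hd Aq qe]; split=> // Xq; exact: nXp (He q Xq qe).
Qed.

Variable K : set C.
Hypothesis cK : compact K.
Hypothesis cnK : connected (~` K).

Lemma open_compactC : open (~` K).
Proof.
apply: closed_openC; apply: compact_closed => //; exact: norm_hausdorff.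
Qed.

Lemma compact_dist p : ~ K p ->
  exists2 e : R, 0 < e & forall z, K z -> e <= modulus (z - p).
Proof.
have /open_modulusP H := open_compactC.
move=> /H[e e0 He]; exists e => // z Kz.
by rewrite leNgt; apply/negP => /He.
Qed.

Lemma compact_far (M : R) : exists2 p, ~ K p & M <= modulus p.
Proof.
have [B B0 HB] := compact_modulus_bounded cK.
have h : modulus (cpl (`|M| + B + 1) 0) = `|M| + B + 1.
  by rewrite modulus_cpl0 ger0_norm // !addr_ge0 // ltW.
exists (cpl (`|M| + B + 1) 0).
  by move=> /HB; rewrite h; have := normr_ge0 M; lra.
by rewrite h; have := ler_norm M; lra.
Qed.

(** 1 / (z - q) is 1 / (z - p) times 1 / (1 - u) with u = (q - p) / (z - p), a geometric series on
    K. *)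
Lemma poly_approx_pole_step p q : ~ K p ->
  (forall z, K z -> modulus (q - p) <= 2^-1 * modulus (z - p)) ->
  poly_approx K (fun z => (z - p)^-1) -> poly_approx K (fun z => (z - q)^-1).
Proof.
move=> nKp H Hp.
have [m m0 Km] := compact_modulus_bounded cK.
have zp z : K z -> z - p != 0.
  by move=> Kz; rewrite subr_eq0; apply/eqP => E; apply: nKp; rewrite -E.
pose u z : C := (q - p) * (z - p)^-1.
have Hu : poly_approx K u by apply: (poly_approxM Km) Hp; exact: poly_approx_cst.
have u2 z : K z -> modulus (u z) <= 2^-1.
  move=> Kz; rewrite modulusM modulusV ler_pdivrMr ?H //.
  by rewrite modulus_gt0 zp.
apply: poly_approx_ext (poly_approxM Km Hp (poly_approx_geom Km Hu u2)) => z Kz.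
have zp0 := zp z Kz; rewrite -invfM; congr (_^-1).
by rewrite /u; field.
Qed.

(** Runge's pole pushing: the good poles form a nonempty set stable under short moves in both
    directions, so they fill the connected complement of K. *)
Lemma poly_approx_pole p : ~ K p -> poly_approx K (fun z => (z - p)^-1).
Proof.
have [m m0 Km] := compact_modulus_bounded cK.
pose X : set C := [set p | ~ K p /\ poly_approx K (fun z => (z - p)^-1)].
suff E : X = ~` K.
  move=> Kp; have : X p by rewrite E.
  by move=> [].
have dist (p' : C) : ~ K p' -> exists2 e : R, 0 < e & forall q, ~ K q -> modulus (q - p') < e ->
    (forall z, K z -> modulus (q - p') <= 2^-1 * modulus (z - p')) /\
    (forall z, K z -> modulus (p' - q) <= 2^-1 * modulus (z - q)).
  (* With e / 3, the point q keeps distance at least 2 e / 3 from K, so the step is allowed from p'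
     to q and from q to p'. *)
  move=> /compact_dist[e e0 He]; exists (e / 3) => [|q _ hq]; first by rewrite divr_gt0.
  split=> z Kz; have := He z Kz; first by lra.
  have := modulus_triangle q z p'; rewrite (modulusC p'); lra.
apply: connected_clopen => //.
- exact: open_compactC.
- by move=> ? [].
(* Start from a pole beyond twice the radius of K, where 1 / (z - p') is a geometric series in z /
   p'. *)
- have [p' nKp hp] := compact_far (2 * m); exists p'; split=> //.
  have p0 : p' != 0 by rewrite -modulus_gt0; lra.
  pose u (z : C) : C := p'^-1 * z.
  have Hu : poly_approx K u.
    by apply: (poly_approxM Km); [exact: poly_approx_cst|exact: poly_approx_id].
  have u2 z : K z -> modulus (u z) <= 2^-1.
    move=> Kz; rewrite modulusM modulusV mulrC ler_pdivrMr ?modulus_gt0 //.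
    by have := Km z Kz; lra.
  have H := poly_approxM Km (poly_approx_cst K (- p'^-1)) (poly_approx_geom Km Hu u2).
  apply: poly_approx_ext H => z Kz.
  have zp : z - p' != 0 by rewrite subr_eq0; apply/eqP => E; apply: nKp; rewrite -E.
  have n1 : 1 - u z != 0.
    rewrite -modulus_gt0; have := modulus_geB 1 (u z); rewrite modulus1.
    by have := u2 z Kz; lra.
  have -> : z - p' = - p' * (1 - u z) by rewrite /u; field.
  by rewrite invfM invrN.
- move=> p' [nKp Hp]; have [e e0 He] := dist p' nKp; exists e => // q nKq hq.
  split=> //; apply: poly_approx_pole_step Hp => //.
  exact: (He q nKq hq).1.
- move=> p' nKp; have [e e0 He] := dist p' nKp; exists e => // q [nKq Hq] hq.
  split=> //; apply: poly_approx_pole_step Hq => //.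
  exact: (He q nKq hq).2.
Qed.

(* [s] is the branch of sqrt((z - p) / (z - c)) cut along a path in the disc
   D(c, r) from c to p off K, and equal to 1 at infinity. *)
Definition sqrt_branch (c : C) (r : R) (p : C) (s : C -> C) :=
  poly_approx K s /\ forall z, K z -> s z ^+ 2 * (z - c) = z - p /\
    (r <= modulus (z - c) -> 0 < re (s z)).

(** A number and its square both have positive real part when it lies in the open sector |arg| < pi
    / 4; the product of two such numbers stays in the right half-plane. *)
Lemma re_gt0_mul (a b : C) : 0 < re a -> 0 < re (a ^+ 2) -> 0 < re b ->
  0 < re (b ^+ 2) -> 0 < re (a * b).
Proof.
have H (x y : R) : 0 < x -> 0 < x * x - y * y -> `|y| < x.
  by move=> x0 h; rewrite ltr_norml; apply/andP; split; nra.
rewrite !expr2 !reM => a0 /(H _ _ a0) ha b0 /(H _ _ b0) hb.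
rewrite subr_gt0; apply: le_lt_trans (ler_norm _) _; rewrite normrM.
exact: ltr_pM.
Qed.

(** The branch is multiplied by the square root near 1 of (z - q) / (z - p) = 1 + u. For r <= |z -
    c| both factors and their squares have positive real part, so the product keeps the right
    sign. *)
Lemma sqrt_branch_step c r p q s : ~ K p -> ~ K c ->
  (forall z, K z -> modulus (q - p) <= 2^-1 * modulus (z - p)) ->
  modulus (p - c) < r ->
  sqrt_branch c r p s -> exists s', sqrt_branch c r q s'.
Proof.
move=> nKp nKc H pr [Hs s2].
have [m m0 Km] := compact_modulus_bounded cK.
have zp z : K z -> z - p != 0.
  by move=> Kz; rewrite subr_eq0; apply/eqP => E; apply: nKp; rewrite -E.
have zc z : K z -> z - c != 0.
  by move=> Kz; rewrite subr_eq0; apply/eqP => E; apply: nKc; rewrite -E.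
pose u z : C := (p - q) * (z - p)^-1.
have Hu : poly_approx K u.
  by apply: (poly_approxM Km) (poly_approx_pole nKp); exact: poly_approx_cst.
have u2 z : K z -> modulus (u z) <= 2^-1.
  move=> Kz; rewrite modulusM modulusV ler_pdivrMr ?modulus_gt0 ?zp //.
  by rewrite modulusC H.
have [t Ht t2] := poly_approx_sqrt Km Hu u2.
exists (fun z => s z * t z); split; first exact: (poly_approxM Km).
move=> z Kz; have [e1 e2] := s2 z Kz; have [e3 e4] := t2 z Kz.
have zp0 := zp z Kz; have zc0 := zc z Kz.
split.
  rewrite exprMn e3 -mulrA (mulrC (1 + _)) mulrA e1 /u.
  by field.
move=> rz; apply: re_gt0_mul.
- exact: e2.
- have -> : s z ^+ 2 = 1 - (p - c) / (z - c).
    by apply: (mulIf zc0); rewrite e1; field.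
  rewrite reB re1 subr_gt0; apply: le_lt_trans (re_le _) _.
  rewrite modulusM modulusV ltr_pdivrMr ?modulus_gt0 // mul1r.
  exact: lt_le_trans rz.
- have -> : t z = 1 + (t z - 1) by ring.
  rewrite reD re1; have := re_geN (t z - 1); lra.
- rewrite e3 reD re1; have := re_geN (u z); have := u2 z Kz; lra.
Qed.

(** If no reachable endpoint lay in the annulus r / 2 <= |p - c| < r, the reachable set would stay
    in D(c, r / 2), hence be open and closed in the complement of K and equal to it, although that
    complement is unbounded. The distance from c to the endpoint is what later bounds the kernel. *)
Lemma sqrt_branch_exists c r : ~ K c -> 0 < r ->
  exists p s, [/\ ~ K p, r / 2 <= modulus (p - c) < r & sqrt_branch c r p s].
Proof.
move=> nKc r0; apply: contrapT => Hno.
pose X : set C := [set p | [/\ ~ K p, modulus (p - c) < r & exists s, sqrt_branch c r p s]].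
have X2 p : X p -> modulus (p - c) < r / 2.
  move=> [nKp pr [s Hs]]; rewrite ltNge; apply/negP => h.
  by apply: Hno; exists p, s; rewrite h.
have dist (p' : C) : ~ K p' -> exists2 e : R, 0 < e & forall q, ~ K q -> modulus (q - p') < e ->
    [/\ (forall z, K z -> modulus (q - p') <= 2^-1 * modulus (z - p')),
    (forall z, K z -> modulus (p' - q) <= 2^-1 * modulus (z - q)) & modulus (q - p') < r / 2].
  (* Steps shorter than r / 2 taken from D(c, r / 2) remain in D(c, r). *)
  move=> /compact_dist[e e0 He]; exists (Num.min (e / 3) (r / 2)) => [|q _].
    by rewrite lt_min !divr_gt0.
  rewrite lt_min => /andP[hq hr]; split=> // z Kz; have := He z Kz; first by lra.
  have := modulus_triangle q z p'; rewrite (modulusC p'); lra.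
suff E : X = ~` K.
  have [p nKp hp] := compact_far (modulus c + r).
  have /X2 : X p by rewrite E.
  have := modulus_geB p c; lra.
apply: connected_clopen => //.
- exact: open_compactC.
- by move=> ? [].
- exists c; split=> //; first by rewrite subrr modulus0.
  exists (fun=> 1); split; first exact: poly_approx_cst.
  by move=> z _; rewrite expr1n mul1r re1 ltr01.
- move=> p Xp; have [nKp pr [s Hs]] := Xp.
  have [e e0 He] := dist p nKp; exists e => // q nKq hq.
  have [h1 h2 h3] := He q nKq hq; split=> //; last exact: sqrt_branch_step Hs.
  have := modulus_triangle p q c; have := X2 p Xp; lra.
- move=> p nKp; have [e e0 He] := dist p nKp; exists e => // q Xq hq.
  have [nKq qr [s Hs]] := Xq.
  have [h1 h2 h3] := He q nKq hq; split=> //; last by apply: sqrt_branch_step Hs.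
  have := modulus_triangle q p c; have := X2 q Xq; rewrite (modulusC p q); lra.
Qed.

(* Approximates the Cauchy kernel 1 / (z - m) to third order away from c while
   staying bounded near c. *)
Lemma cauchy_kernel_approx c r : ~ K c -> 0 < r ->
  exists m G, [/\ modulus (m - c) <= r / 2, poly_approx K G,
    forall z, K z -> modulus (G z) <= 96 / r &
    forall z, K z -> r <= modulus (z - c) ->
      modulus (G z) <= 4 / modulus (z - c) /\
      modulus (G z - (z - m)^-1) <= 2 * r ^+ 2 / modulus (z - c) ^+ 3].
Proof.
move=> nKc r0; have [b [s [nKb /andP[b1 b2] [Hs s2]]]] := sqrt_branch_exists nKc r0.
have [M M0 KM] := compact_modulus_bounded cK.
have n2 : (2 : C) != 0 by rewrite pnatr_eq0.
have m2 : modulus (2 : C) = 2 by rewrite modulus_nat.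
(* With m the midpoint and d the half difference, (z - c) * (z - b) = w^2 - d^2, so [S] is a branch
   of the square root of w^2 - d^2. *)
pose m : C := (c + b) / 2; pose d : C := (b - c) / 2.
have md : modulus d = modulus (b - c) / 2 by rewrite modulusM modulusV m2.
have d0 : d != 0 by rewrite -modulus_gt0 md divr_gt0 //; lra.
pose w (z : C) := z - m.
pose S z : C := s z * (z - c).
(* As (w - S) * (w + S) = d^2, this is 2 / (w + S), which differs from 1 / w by d^2 / (w * (w +
   S)^2), a term of third order. Written without a denominator in z, it is a limit of polynomials on
   K and stays bounded near c. *)
pose G z : C := 2 / d ^+ 2 * (w z - S z).
have Hid (a : C) : poly_approx K (fun z => z - a).
  by apply: poly_approxD; [exact: poly_approx_id|exact: poly_approx_cst].
have prod z : K z -> (w z - S z) * (w z + S z) = d ^+ 2.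
  move=> Kz; have [e _] := s2 z Kz.
  by rewrite -subr_sqr /S exprMn (expr2 (z - c)) mulrA e /w /m /d; field.
have mc : modulus (m - c) = modulus d.
  by congr modulus; rewrite /m /d; field.
have far : forall z, K z -> r <= modulus (z - c) ->
      modulus (G z) <= 4 / modulus (z - c) /\
      modulus (G z - (z - m)^-1) <= 2 * r ^+ 2 / modulus (z - c) ^+ 3.
  move=> z Kz rz; have [e1 /(_ rz) e2] := s2 z Kz.
  set D := modulus (z - c) in rz *.
  have D0 : 0 < D by lra.
  have zc : z - c != 0 by rewrite -modulus_gt0.
  have wS : D / 2 <= modulus (w z + S z).
    have -> : w z + S z = (z - c) * (1 + s z - (m - c) / (z - c)).
      by rewrite /w /S; field.
    rewrite modulusM -/D ler_pM2l //.
    apply: le_trans (re_le _); rewrite reB reD re1.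
    have := re_le ((m - c) / (z - c)); rewrite modulusM modulusV -/D mc md.
    have h : modulus (b - c) / 2 / D <= 2^-1 by rewrite ler_pdivrMr //; lra.
    by lra.
  have wm : D / 2 <= modulus (w z).
    have -> : w z = (z - c) - (m - c) by rewrite /w; ring.
    by have := modulus_geB (z - c) (m - c); rewrite mc md -/D; lra.
  have wS0 : w z + S z != 0 by rewrite -modulus_gt0; lra.
  have w0 : w z != 0 by rewrite -modulus_gt0; lra.
  have GE : G z = 2 / (w z + S z).
    by apply: (mulIf wS0); rewrite /G -(mulrA (2 / _)) prod //; field; rewrite ?wS0 ?d0.
  have D2 : 0 < D / 2 by lra.
  split.
    rewrite GE modulusM modulusV m2.
    apply: (@le_trans _ _ (2 / (D / 2))).
      by rewrite ler_pM2l // lef_pV2 // posrE; lra.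
    by rewrite le_eqVlt; apply/orP; left; apply/eqP; field; lra.
  have -> : G z - (z - m)^-1 = d ^+ 2 / (w z * (w z + S z) ^+ 2).
    by rewrite -(prod z Kz) GE -/(w z); field; rewrite wS0.
  rewrite modulusM modulusV modulusM !modulusX md.
  have h1 : (D / 2) * (D / 2) ^+ 2 <= modulus (w z) * modulus (w z + S z) ^+ 2.
    apply: ler_pM => //; try lra; first exact: sqr_ge0.
    by rewrite ler_sqr ?nnegrE; lra.
  have h2 : (modulus (b - c) / 2) ^+ 2 <= (r / 2) ^+ 2.
    by rewrite ler_sqr ?nnegrE; lra.
  have h3 : 0 < (D / 2) * (D / 2) ^+ 2 by rewrite mulr_gt0 // exprn_gt0.
  have h4 : (modulus (w z) * modulus (w z + S z) ^+ 2)^-1 <= ((D / 2) * (D / 2) ^+ 2)^-1.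
    by rewrite lef_pV2 // posrE // (lt_le_trans h3).
  have h5 : 0 <= (modulus (w z) * modulus (w z + S z) ^+ 2)^-1.
    by rewrite invr_ge0 mulr_ge0 ?modulus_ge0 // sqr_ge0.
  apply: le_trans (ler_pM (sqr_ge0 _) h5 h2 h4) _.
  by rewrite le_eqVlt; apply/orP; left; apply/eqP; field; lra.
exists m, G; split.
- by rewrite mc md; lra.
- apply: (poly_approxM KM); first exact: poly_approx_cst.
  have H := poly_approxM KM (poly_approx_cst K (-1)) (poly_approxM KM Hs (Hid c)).
  by apply: poly_approx_ext (poly_approxD (Hid m) H) => z _; rewrite mulN1r.
- move=> z Kz; have [rz|zr] := leP r (modulus (z - c)); last first.
    have wm : modulus (w z) <= 3 / 2 * r.
      have -> : w z = (z - c) - (m - c) by rewrite /w; ring.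
      by have := modulusB (z - c) (m - c); rewrite mc md; lra.
    have Sm : modulus (S z) <= 3 / 2 * r.
      (* |S|^2 = |z - c| |z - b| <= r * (2 r), which is below (3 / 2 * r)^2. *)
      rewrite -ler_sqr ?nnegrE ?modulus_ge0 ?mulr_ge0 ?ltW //.
      rewrite -modulusX /S exprMn (expr2 (z - c)) mulrA (s2 z Kz).1 modulusM.
      have -> : z - b = (z - c) - (b - c) by ring.
      have h1 := modulusB (z - c) (b - c).
      have := ler_pM (modulus_ge0 _) (modulus_ge0 (z - c)) h1 (ltW zr).
      nra.
    rewrite modulusM modulusM modulusV modulusX m2 md.
    have h1 : modulus (w z - S z) <= 3 * r by have := modulusB (w z) (S z); lra.
    (* |d| >= r / 4, which leads to 2 * (4 / r)^2 * (3 r) = 96 / r. *)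
    have h2 : (r / 4) ^+ 2 <= (modulus (b - c) / 2) ^+ 2.
      by rewrite ler_sqr ?nnegrE; lra.
    have h3 : 0 < (r / 4) ^+ 2 by rewrite exprn_gt0 // divr_gt0.
    have h4 : 2 / (modulus (b - c) / 2) ^+ 2 <= 2 / (r / 4) ^+ 2.
      by rewrite ler_pM2l // lef_pV2 // posrE // (lt_le_trans h3).
    have h5 : 0 <= 2 / (modulus (b - c) / 2) ^+ 2.
      by rewrite divr_ge0 // sqr_ge0.
    apply: le_trans (ler_pM h5 (modulus_ge0 _) h4 h1) _.
    rewrite le_eqVlt; apply/orP; left; apply/eqP; field; lra.
  apply: le_trans (far z Kz rz).1 _.
  have zc0 : 0 < modulus (z - c) by lra.
  apply: (@le_trans _ _ (4 / r)); first by rewrite ler_pM2l // lef_pV2.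
  by rewrite ler_pM2r ?invr_gt0 //; lra.
- exact: far.
Qed.

End Kernel.

(** * Contour integrals along rectangles *)

Section RealIntegral.
Variable R : realType.
Implicit Types (f g : R -> R) (a b c : R).

Definition rint a b f : R := \int[@lebesgue_measure R]_(x in `[a, b]) f x.

Lemma rint_integrable a b f : continuous f ->
  (@lebesgue_measure R).-integrable `[a, b] (EFin \o f).
Proof.
move=> cf; apply: continuous_compact_integrable; first exact: segment_compact.
exact: continuous_subspaceT.
Qed.

Lemma rintD a b f g : continuous f -> continuous g ->
  rint a b (fun x => f x + g x) = rint a b f + rint a b g.
Proof. by move=> cf cg; apply: RintegralD => //; exact: rint_integrable. Qed.

Lemma rintZ a b f (k : R) : continuous f ->
  rint a b (fun x => k * f x) = k * rint a b f.
Proof. by move=> cf; apply: RintegralZl => //; exact: rint_integrable. Qed.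

Lemma rint_cst a b (k : R) : a <= b -> rint a b (fun=> k) = k * (b - a).
Proof.
move=> ab; rewrite /rint Rintegral_cst //=.
rewrite lebesgue_measure_itv /= lte_fin.
by case: ltrP ab => // h1 h2; have -> : a = b by [apply: le_anti; rewrite h1 h2]; rewrite subrr.
Qed.

Lemma rint_ext a b f g : (forall x, a <= x <= b -> f x = g x) ->
  rint a b f = rint a b g.
Proof.
by move=> E; apply: eq_Rintegral => x /set_mem /=; rewrite in_itv /=; exact: E.
Qed.

Lemma rint_split c a b f : continuous f -> a <= c -> c <= b ->
  rint a b f = rint a c f + rint c b f.
Proof.
move=> cf ac cb.
have E : rint a b f - rint a c f = rint c b f; last by rewrite -E addrC subrK.
rewrite /rint Rintegral_itvB.
- rewrite Rintegral_itv_obnd_cbnd //.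
  apply: integrableS (rint_integrable a b cf) => //.
  move=> x /=; rewrite !in_itv /= => /andP[h1 ->]; rewrite andbT.
  exact: le_trans ac (ltW h1).
- exact: rint_integrable.
- by rewrite bnd_simp.
- by rewrite bnd_simp.
Qed.

Lemma rint_le a b f g : continuous f -> continuous g -> 
  (forall x, a <= x <= b -> f x <= g x) -> rint a b f <= rint a b g.
Proof.
by move=> cf cg H; apply: le_Rintegral => //; exact: rint_integrable.
Qed.

Lemma rint_bound a b f (k : R) : continuous f -> a <= b ->
  (forall x, a <= x <= b -> `|f x| <= k) -> `|rint a b f| <= k * (b - a).
Proof.
move=> cf ab H.
have ck (c : R) : continuous (fun _ : R => c) by move=> x; exact: cvg_cst.
rewrite ler_norml -mulNr -!rint_cst //; apply/andP; split; apply: rint_le => // x.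
- by move=> /H; rewrite ler_norml => /andP[].
- by move=> /H; rewrite ler_norml => /andP[].
Qed.

End RealIntegral.

Section RectIntegral.
Variable R : realType.
Local Notation C := (Cplx R).
Implicit Types (f g : C -> C) (a b c x y : R).

Definition cint a b (f : R -> C) : C :=
  cpl (rint a b (fun t => re (f t))) (rint a b (fun t => im (f t))).

(** The contour integral of f(z) dz along the boundary, counterclockwise: bottom minus top, plus i
    times right minus left. *)
Definition rect x0 x1 y0 y1 f : C :=
  cint x0 x1 (fun x => f (cpl x y0)) - cint x0 x1 (fun x => f (cpl x y1)) +
  cpl 0 1 * (cint y0 y1 (fun y => f (cpl x1 y)) - cint y0 y1 (fun y => f (cpl x0 y))).

Lemma cplhE y : continuous (fun x => cpl x y : C).
Proof.
move=> x A /nbhs_modulusP[e e0 HA]; apply/nbhs_ballP; exists e => //= t.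
rewrite /ball /= distrC => ht; apply: HA; apply: le_lt_trans ht.
by apply: le_trans (modulus_le_re_im _) _; rewrite reB imB /= subrr normr0 addr0.
Qed.

Lemma cplvE x : continuous (fun y => cpl x y : C).
Proof.
move=> y A /nbhs_modulusP[e e0 HA]; apply/nbhs_ballP; exists e => //= t.
rewrite /ball /= distrC => ht; apply: HA; apply: le_lt_trans ht.
by apply: le_trans (modulus_le_re_im _) _; rewrite reB imB /= subrr normr0 add0r.
Qed.

Lemma continuous_re (f : R -> C) : continuous f -> continuous (fun t => re (f t)).
Proof. by move=> cf t; apply: continuous_comp (cf t) _; exact: re_continuous. Qed.

Lemma continuous_im (f : R -> C) : continuous f -> continuous (fun t => im (f t)).
Proof. by move=> cf t; apply: continuous_comp (cf t) _; exact: im_continuous. Qed.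

Lemma cont_h f y : continuous f -> continuous (fun x => f (cpl x y)).
Proof. by move=> cf x; apply: continuous_comp (@cplhE y x) _; exact: cf. Qed.

Lemma cont_v f x : continuous f -> continuous (fun y => f (cpl x y)).
Proof. by move=> cf y; apply: continuous_comp (@cplvE x y) _; exact: cf. Qed.

Lemma cintD a b (f g : R -> C) : continuous f -> continuous g ->
  cint a b (fun t => f t + g t) = cint a b f + cint a b g.
Proof.
move=> cf cg; apply: C_eqP; rewrite ?reD ?imD /= -rintD; try exact: continuous_re;
  try exact: continuous_im.
- by congr rint; apply/funext => t; rewrite reD.
- by congr rint; apply/funext => t; rewrite imD.
Qed.

Lemma cintZ a b (f : R -> C) (k : C) : continuous f ->
  cint a b (fun t => k * f t) = k * cint a b f.
Proof.
move=> cf.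
have cr := continuous_re cf; have ci := continuous_im cf.
have cZ (l : R) (h : R -> R) : continuous h -> continuous (fun t => l * h t).
  by move=> ch t; apply: continuousM; [exact: cvg_cst|exact: ch].
apply: C_eqP; rewrite ?reM ?imM /=.
- transitivity (rint a b (fun t => re k * re (f t) + (- im k) * im (f t))).
    by congr rint; apply/funext => t; rewrite reM mulNr.
  by rewrite rintD ?rintZ ?mulNr //; exact: cZ.
- transitivity (rint a b (fun t => re k * im (f t) + im k * re (f t))).
    by congr rint; apply/funext => t; rewrite imM.
  by rewrite rintD ?rintZ //; exact: cZ.
Qed.

Lemma cint_cst a b (k : C) : a <= b -> cint a b (fun=> k) = k * cpl (b - a) 0.
Proof.
move=> ab; apply: C_eqP; rewrite /= rint_cst ?reM ?imM //= mulr0.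
  by rewrite subr0.
by rewrite add0r.
Qed.

Lemma cint_ext a b (f g : R -> C) : (forall t, a <= t <= b -> f t = g t) ->
  cint a b f = cint a b g.
Proof. by move=> E; congr cpl; apply: rint_ext => t /E ->. Qed.

Lemma cint_split c a b (f : R -> C) : continuous f -> a <= c -> c <= b ->
  cint a b f = cint a c f + cint c b f.
Proof.
move=> cf ac cb; apply: C_eqP; rewrite ?reD ?imD /=; apply: rint_split => //.
- exact: continuous_re.
- exact: continuous_im.
Qed.

(** The factor 2 comes from bounding real and imaginary parts separately. *)
Lemma cint_bound a b (f : R -> C) (k : R) : continuous f -> a <= b ->
  (forall t, a <= t <= b -> modulus (f t) <= k) ->
  modulus (cint a b f) <= 2 * k * (b - a).
Proof.
move=> cf ab H; apply: le_trans (modulus_le_re_im _) _ => /=.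
rewrite -mulrA mulr_natl mulr2n; apply: lerD; apply: rint_bound => //.
- exact: continuous_re.
- by move=> t /H; apply: le_trans; exact: re_le_modulus.
- exact: continuous_im.
- by move=> t /H; apply: le_trans; exact: im_le_modulus.
Qed.

Lemma rectD x0 x1 y0 y1 f g : continuous f -> continuous g ->
  rect x0 x1 y0 y1 (fun z => f z + g z) = rect x0 x1 y0 y1 f + rect x0 x1 y0 y1 g.
Proof.
move=> cf cg; rewrite /rect !cintD; try exact: cont_h; try exact: cont_v.
by ring.
Qed.

Lemma rectZ x0 x1 y0 y1 (k : C) f : continuous f ->
  rect x0 x1 y0 y1 (fun z => k * f z) = k * rect x0 x1 y0 y1 f.
Proof.
move=> cf; rewrite /rect !cintZ; try exact: cont_h; try exact: cont_v.
by ring.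
Qed.

Definition in_rect x0 x1 y0 y1 (z : C) := (x0 <= re z <= x1) && (y0 <= im z <= y1).

Definition on_rect x0 x1 y0 y1 (z : C) := in_rect x0 x1 y0 y1 z &&
  [|| re z == x0, re z == x1, im z == y0 | im z == y1].

Lemma rect_ext x0 x1 y0 y1 f g : x0 <= x1 -> y0 <= y1 ->
  (forall z, on_rect x0 x1 y0 y1 z -> f z = g z) ->
  rect x0 x1 y0 y1 f = rect x0 x1 y0 y1 g.
Proof.
move=> x01 y01 E; congr (_ - _ + _ * (_ - _)); apply: cint_ext => t ht; apply: E;
  by rewrite /on_rect /in_rect /= ?ht ?lexx ?eqxx ?orbT ?x01 ?y01.
Qed.

Lemma rect_bound x0 x1 y0 y1 f (k : R) : continuous f -> x0 <= x1 -> y0 <= y1 ->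
  (forall z, on_rect x0 x1 y0 y1 z -> modulus (f z) <= k) ->
  modulus (rect x0 x1 y0 y1 f) <= 4 * k * ((x1 - x0) + (y1 - y0)).
Proof.
move=> cf x01 y01 H; rewrite /rect.
have m1 : modulus (cpl 0 1 : C) = 1.
  by rewrite modulusE /= expr0n add0r expr1n sqrtr1.
apply: le_trans (modulusD _ _) _; rewrite modulusM m1 mul1r.
have h1 := modulusB (cint x0 x1 (fun x => f (cpl x y0))) (cint x0 x1 (fun x => f (cpl x y1))).
have h2 := modulusB (cint y0 y1 (fun y => f (cpl x1 y))) (cint y0 y1 (fun y => f (cpl x0 y))).
have b1 : modulus (cint x0 x1 (fun x => f (cpl x y0))) <= 2 * k * (x1 - x0).
  apply: cint_bound => // [|t ht]; first exact: cont_h.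
  by apply: H; rewrite /on_rect /in_rect /= ?ht ?lexx ?eqxx ?orbT ?x01 ?y01.
have b2 : modulus (cint x0 x1 (fun x => f (cpl x y1))) <= 2 * k * (x1 - x0).
  apply: cint_bound => // [|t ht]; first exact: cont_h.
  by apply: H; rewrite /on_rect /in_rect /= ?ht ?lexx ?eqxx ?orbT ?x01 ?y01.
have b3 : modulus (cint y0 y1 (fun y => f (cpl x1 y))) <= 2 * k * (y1 - y0).
  apply: cint_bound => // [|t ht]; first exact: cont_v.
  by apply: H; rewrite /on_rect /in_rect /= ?ht ?lexx ?eqxx ?orbT ?x01 ?y01.
have b4 : modulus (cint y0 y1 (fun y => f (cpl x0 y))) <= 2 * k * (y1 - y0).
  apply: cint_bound => // [|t ht]; first exact: cont_v.
  by apply: H; rewrite /on_rect /in_rect /= ?ht ?lexx ?eqxx ?orbT ?x01 ?y01.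
lra.
Qed.

Lemma rect_splitx x x0 x1 y0 y1 f : continuous f -> x0 <= x -> x <= x1 ->
  rect x0 x1 y0 y1 f = rect x0 x y0 y1 f + rect x x1 y0 y1 f.
Proof.
move=> cf h0 h1; rewrite /rect.
rewrite (@cint_split x x0 x1 (fun x => f (cpl x y0))) //; last exact: cont_h.
rewrite (@cint_split x x0 x1 (fun x => f (cpl x y1))) //; last exact: cont_h.
by ring.
Qed.

Lemma rect_splity y x0 x1 y0 y1 f : continuous f -> y0 <= y -> y <= y1 ->
  rect x0 x1 y0 y1 f = rect x0 x1 y0 y f + rect x0 x1 y y1 f.
Proof.
move=> cf h0 h1; rewrite /rect.
rewrite (@cint_split y y0 y1 (fun y => f (cpl x0 y))) //; last exact: cont_v.
rewrite (@cint_split y y0 y1 (fun y => f (cpl x1 y))) //; last exact: cont_v.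
by ring.
Qed.

Lemma rect_cst x0 x1 y0 y1 (k : C) : rect x0 x1 y0 y1 (fun=> k) = 0.
Proof. by rewrite /rect !subrr mulr0 addr0. Qed.

Lemma continuous_idC : continuous (fun z : C => z).
Proof. by move=> z; exact: cvg_id. Qed.

Lemma rect_id x0 x1 y0 y1 : x0 <= x1 -> y0 <= y1 ->
  rect x0 x1 y0 y1 (fun z => z) = 0.
Proof.
move=> x01 y01.
have Eh : cint x0 x1 (fun x => cpl x y1) =
    cint x0 x1 (fun x => cpl x y0) + cpl 0 (y1 - y0) * cpl (x1 - x0) 0.
  rewrite -cint_cst // -cintD; [|exact: cplhE|exact: cst_continuous].
  by apply: cint_ext => t _; apply: C_eqP => /=; ring.
have Ev : cint y0 y1 (fun y => cpl x1 y) =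
    cint y0 y1 (fun y => cpl x0 y) + cpl (x1 - x0) 0 * cpl (y1 - y0) 0.
  rewrite -cint_cst // -cintD; [|exact: cplvE|exact: cst_continuous].
  by apply: cint_ext => t _; apply: C_eqP => /=; ring.
rewrite /rect Eh Ev.
have -> : cpl 0 (y1 - y0) = cpl 0 1 * cpl (y1 - y0) 0 :> C.
  by apply: C_eqP; rewrite ?reM ?imM /=; ring.
by ring.
Qed.

Lemma rect_affine x0 x1 y0 y1 (k l : C) : x0 <= x1 -> y0 <= y1 ->
  rect x0 x1 y0 y1 (fun z => k + l * z) = 0.
Proof.
move=> x01 y01; rewrite rectD; last 2 first.
- exact: cst_continuous.
- by move=> z; apply: continuousM; [exact: cst_continuous|exact: continuous_idC].
by rewrite rect_cst rectZ ?rect_id ?mulr0 ?addr0 //; exact: continuous_idC.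
Qed.

End RectIntegral.

Section ContinuousC.
Variable R : realType.
Local Notation C := (Cplx R).

Lemma continuous_addC (f g : C -> C) : continuous f -> continuous g ->
  continuous (fun z => f z + g z).
Proof.
move=> cf cg z; apply/continuous_modulusP => e e0.
have e2 : 0 < e / 2 by rewrite divr_gt0.
have /continuous_modulusP/(_ _ e2)[d1 d10 H1] := cf z.
have /continuous_modulusP/(_ _ e2)[d2 d20 H2] := cg z.
exists (Num.min d1 d2); first by rewrite lt_min d10.
move=> y; rewrite lt_min => /andP[/H1 h1 /H2 h2].
have -> : f y + g y - (f z + g z) = (f y - f z) + (g y - g z) by ring.
by have := modulusD (f y - f z) (g y - g z); lra.
Qed.

Lemma continuous_mulC (f g : C -> C) : continuous f -> continuous g ->
  continuous (fun z => f z * g z).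
Proof. by move=> cf cg z; apply: continuousM; [exact: cf|exact: cg]. Qed.

Lemma continuous_cstC (c : C) : continuous (fun _ : C => c).
Proof. exact: cst_continuous. Qed.

End ContinuousC.

(** * Goursat's theorem for rectangles *)

Section Goursat.
Variable R : realType.
Local Notation C := (Cplx R).
Implicit Types (f g : C -> C) (a b c x y : R).

(* q = ((x0, x1), (y0, y1)) encodes the rectangle [x0, x1] x [y0, y1]. *)
Local Notation box := ((R * R) * (R * R))%type.
Let size_box (q : box) := (q.1.2 - q.1.1) + (q.2.2 - q.2.1).
Let ibox f (q : box) := rect q.1.1 q.1.2 q.2.1 q.2.2 f.
Let half_box (q q' : box) := [/\ q.1.1 <= q'.1.1, q'.1.2 <= q.1.2,
  q.2.1 <= q'.2.1, q'.2.2 <= q.2.2 & size_box q' = size_box q / 2].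
Let bad f e q := [/\ q.1.1 <= q.1.2, q.2.1 <= q.2.2 &
  e * size_box q ^+ 2 < modulus (ibox f q)].

(** Halving the sides divides the squared size by 4, so if all four quarters obeyed the bound, the
    whole box would too. *)
Let bad_half f e q : continuous f -> bad f e q -> exists q', bad f e q' /\ half_box q q'.
Proof.
case: q => [[x0 x1] [y0 y1]] cf [/= x01 y01]; rewrite /ibox /size_box /= => H.
pose x := (x0 + x1) / 2; pose y := (y0 + y1) / 2.
have x0x : x0 <= x by rewrite /x; lra.
have xx1 : x <= x1 by rewrite /x; lra.
have y0y : y0 <= y by rewrite /y; lra.
have yy1 : y <= y1 by rewrite /y; lra.
have E : rect x0 x1 y0 y1 f =
    (rect x0 x y0 y f + rect x0 x y y1 f) + (rect x x1 y0 y f + rect x x1 y y1 f).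
  by rewrite (rect_splitx _ _ cf x0x xx1) (rect_splity _ _ cf y0y yy1) (rect_splity x x1 cf y0y yy1).
pose ok (q : box) := e * size_box q ^+ 2 < modulus (ibox f q).
have [h1|h1] := boolP (ok ((x0, x), (y0, y))).
  exists ((x0, x), (y0, y)); split; split => //=.
  by rewrite /size_box /= /x /y; field.
have [h2|h2] := boolP (ok ((x0, x), (y, y1))).
  exists ((x0, x), (y, y1)); split; split => //=.
  by rewrite /size_box /= /x /y; field.
have [h3|h3] := boolP (ok ((x, x1), (y0, y))).
  exists ((x, x1), (y0, y)); split; split => //=.
  by rewrite /size_box /= /x /y; field.
have [h4|h4] := boolP (ok ((x, x1), (y, y1))).
  exists ((x, x1), (y, y1)); split; split => //=.
  by rewrite /size_box /= /x /y; field.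
move: h1 h2 h3 h4; rewrite /ok /ibox /size_box /= -!leNgt => h1 h2 h3 h4.
exfalso.
have k1 := modulusD (rect x0 x y0 y f + rect x0 x y y1 f) (rect x x1 y0 y f + rect x x1 y y1 f).
have k2 := modulusD (rect x0 x y0 y f) (rect x0 x y y1 f).
have k3 := modulusD (rect x x1 y0 y f) (rect x x1 y y1 f).
rewrite -E in k1.
have s1 : x - x0 = (x1 - x0) / 2 by rewrite /x; field.
have s2 : x1 - x = (x1 - x0) / 2 by rewrite /x; field.
have s3 : y - y0 = (y1 - y0) / 2 by rewrite /y; field.
have s4 : y1 - y = (y1 - y0) / 2 by rewrite /y; field.
rewrite ?s1 ?s2 ?s3 ?s4 in h1 h2 h3 h4.
have s : ((x1 - x0) / 2 + (y1 - y0) / 2) ^+ 2 = (x1 - x0 + (y1 - y0)) ^+ 2 / 4 by field.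
rewrite s in h1 h2 h3 h4.
lra.
Qed.

Lemma goursat x0 x1 y0 y1 f : continuous f -> x0 <= x1 -> y0 <= y1 ->
  (forall z, in_rect x0 x1 y0 y1 z -> exists l, has_deriv f z l) ->
  rect x0 x1 y0 y1 f = 0.
Proof.
move=> cf x01 y01 Hd.
apply/eqP; rewrite -modulus_eq0; apply/eqP/le_anti; rewrite modulus_ge0 andbT.
apply/ler_addgt0Pl => e0 e0p; rewrite addr0.
pose S := size_box ((x0, x1), (y0, y1)).
have S0 : 0 <= S by rewrite /S /size_box /=; lra.
(* The summand 1 covers a degenerate rectangle, where S = 0. *)
pose e := e0 / (S + 1) ^+ 2.
have ep : 0 < e by rewrite divr_gt0 // exprn_gt0 //; lra.
have eS : e * S ^+ 2 <= e0.
  rewrite /e -mulrA ler_piMr ?(ltW e0p) // mulrC ler_pdivrMr ?exprn_gt0 //; last lra.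
  by rewrite mul1r ler_sqr ?nnegrE //; lra.
apply: le_trans eS; rewrite leNgt; apply/negP => Hbad.
have /choice[st Hst] : forall q, exists q', bad f e q -> bad f e q' /\ half_box q q'.
  move=> q; have [Hb|nb] := pselect (bad f e q); last by exists q.
  by have [q' ?] := bad_half cf Hb; exists q'.
pose Q n := iter n st ((x0, x1), (y0, y1)).
have QB n : bad f e (Q n).
  by elim: n => [|n IH]; [split|rewrite /Q iterS; case: (Hst _ IH)].
have QH n : half_box (Q n) (Q n.+1) by rewrite /Q iterS; case: (Hst _ (QB n)).
have Qs n : size_box (Q n) = S * 2^-1 ^+ n.
  elim: n => [|n IH]; first by rewrite mulr1.
  by have [_ _ _ _ ->] := QH n; rewrite IH exprSr mulrA.
have mono (m n : nat) : (m <= n)%N -> [/\ (Q m).1.1 <= (Q n).1.1, (Q n).1.2 <= (Q m).1.2,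
   (Q m).2.1 <= (Q n).2.1 & (Q n).2.2 <= (Q m).2.2].
  elim: n => [|n IH]; first by rewrite leqn0 => /eqP ->.
  rewrite leq_eqVlt => /predU1P[->//|]; rewrite ltnS => /IH[a1 a2 a3 a4].
  have [b1 b2 b3 b4 _] := QH n; split; [exact: le_trans b1|exact: le_trans a2|
    exact: le_trans b3|exact: le_trans a4].
have lim (l u : nat -> R) : (forall m n, l m <= u n) -> exists X, forall n, l n <= X <= u n.
  move=> lu; have hs : has_sup (range l).
    by split; [exists (l 0%N), 0%N|exists (u 0%N) => _ [m _ <-]].
  exists (sup (range l)) => n; apply/andP; split; first by apply: sup_upper_bound => //; exists n.
  by apply: ge_sup; [case: hs|move=> _ [m _ <-]].
have [X HX] : exists X, forall n, (Q n).1.1 <= X <= (Q n).1.2.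
  apply: lim => m n; have [k _ _] := QB (maxn m n).
  have [a1 _ _ _] := mono _ _ (leq_maxl m n).
  have [_ a2 _ _] := mono _ _ (leq_maxr m n); lra.
have [Y HY] : exists X, forall n, (Q n).2.1 <= X <= (Q n).2.2.
  apply: lim => m n; have [_ k _] := QB (maxn m n).
  have [_ _ a1 _] := mono _ _ (leq_maxl m n).
  have [_ _ _ a2] := mono _ _ (leq_maxr m n); lra.
pose z := cpl X Y : C.
have [l Hl] : exists l, has_deriv f z l.
  by apply: Hd; rewrite /in_rect /=; have := HX 0%N; have := HY 0%N => /= -> ->.
have e4 : 0 < e / 4 by rewrite divr_gt0.
have [d d0 Hd'] := Hl _ e4.
have [n Hn] := exp2_small S d0.
have [k1 k2 k3] := QB n.
set q := Q n in k1 k2 k3.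
(* Near z, f is affine up to e / 4 times the distance. The affine part integrates to 0, and the
   factor 4 of [rect_bound] turns the rest into e times the squared size, against [bad]. *)
pose g (w : C) := f w + ((- (f z - l * z)) + (- l) * w).
have ca : continuous (fun w : C => - (f z - l * z) + (- l) * w).
  apply: continuous_addC; first exact: continuous_cstC.
  by apply: continuous_mulC; [exact: continuous_cstC|exact: continuous_idC].
have cg : continuous g by exact: continuous_addC.
have Ig : rect q.1.1 q.1.2 q.2.1 q.2.2 g = ibox f q.
  by rewrite /g (rectD _ _ _ _ cf ca) rect_affine ?addr0 //.
have B : modulus (rect q.1.1 q.1.2 q.2.1 q.2.2 g) <= 4 * (e / 4 * size_box q) * size_box q.
  apply: rect_bound => // w /andP[/andP[/andP[w1 w2] /andP[w3 w4]] _].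
  have wz : modulus (w - z) <= size_box q.
    apply: le_trans (modulus_le_re_im _) _; rewrite reB imB /= /size_box.
    have /andP[X1 X2] := HX n; have /andP[Y1 Y2] := HY n; rewrite -/q in X1 X2 Y1 Y2.
    apply: lerD; rewrite ler_norml; apply/andP; split; lra.
  have -> : g w = f w - f z - l * (w - z) by rewrite /g; ring.
  apply: le_trans (Hd' w _) _; last by rewrite ler_pM2l.
  by apply: le_lt_trans wz _; rewrite Qs.
move: k3; rewrite -Ig ltNge => /negP; apply; apply: le_trans B _.
by rewrite le_eqVlt; apply/orP; left; apply/eqP; field.
Qed.
End Goursat.

(** * Contour integrals of the capped Cauchy kernel *)

Section CauchyKernel.
Variable R : realType.
Local Notation C := (Cplx R).
Implicit Types (f g : C -> C).

Lemma derivable_mulC f g (z : C) :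
  derivable f z 1 -> derivable g z 1 -> derivable (fun w => f w * g w) z 1.
Proof. exact: derivableM. Qed.

Lemma derivable_subC (a z : C) : derivable (fun w => w - a) z 1.
Proof.
apply: derivableB; first exact: derivable_id.
exact: derivable_cst.
Qed.

Lemma derivable_invC (a z : C) : z - a != 0 -> derivable (fun w => (w - a)^-1) z 1.
Proof. by move=> za; apply: derivableV => //; exact: derivable_subC. Qed.

Lemma derivable_nearC f g (z : C) (d : R) : 0 < d ->
  (forall y, modulus (y - z) < d -> f y = g y) -> derivable f z 1 -> derivable g z 1.
Proof.
move=> d0 E; apply: near_eq_derivable; apply/nbhs_modulusP.
by exists d.
Qed.

(* The Cauchy kernel [1 / (w - z)], capped at distance d of its pole. *)
Definition capped (d : R) (z w : C) : C :=
  cpl (re (w - z)) (- im (w - z)) * cpl (Num.max (modulus (w - z) ^+ 2) (d ^+ 2))^-1 0.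

Let cj_modulus (u : C) : modulus (cpl (re u) (- im u)) = modulus u.
Proof. by rewrite !modulusE /= sqrrN. Qed.

Let max_gt0 d (u : C) : 0 < d -> 0 < Num.max (modulus u ^+ 2) (d ^+ 2).
Proof. by move=> d0; rewrite lt_max orbC exprn_gt0. Qed.

Lemma capped_out (d : R) (z w : C) : 0 < d -> d <= modulus (w - z) -> capped d z w = (w - z)^-1.
Proof.
move=> d0 h; rewrite /capped.
have m0 : 0 < modulus (w - z) by exact: lt_le_trans h.
have u0 : w - z != 0 by rewrite -modulus_gt0.
rewrite max_l ?ler_sqr ?nnegrE ?modulus_ge0 ?(ltW d0) //.
apply: (mulIf u0); rewrite mulVf //.
have n0 : re (w - z) ^+ 2 + im (w - z) ^+ 2 != 0.
  by rewrite -modulus_sqr gt_eqF // exprn_gt0.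
by apply: C_eqP; rewrite !(reM, imM) /= modulus_sqr; move: (re (w - z)) (im (w - z)) n0 => a b n0; field.
Qed.

Lemma capped_bound (d : R) (z w : C) : 0 < d -> modulus (capped d z w) <= d^-1.
Proof.
move=> d0; rewrite /capped modulusM cj_modulus modulus_cpl0.
have M0 := max_gt0 (w - z) d0.
rewrite ger0_norm ?invr_ge0 ?(ltW M0) // ler_pdivrMr //.
rewrite mulrC ler_pdivlMr // le_max.
have [h|/ltW h] := leP d (modulus (w - z)); apply/orP; [left|right].
  by rewrite expr2 ler_pM2l // (lt_le_trans d0).
by rewrite expr2 ler_pM2r.
Qed.

Lemma continuous_capped (d : R) (z : C) : 0 < d -> continuous (capped d z).
Proof.
move=> d0; apply: continuous_mulC => w.
- apply/continuous_modulusP => e e0; exists e => // y.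
  have -> : cpl (re (y - z)) (- im (y - z)) - cpl (re (w - z)) (- im (w - z)) =
            cpl (re (y - w)) (- im (y - w)).
    by apply: C_eqP; rewrite !(reD, imD, reN, imN) /= ?(reD, imD, reN, imN); ring.
  by rewrite cj_modulus.
- have h : {for w, continuous (fun y => (Num.max (modulus (y - z) ^+ 2) (d ^+ 2))^-1)}.
    have cm : {for w, continuous (fun y => modulus (y - z))}.
      apply: (@continuous_comp _ _ _ (fun y : C => y - z) (@modulus R)); last exact: modulus_continuous.
      have [l H] := (derivable_has_derivP (fun y => y - z) w).1 (@derivable_subC z w).
      exact: has_deriv_continuous H.
    apply: (@continuous_comp _ _ _ (fun y : C => modulus (y - z))
      (fun t : R => (Num.max (t ^+ 2) (d ^+ 2))^-1)) => //.
    apply: continuousV; first by rewrite gt_eqF // max_gt0.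
    apply: (@continuous_max _ _ (fun t : R => t ^+ 2) (fun=> d ^+ 2)).
      exact: exprn_continuous.
    exact: cst_continuous.
  apply: (@continuous_comp _ _ _ (fun y => (Num.max (modulus (y - z) ^+ 2) (d ^+ 2))^-1)
     (fun x => cpl x 0)); first exact: h.
  exact: cplhE.
Qed.

Lemma derivable_capped (d : R) (z w : C) : 0 < d -> d < modulus (w - z) -> derivable (capped d z) w 1.
Proof.
move=> d0 dw; apply: (@derivable_nearC (fun y => (y - z)^-1) _ w (modulus (w - z) - d)).
- by rewrite subr_gt0.
- move=> y yw; rewrite capped_out //.
  have -> : y - z = (w - z) - (w - y) by ring.
  have := modulus_geB (w - z) (w - y); rewrite (modulusC w y); lra.
- by apply: derivable_invC; rewrite -modulus_gt0; lra.
Qed.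

Lemma goursat_derivable (x0 x1 y0 y1 : R) f : continuous f -> x0 <= x1 -> y0 <= y1 ->
  (forall z, in_rect x0 x1 y0 y1 z -> derivable f z 1) -> rect x0 x1 y0 y1 f = 0.
Proof.
by move=> cf h1 h2 H; apply: goursat => // z /H/derivable_has_derivP.
Qed.

(** The primitive atan ((x - a) / s) runs from - pi / 4 to pi / 4. This is the contribution of one
    side of a square centred at the pole. *)
Lemma rint_atan (a s : R) : 0 < s ->
  rint (a - s) (a + s) (fun x => s / ((x - a) ^+ 2 + s ^+ 2)) = pi / 2.
Proof.
move=> s0; have s2 : 0 < s ^+ 2 by rewrite exprn_gt0.
have p0 x : 0 < (x - a) ^+ 2 + s ^+ 2 by rewrite ltr_wpDl // sqr_ge0.
have dF (x : R) : is_derive x 1 (fun x => atan ((x - a) / s)) (s / ((x - a) ^+ 2 + s ^+ 2)).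
  have dg : is_derive x 1 ((id - cst a) * cst s^-1 : R -> R) s^-1.
    by apply: is_derive_eq; rewrite /GRing.scale /= mulr0 add0r subr0 mulr1.
  have H := @is_derive1_comp R atan ((id - cst a) * cst s^-1) x _ _
    (is_derive1_atan ((x - a) / s)) dg.
  apply: is_derive_eq H _.
  have h : (x - a) ^+ 2 + s ^+ 2 != 0 by rewrite gt_eqF.
  have hs : s != 0 by rewrite gt_eqF.
  have -> : 1 + ((x - a) / s) ^+ 2 = ((x - a) ^+ 2 + s ^+ 2) / s ^+ 2 by field.
  rewrite invfM invrK; field.
  by rewrite hs h.
rewrite /rint /Rintegral (@continuous_FTC2 _ _ (fun x => atan ((x - a) / s))).
- rewrite /=.
  have -> : (a + s - a) / s = 1 by field; rewrite gt_eqF.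
  have -> : (a - s - a) / s = - 1 by field; rewrite gt_eqF.
  by rewrite atanN atan1; field.
- lra.
- apply: continuous_subspaceT => x.
  apply: (@continuous_comp _ _ _ (fun x => x - a) (fun t => s / (t ^+ 2 + s ^+ 2))).
    by apply: continuousB; [exact: cvg_id|exact: cvg_cst].
  apply: continuousM; first exact: cvg_cst.
  apply: continuousV; first by rewrite gt_eqF.
  by apply: continuousD; [exact: exprn_continuous|exact: cvg_cst].
- have ca (x : R) : {for x, continuous (fun x => atan ((x - a) / s))}.
    apply: differentiable_continuous; apply/derivable1_diffP.
    by have [] := dF x.
  split.
  + by move=> x _; have [] := dF x.
  + by apply: cvg_at_right_filter; exact: ca.
  + by apply: cvg_at_left_filter; exact: ca.
- by move=> x _; rewrite derive1E; have [_ ->] := dF x.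
Qed.

Lemma cappedE (d : R) (z w : C) : 0 < d -> d <= modulus (w - z) ->
  capped d z w = cpl (re (w - z) / (re (w - z) ^+ 2 + im (w - z) ^+ 2))
                   (- im (w - z) / (re (w - z) ^+ 2 + im (w - z) ^+ 2)).
Proof.
move=> d0 h; rewrite /capped max_l ?ler_sqr ?nnegrE ?modulus_ge0 ?(ltW d0) //.
by rewrite modulus_sqr; apply: C_eqP; rewrite !(reM, imM) /= ?mulr0 ?subr0 ?add0r.
Qed.

(** Opposite sides cancel in the real part, and the imaginary part consists of four arctangent
    integrals pi / 2. *)
Lemma rect_capped_square (d s : R) (z : C) : 0 < d -> d <= s ->
  rect (re z - s) (re z + s) (im z - s) (im z + s) (capped d z) = cpl 0 (2 * pi).
Proof.
move=> d0 ds; have s0 : 0 < s by exact: lt_le_trans ds.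
set a := re z; set b := im z.
pose p (t : R) := t ^+ 2 + s ^+ 2.
have hm (w : C) : re w = a - s \/ re w = a + s \/ im w = b - s \/ im w = b + s ->
    d <= modulus (w - z).
  move=> H; apply: le_trans ds _.
  have h1 := le_trans (ler_norm _) (re_le_modulus (w - z)).
  have h2 := le_trans (ler_norm _) (im_le_modulus (w - z)).
  have h3 := le_trans (ler_norm _) (re_le_modulus (z - w)).
  have h4 := le_trans (ler_norm _) (im_le_modulus (z - w)).
  rewrite (modulusC z w) in h3 h4; rewrite !(reB, imB) -/a -/b in h1 h2 h3 h4.
  by case: H => [H|[H|[H|H]]]; rewrite H in h1 h2 h3 h4; lra.
have bs : b - s - b = - s by ring.
have bS : b + s - b = s by ring.
have as_ : a - s - a = - s by ring.
have aS : a + s - a = s by ring.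
have cB : cint (a - s) (a + s) (fun x => capped d z (cpl x (b - s))) =
    cint (a - s) (a + s) (fun x => cpl ((x - a) / p (x - a)) (s / p (x - a))).
  apply: cint_ext => x _; rewrite cappedE //; last by apply: hm => /=; tauto.
  by rewrite !(reB, imB) /= -/a -/b bs sqrrN opprK.
have cT : cint (a - s) (a + s) (fun x => capped d z (cpl x (b + s))) =
    cint (a - s) (a + s) (fun x => cpl ((x - a) / p (x - a)) (- s / p (x - a))).
  apply: cint_ext => x _; rewrite cappedE //; last by apply: hm => /=; tauto.
  by rewrite !(reB, imB) /= -/a -/b bS.
have cR : cint (b - s) (b + s) (fun y => capped d z (cpl (a + s) y)) =
    cint (b - s) (b + s) (fun y => cpl (s / p (y - b)) (- (y - b) / p (y - b))).
  apply: cint_ext => x _; rewrite cappedE //; last by apply: hm => /=; tauto.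
  by rewrite !(reB, imB) /= -/a -/b aS /p (addrC (s ^+ 2)).
have cL : cint (b - s) (b + s) (fun y => capped d z (cpl (a - s) y)) =
    cint (b - s) (b + s) (fun y => cpl (- s / p (y - b)) (- (y - b) / p (y - b))).
  apply: cint_ext => x _; rewrite cappedE //; last by apply: hm => /=; tauto.
  by rewrite !(reB, imB) /= -/a -/b as_ sqrrN /p (addrC (s ^+ 2)).
have cont (c : R) : continuous (fun x => s / p (x - c)).
  move=> x; apply: (@continuous_comp _ _ _ (fun x => x - c) (fun t => s / p t)).
    by apply: continuousB; [exact: cvg_id|exact: cvg_cst].
  apply: continuousM; first exact: cvg_cst.
  apply: continuousV; first by rewrite gt_eqF // /p ltr_wpDl ?sqr_ge0 // exprn_gt0.
  by apply: continuousD; [exact: exprn_continuous|exact: cvg_cst].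
have IN (c : R) : rint (c - s) (c + s) (fun x => - s / p (x - c)) = - (pi / 2).
  rewrite -(rint_atan c s0) -[RHS]mulN1r -rintZ //; last exact: cont.
  by congr rint; apply/funext => x; rewrite mulN1r mulNr.
have IP (c : R) : rint (c - s) (c + s) (fun x => s / p (x - c)) = pi / 2 by exact: rint_atan.
rewrite /rect cB cT cR cL; apply: C_eqP; rewrite !(reD, imD, reM, imM, reN, imN) /=.
  by ring.
by rewrite !IN !IP; field.
Qed.

(** Cut out the square of half-side 2 d around z: on the four remaining pieces the distance to z
    exceeds d strictly, so Goursat's theorem applies. *)
Lemma rect_capped (d : R) (z : C) (x0 x1 y0 y1 : R) : 0 < d ->
  x0 <= re z - 2 * d -> re z + 2 * d <= x1 ->
  y0 <= im z - 2 * d -> im z + 2 * d <= y1 ->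
  rect x0 x1 y0 y1 (capped d z) = cpl 0 (2 * pi).
Proof.
move=> d0 h0 h1 h2 h3; have ck := @continuous_capped d z d0.
have d2 : d <= 2 * d by lra.
have far (w : C) : [\/ re w <= re z - 2 * d, re z + 2 * d <= re w,
    im w <= im z - 2 * d | im z + 2 * d <= im w] -> derivable (capped d z) w 1.
  move=> H; apply: derivable_capped => //.
  have k1 := le_trans (ler_norm _) (re_le_modulus (w - z)).
  have k2 := le_trans (ler_norm _) (im_le_modulus (w - z)).
  have k3 := le_trans (ler_norm _) (re_le_modulus (z - w)).
  have k4 := le_trans (ler_norm _) (im_le_modulus (z - w)).
  rewrite (modulusC z w) in k3 k4; rewrite !(reB, imB) in k1 k2 k3 k4.
  by case: H => H; lra.
rewrite (@rect_splitx R (re z - 2 * d)) //; last lra.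
rewrite (@goursat_derivable x0) //; last 2 first.
- lra.
- by move=> w /andP[/andP[w1 w2] _]; apply: far; constructor 1.
rewrite add0r (@rect_splitx _ (re z + 2 * d)) //; last lra.
rewrite (@goursat_derivable (re z + 2 * d)) //; last 2 first.
- lra.
- by move=> w /andP[/andP[w1 w2] _]; apply: far; constructor 2.
rewrite addr0 (@rect_splity _ (im z - 2 * d)) //; last lra.
rewrite (@goursat_derivable _ _ y0) //; last 2 first.
- lra.
- by move=> w /andP[_ /andP[w1 w2]]; apply: far; constructor 3.
rewrite add0r (@rect_splity _ (im z + 2 * d)) //; last lra.
rewrite (@goursat_derivable _ _ (im z + 2 * d)) //; last 2 first.
- lra.
- by move=> w /andP[_ /andP[w1 w2]]; apply: far; constructor 4.
by rewrite addr0; exact: rect_capped_square.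
Qed.

End CauchyKernel.

(** * Mergelyan's theorem *)

Section GridSums.
Variable R : realType.
Local Notation C := (Cplx R).

(** The distance |i - j|: with truncated subtraction one of the summands is always 0. *)
Definition ndist (i j : nat) : nat := ((i - j) + (j - i))%N.

(** Each distance is attained at most once on either side of i0. *)
Lemma sum_ndist (u : nat -> R) (S : R) (N i0 : nat) : (forall n, 0 <= u n) ->
  (forall n, \sum_(a < n) u a <= S) -> \sum_(i < N) u (ndist i i0) <= 2 * S.
Proof.
move=> u0 HS.
(* On the longer range i0 + N the sum splits at i0 whether or not i0 < N. *)
apply: (@le_trans _ _ (\sum_(i < i0 + N) u (ndist i i0))).
  rewrite -!(big_mkord xpredT (fun i => u (ndist i i0))).
  rewrite [leRHS](@big_cat_nat _ _ _ N) //=; last exact: leq_addl.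
  by rewrite lerDl sumr_ge0.
rewrite big_split_ord /= mulrDl mul1r.
apply: lerD.
- rewrite (reindex_inj rev_ord_inj) /=.
  apply: (@le_trans _ _ (\sum_(i < i0.+1) u i)); last exact: HS.
  rewrite big_ord_recl /=; apply: ler_wpDl => //.
  apply: ler_sum => i _; rewrite le_eqVlt; apply/orP; left; apply/eqP; congr u.
  by rewrite /ndist /bump; have := ltn_ord i; lia.
- apply: le_trans (HS N).
  apply: ler_sum => i _; rewrite le_eqVlt; apply/orP; left; apply/eqP; congr u.
  by rewrite /ndist; lia.
Qed.

(** Comparable to n^-3, but telescoping, as does its tail sum: the double sum over the grid is
    bounded by two explicit telescopings. *)
Definition weight (n : nat) : R := (n.+1%:R * n.+2%:R * n.+3%:R)^-1.

Lemma weight_ge0 n : 0 <= weight n.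
Proof. by rewrite invr_ge0 !mulr_ge0. Qed.

Let nz (n : nat) : (n.+1%:R : R) != 0. Proof. by rewrite pnatr_eq0. Qed.

Lemma sum_weight a n :
  \sum_(b < n) weight (a + b) <= 2^-1 * (a.+1%:R * a.+2%:R)^-1.
Proof.
have -> : \sum_(b < n) weight (a + b) =
    2^-1 * ((a.+1%:R * a.+2%:R)^-1 - ((a + n).+1%:R * (a + n).+2%:R)^-1).
  elim: n => [|n IH]; first by rewrite big_ord0 addn0 subrr mulr0.
  rewrite big_ord_recr /= IH /weight addnS.
  have := nz (a + n); have := nz (a + n).+1; have := nz (a + n).+2.
  have := nz a; have := nz a.+1.
  rewrite -!natr1 => h1 h2 h3 h4 h5; field.
  by rewrite -natrD ?h1 ?h2 ?h3 ?h4 ?h5.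
by rewrite mulrBr gerBl mulr_ge0 // invr_ge0 mulr_ge0.
Qed.

Lemma sum_weight2 n : \sum_(a < n) 2^-1 * (a.+1%:R * a.+2%:R)^-1 <= 2^-1 :> R.
Proof.
have -> : \sum_(a < n) 2^-1 * (a.+1%:R * a.+2%:R)^-1 = 2^-1 * (1 - n.+1%:R^-1) :> R.
  elim: n => [|n IH]; first by rewrite big_ord0 invr1 subrr mulr0.
  rewrite big_ord_recr /= IH.
  have := nz n; have := nz n.+1; rewrite -!natr1 => h1 h2; field.
  by rewrite ?h1 ?h2.
by rewrite mulrBr mulr1 gerBl mulr_ge0 // invr_ge0.
Qed.

Lemma sum_weight_grid (N i0 j0 : nat) :
  \sum_(i < N) \sum_(j < N) weight (ndist i i0 + ndist j j0) <= 2.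
Proof.
pose u (a : nat) : R := 2 * (2^-1 * (a.+1%:R * a.+2%:R)^-1).
have u0 n : 0 <= u n by rewrite !mulr_ge0 // invr_ge0 mulr_ge0.
apply: (@le_trans _ _ (\sum_(i < N) u (ndist i i0))).
  apply: ler_sum => i _.
  apply: (@sum_ndist (fun b => weight (ndist i i0 + b))) => n.
  - exact: weight_ge0.
  - exact: sum_weight.
apply: le_trans (@sum_ndist u 1 _ _ u0 _) _; last by rewrite mulr1.
move=> n; rewrite /u -mulr_sumr.
by have := sum_weight2 n; lra.
Qed.

(** Common edges cancel; the inductions start from degenerate rectangles, whose integral is 0. *)
Lemma rect_grid (f : C -> C) (t : nat -> R) N M : continuous f ->
  (forall n, t n <= t n.+1) ->
  \sum_(i < N) \sum_(j < M) rect (t i) (t i.+1) (t j) (t j.+1) f =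
    rect (t 0%N) (t N) (t 0%N) (t M) f.
Proof.
move=> cf tS.
have tm (m n : nat) : (m <= n)%N -> t m <= t n.
  elim: n => [|n IH]; first by rewrite leqn0 => /eqP ->.
  by rewrite leq_eqVlt => /predU1P[->//|/IH /le_trans]; apply.
have z (a b c : R) : rect a b c c f = 0.
  rewrite /rect subrr add0r.
  have cc (g : R -> C) : cint c c g = 0.
    by rewrite /cint /rint set_itv1 !Rintegral_set1.
  by rewrite !cc subrr mulr0.
have z' (a b c : R) : rect c c a b f = 0.
  rewrite /rect subrr mulr0 addr0.
  have cc (g : R -> C) : cint c c g = 0.
    by rewrite /cint /rint set_itv1 !Rintegral_set1.
  by rewrite !cc subrr.
elim: N => [|N IH]; first by rewrite big_ord0 z'.
rewrite big_ord_recr /= IH [RHS](@rect_splitx R (t N)) ?tm //; congr (_ + _).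
elim: M {IH} => [|M IH]; first by rewrite big_ord0 z.
by rewrite big_ord_recr /= IH [RHS](@rect_splity R (t M)) ?tm.
Qed.

End GridSums.

(** * The contribution of a single grid square *)

Section Square.
Variable R : realType.
Local Notation C := (Cplx R).

Lemma kernel_expansion (w u G : C) (d D : R) : 0 < d -> 8 * d <= D ->
  D - 2 * d <= modulus w -> modulus u <= 5 * d -> D - 3 * d <= modulus (w - u) ->
  modulus G <= 4 / D -> modulus (G - w^-1) <= 32 * d ^+ 2 / D ^+ 3 ->
  modulus ((w - u)^-1 - G - u * G ^+ 2) <= 242 * d ^+ 2 / D ^+ 3.
Proof.
move=> d0 dD hw hu hwu hG hGw.
have D0 : 0 < D by lra.
have w0 : w != 0 by rewrite -modulus_gt0; lra.
have wu0 : w - u != 0 by rewrite -modulus_gt0; lra.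
(* Three errors: the Taylor remainder of 1 / (w - u), the replacement of 1 / w by G, and that of 1 /
   w^2 by G^2. Their constants 90, 32 and 107 add up to less than 242. *)
have -> : (w - u)^-1 - G - u * G ^+ 2 =
  u ^+ 2 * (w ^+ 2 * (w - u))^-1 + (- (G - w^-1)) + u * (- (G - w^-1)) * (w^-1 + G).
  by field; rewrite w0.
have X0 : 0 < d ^+ 2 / D ^+ 3 by rewrite divr_gt0 ?exprn_gt0.
set X := d ^+ 2 / D ^+ 3 in X0.
rewrite -(mulrA 242) -/X; rewrite -(mulrA 32) -/X in hGw.
have h1 : modulus (u ^+ 2 * (w ^+ 2 * (w - u))^-1) <= 90 * X.
  rewrite modulusM modulusV modulusM !modulusX.
  have a1 : modulus u ^+ 2 <= (5 * d) ^+ 2.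
    by rewrite ler_sqr ?nnegrE ?modulus_ge0 //; lra.
  have a2 : (3 / 4 * D) ^+ 2 * (D / 2) <= modulus w ^+ 2 * modulus (w - u).
    apply: ler_pM; [exact: sqr_ge0|lra| |lra].
    by rewrite ler_sqr ?nnegrE ?modulus_ge0 //; lra.
  have a3 : 0 < (3 / 4 * D) ^+ 2 * (D / 2).
    by rewrite mulr_gt0 ?exprn_gt0 //; lra.
  have a4 : (modulus w ^+ 2 * modulus (w - u))^-1 <= ((3 / 4 * D) ^+ 2 * (D / 2))^-1.
    by rewrite lef_pV2 // posrE // (lt_le_trans a3).
  apply: le_trans (ler_pM _ _ a1 a4) _; first exact: sqr_ge0.
    by rewrite invr_ge0 mulr_ge0 ?modulus_ge0 // sqr_ge0.
  have -> : (5 * d) ^+ 2 * ((3 / 4 * D) ^+ 2 * (D / 2))^-1 = 25 * 32 / 9 * X.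
    by rewrite /X; field; lra.
  by rewrite ler_pM2r //; lra.
have h2 : modulus (- (G - w^-1)) <= 32 * X by rewrite modulusN.
have h3 : modulus (u * (- (G - w^-1)) * (w^-1 + G)) <= 107 * X.
  rewrite !modulusM.
  have b1 : modulus (w^-1 + G) <= (16 / 3) / D.
    apply: le_trans (modulusD _ _) _; rewrite modulusV.
    have : (modulus w)^-1 <= (3 / 4 * D)^-1 by rewrite lef_pV2 ?posrE //; lra.
    have -> : (3 / 4 * D)^-1 = (4 / 3) / D by field; lra.
    have -> : (16 / 3) / D = (4 / 3) / D + 4 / D by field; lra.
    by move=> ?; apply: lerD.
  have b2 := ler_pM (modulus_ge0 _) (modulus_ge0 _) hu h2.
  apply: le_trans (ler_pM _ (modulus_ge0 _) b2 b1) _.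
    by rewrite mulr_ge0 ?modulus_ge0.
  have -> : 5 * d * (32 * X) * (16 / 3 / D) = (2560 / 3 * (d / D)) * X by field; lra.
  rewrite ler_pM2r //.
  have : d / D <= 8^-1 by rewrite ler_pdivrMr //; lra.
  lra.
set t1 := u ^+ 2 * _ in h1 *; set t2 := - (G - w^-1) in h2 h3 *.
set t3 := u * t2 * _ in h3 *.
have := modulusD (t1 + t2) t3; have := modulusD t1 t2; lra.
Qed.

(** The constant covers 8 * 242 * (5 / 4)^3 = 3781.25. *)
Lemma cube_bound (e d Z D : R) : 0 < e -> 0 < d -> 0 < Z -> 4 / 5 * Z <= D ->
  8 * (e * (242 * d ^+ 2 / D ^+ 3)) * d <= 4000 * (e * d ^+ 3 / Z ^+ 3).
Proof.
move=> e0 d0 Z0 ZD; have D0 : 0 < D by lra.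
have h1 : (4 / 5 * Z) ^+ 3 <= D ^+ 3.
  by apply: lerXn2r => //; rewrite nnegrE; lra.
have h2 : (D ^+ 3)^-1 <= ((4 / 5 * Z) ^+ 3)^-1.
  by rewrite lef_pV2 // posrE exprn_gt0 //; lra.
have X0 : 0 < e * d ^+ 3 by rewrite mulr_gt0 ?exprn_gt0.
have h3 := ler_wpM2l (ltW X0) h2.
have E : ((4 / 5 * Z) ^+ 3)^-1 = 125 / 64 * (Z ^+ 3)^-1 by field; lra.
rewrite E in h3.
have h4 : 0 < e * d ^+ 3 * (Z ^+ 3)^-1 by rewrite mulr_gt0 // invr_gt0 exprn_gt0.
have -> : 8 * (e * (242 * d ^+ 2 / D ^+ 3)) * d = 1936 * (e * d ^+ 3 * (D ^+ 3)^-1) by ring.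
move: h3 h4; set p := (D ^+ 3)^-1; set q := (Z ^+ 3)^-1 => h3 h4.
by move: h3 h4; lra.
Qed.

(** For w near c, 1 / (z - w) is close to G(z) + (w - m) G(z)^2, so the boundary integral of f times
    the kernel is close to - A G - B G^2, with A and B the moments of f of orders 0 and 1. The
    moments only see the oscillation of f, which provides the factor e. *)
Lemma square_approx (K : set C) (f : C -> C) (e d x y : R) (c : C) :
  compact K -> connected (~` K) -> continuous f -> 0 < e -> 0 < d ->
  (forall z, K^° z -> derivable f z 1) ->
  (forall z w, modulus (z - w) <= 12 * d -> modulus (f z - f w) <= e) ->
  c = cpl (x + d / 2) (y + d / 2) ->
  exists Q : C -> C, poly_approx K Q /\ forall z : C, K z ->
    (modulus (z - c) < 10 * d ->
      modulus (rect x (x + d) y (y + d) (fun w => f w * capped d z w) -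
        f z * rect x (x + d) y (y + d) (capped d z) - Q z) <= (240 * 100) * e) /\
    (10 * d <= modulus (z - c) ->
      modulus (rect x (x + d) y (y + d) (fun w => f w * capped d z w) -
        f z * rect x (x + d) y (y + d) (capped d z) - Q z)
      <= 4000 * (e * d ^+ 3 / modulus (z - c) ^+ 3)).
Proof.
move=> cK cnK cf e0 d0 holf oscf cE; pose J g := rect x (x + d) y (y + d) g.
have xd : x <= x + d by lra.
have yd : y <= y + d by lra.
have inS w : in_rect x (x + d) y (y + d) w -> modulus (w - c) <= d.
  move=> /andP[/andP[w1 w2] /andP[w3 w4]].
  apply: le_trans (modulus_le_re_im _) _; rewrite cE reB imB /= [leRHS]splitr.
  by apply: lerD; rewrite ler_norml; apply/andP; split; lra.
have onS w : on_rect x (x + d) y (y + d) w -> modulus (w - c) <= d.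
  by move=> /andP[/inS].
have ck z : continuous (capped d z) by exact: continuous_capped.
have cfk z : continuous (fun w => f w * capped d z w).
  exact: (continuous_mulC cf (ck z)).
have cZ (a : C) (g : C -> C) : continuous g -> continuous (fun w => a * g w).
  by move=> cg; exact: (continuous_mulC (@continuous_cstC R a) cg).
have cB (a : C) (g : C -> C) : continuous g -> continuous (fun w => g w + a).
  by move=> cg; exact: (continuous_addC cg (@continuous_cstC R a)).
have cJ g k : continuous g -> (forall w, modulus (w - c) <= d -> modulus (g w) <= k) ->
    modulus (J g) <= 8 * k * d.
  move=> cg H; have := @rect_bound R x (x + d) y (y + d) g k cg xd yd.
  have -> : 4 * k * (x + d - x + (y + d - y)) = 8 * k * d by ring.
  by apply => w /onS /H.
have oscS w : modulus (w - c) <= d -> modulus (f w - f c) <= e.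
  by move=> h; apply: oscf; lra.
have farS z w : 10 * d <= modulus (z - c) -> modulus (w - c) <= d -> d < modulus (w - z).
  move=> zc wc.
  by have := modulus_triangle w z c; rewrite (modulusC z w); lra.
have far0 z : 10 * d <= modulus (z - c) -> J (capped d z) = 0.
  move=> zc; apply: (goursat_derivable (ck z) xd yd) => w /inS wc.
  exact: (derivable_capped d0 (farS _ _ zc wc)).
have good z : 10 * d <= modulus (z - c) -> ~ (exists p, ~ K p /\ modulus (p - c) <= 2 * d) ->
    J (fun w => f w * capped d z w) = 0.
  move=> zc nobad; apply: (goursat_derivable (cfk z) xd yd) => w /inS wc.
  apply: (derivable_mulC _ (derivable_capped d0 (farS _ _ zc wc))).
  apply: holf; apply/nbhs_modulusP; exists d; first exact: d0.
  move=> v vw; apply: contrapT => nKv; apply: nobad; exists v; split; first exact: nKv.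
  by have := modulus_triangle w v c; lra.
clear holf.
have near_est z : modulus (z - c) < 10 * d ->
    modulus (J (fun w => f w * capped d z w) - f z * J (capped d z)) <= 8 * e.
  move=> zc.
  have -> : J (fun w => f w * capped d z w) - f z * J (capped d z) =
      J (fun w => (f w + (- f z)) * capped d z w).
    transitivity (J (fun w => f w * capped d z w + (- f z) * capped d z w)).
      rewrite /J (rectD _ _ _ _ (cfk z) (cZ (- f z) _ (ck z))).
      by rewrite (rectZ _ _ _ _ (- f z) (ck z)) mulNr.
    by congr rect; apply/funext => w; rewrite mulrDl.
  apply: le_trans (cJ _ (e / d) _ _) _.
  - exact: (continuous_mulC (cB (- f z) _ cf) (ck z)).
  - move=> w wc; rewrite modulusM; apply: ler_pM; try exact: modulus_ge0.
      apply: oscf; have := modulus_triangle c w z; rewrite (modulusC c z); lra.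
    exact: capped_bound.
  - by rewrite le_eqVlt; apply/orP; left; apply/eqP; field; lra.
have farE z w : 10 * d <= modulus (z - c) -> modulus (w - c) <= d ->
    capped d z w = (w - z)^-1.
  move=> zc wc; apply: capped_out => //.
  have := modulus_triangle w z c; rewrite (modulusC z w); lra.
(* If no point off K is within 2 d of c, the square lies in the interior of K, both integrals vanish
   for z far away, and Q = 0 works. *)
have [[p [nKp pc]]|nobad] := pselect (exists p, ~ K p /\ modulus (p - c) <= 2 * d); last first.
  exists (fun=> 0); split; first exact: poly_approx_cst.
  move=> z Kz /=; rewrite subr0; split=> [/near_est|zc]; first by lra.
  rewrite -/(J _) -/(J _) far0 // mulr0 subr0 good // modulus0.
  apply: mulr_ge0; first exact: ler0n.
  apply: divr_ge0; last exact: (exprn_ge0 3 (modulus_ge0 _)).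
  exact: (mulr_ge0 (ltW e0) (exprn_ge0 3 (ltW d0))).
(* The kernel is built at p with radius 4 d. As |p - c| <= 2 d, a point with |z - c| >= 10 d
   satisfies |z - p| >= 8 d and is in the far region of the kernel. *)
have d4 : 0 < 4 * d by lra.
have [m [G [mp HG G1 G2]]] := cauchy_kernel_approx cK cnK nKp d4.
have [M M0 KM] := compact_modulus_bounded cK.
pose A := J f; pose B := J (fun w => f w * (w - m)).
have cm : continuous (fun w : C => w - m).
  exact: (cB (- m) _ (@continuous_idC R)).
(* Subtracting f c changes neither moment, since affine functions integrate to 0 along the boundary,
   and leaves an integrand of size e. *)
pose g w := f w + (- f c).
have cg : continuous g by exact: (cB (- f c) _ cf).
have c1 : continuous (fun w => g w * (w - m)) by exact: (continuous_mulC cg cm).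
have ge_ w : modulus (w - c) <= d -> modulus (g w) <= e by exact: oscS.
have um w : modulus (w - c) <= d -> modulus (w - m) <= 5 * d.
  move=> wc; have h1 := modulus_triangle c w m; have h2 := modulus_triangle p c m.
  by rewrite (modulusC c p) (modulusC p m) in h2; lra.
have AE : A = J g.
  by rewrite /A /g /J (rectD _ _ _ _ cf (@continuous_cstC R (- f c))) rect_cst addr0.
have BE : B = J (fun w => g w * (w - m)).
  have -> : (fun w => g w * (w - m)) =
      (fun w => f w * (w - m) + (f c * m + (- f c) * w)).
    by apply/funext => w; rewrite /g; ring.
  have caff : continuous (fun w => f c * m + (- f c) * w).
    exact: (continuous_addC (@continuous_cstC R (f c * m)) (cZ (- f c) _ (@continuous_idC R))).
  by rewrite /J (rectD _ _ _ _ (continuous_mulC cf cm) caff) rect_affine // addr0.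
have hA : modulus A <= 8 * e * d by rewrite AE; exact: (cJ g e cg ge_).
have hB : modulus B <= 40 * e * d ^+ 2.
  rewrite BE; apply: le_trans (cJ _ (e * (5 * d)) _ _) _.
  - exact: c1.
  - move=> w wc; rewrite modulusM; apply: ler_pM; try exact: modulus_ge0.
      exact: ge_.
    exact: um.
  - by rewrite le_eqVlt; apply/orP; left; apply/eqP; ring.
exists (fun z => - A * G z + - B * (G z * G z)); split.
  have HGG := poly_approxM KM HG HG.
  by apply: poly_approxD; apply: (poly_approxM KM) => //; exact: poly_approx_cst.
move=> z Kz /=; split=> [zc|zc].
  have h1 : modulus (G z) <= 24 / d.
    by apply: le_trans (G1 z Kz) _; rewrite le_eqVlt; apply/orP; left; apply/eqP; field; lra.
  have h2 : modulus (- A * G z) <= 192 * e.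
    rewrite modulusM modulusN; apply: le_trans (ler_pM _ _ hA h1) _; try exact: modulus_ge0.
    by rewrite le_eqVlt; apply/orP; left; apply/eqP; field; lra.
  have h3 : modulus (- B * (G z * G z)) <= (2304 * 10) * e.
    rewrite !modulusM modulusN.
    have h4 := ler_pM (modulus_ge0 _) (modulus_ge0 _) h1 h1.
    apply: le_trans (ler_pM _ _ hB h4) _; try exact: modulus_ge0.
      by rewrite mulr_ge0 ?modulus_ge0.
    by rewrite le_eqVlt; apply/orP; left; apply/eqP; field; lra.
  (* 8 + 192 + 23040 stays below 24000. *)
  have h4 := near_est z zc.
  apply: le_trans (modulusB _ _) _.
  have := modulusD (- A * G z) (- B * (G z * G z)); lra.
rewrite -/(J _) -/(J _) far0 // mulr0 subr0.
set D := modulus (z - p).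
have zpc : 4 / 5 * modulus (z - c) <= D.
  by have := modulus_triangle p z c; rewrite -/D; lra.
have D8 : 8 * d <= D by lra.
have rz : 4 * d <= modulus (z - p) by rewrite -/D; lra.
have [G3 G4] := G2 z Kz rz.
pose b w := capped d z w + (G z + (w - m) * (G z * G z)).
have cb : continuous b.
  have h := continuous_addC (@continuous_cstC R (G z)) (continuous_mulC cm (@continuous_cstC R (G z * G z))).
  exact: (continuous_addC (ck z) h).
(* Far from the square the kernel also integrates to 0, so g may replace f here too; up to sign, [b]
   is the error of the kernel expansion. *)
have -> : J (fun w => f w * capped d z w) - (- A * G z + - B * (G z * G z)) =
    J (fun w => g w * b w).
  have Jk : J (fun w => g w * capped d z w) = J (fun w => f w * capped d z w).
    transitivity (J (fun w => f w * capped d z w + (- f c) * capped d z w)).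
      by congr rect; apply/funext => w; rewrite /g mulrDl.
    rewrite /J (rectD _ _ _ _ (cfk z) (cZ (- f c) _ (ck z))) (rectZ _ _ _ _ (- f c) (ck z)).
    by move: (far0 z zc); rewrite /J => ->; rewrite mulr0 addr0.
  have -> : (fun w => g w * b w) = (fun w => g w * capped d z w +
      (G z * g w + (G z * G z) * (g w * (w - m)))).
    by apply/funext => w; rewrite /b; ring.
  have c2 := cZ (G z * G z) _ c1; have c3 := cZ (G z) _ cg.
  rewrite /J (rectD _ _ _ _ (continuous_mulC cg (ck z)) (continuous_addC c3 c2)).
  rewrite (rectD _ _ _ _ c3 c2) (rectZ _ _ _ _ _ cg) (rectZ _ _ _ _ _ c1).
  move: Jk; rewrite /J => ->; move: AE BE; rewrite /J => -> ->; ring.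
apply: le_trans (cJ _ (e * (242 * d ^+ 2 / D ^+ 3)) _ _) _.
- exact: (continuous_mulC cg cb).
- move=> w wc; rewrite modulusM; apply: ler_pM; try exact: modulus_ge0.
    exact: ge_.
  have -> : b w = - (((z - m) - (w - m))^-1 - G z - (w - m) * G z ^+ 2).
    have -> : (z - m) - (w - m) = - (w - z) by ring.
    by rewrite /b farE // invrN; ring.
  rewrite modulusN; apply: kernel_expansion => //.
  - have := modulus_triangle m z p; rewrite -/D; lra.
  - exact: um.
  - have -> : (z - m) - (w - m) = z - w by ring.
    have h1 := modulus_triangle w z p; have h2 := modulus_triangle c w p.
    by rewrite (modulusC c p) -/D in h1 h2; lra.
  - apply: le_trans G4 _; rewrite -/D.
    by rewrite le_eqVlt; apply/orP; left; apply/eqP; field; lra.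
apply: cube_bound => //; clear -zc d0; lra.
Qed.

End Square.

(** * Summation over the grid *)

Section MergelyanCore.
Variable R : realType.
Local Notation C := (Cplx R).

(** The constant is 23 * 24 * 25 = 13800. *)
Lemma weight_near n : (n <= 22)%N -> 1 <= (138 * 100) * weight R n.
Proof.
move=> n22.
have h : n%:R <= 22 :> R by rewrite ler_nat.
have n0 : 0 <= n%:R :> R by exact: ler0n.
rewrite /weight -!natr1 ler_pdivlMr ?mul1r; last first.
  by rewrite !mulr_gt0 //; lra.
have h1 : (n%:R + 1) * (n%:R + 1 + 1) <= 23 * 24 :> R by apply: ler_pM; lra.
have h2 : 0 <= (n%:R + 1) * (n%:R + 1 + 1) :> R by apply: mulr_ge0; lra.
have h3 : (n%:R + 1) * (n%:R + 1 + 1) * (n%:R + 1 + 1 + 1) <= 23 * 24 * 25 :> R.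
  by apply: ler_pM; lra.
lra.
Qed.

Lemma weight_far n : (n.+3%:R ^+ 3)^-1 <= weight R n.
Proof.
rewrite /weight lef_pV2 ?posrE ?exprn_gt0 ?mulr_gt0 //.
rewrite !exprS expr0 mulr1 mulrA.
by apply: ler_pM => //; last apply: ler_pM => //; rewrite ler_nat; lia.
Qed.

Lemma grid_dist (B d x : R) (i i0 : nat) : 0 < d ->
  - B + i0%:R * d <= x -> x <= - B + i0%:R * d + d ->
  ((ndist i i0)%:R - 2^-1) * d <= `|x - (- B + i%:R * d + d / 2)| <=
    ((ndist i i0)%:R + 2^-1) * d.
Proof.
move=> d0 h1 h2.
have [le|/ltnW le] := leqP i i0.
  have E : (ndist i i0)%:R = i0%:R - i%:R :> R.
    by rewrite /ndist -natrB //; congr (_%:R); lia.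
  have E0 : 0 <= (ndist i i0)%:R * d by rewrite mulr_ge0 // ltW.
  rewrite mulrBl mulrDl; rewrite E mulrBl in E0 *.
  apply/andP; split; first by apply: le_trans (ler_norm _); lra.
  by rewrite ler_norml; apply/andP; split; lra.
have E : (ndist i i0)%:R = i%:R - i0%:R :> R.
  by rewrite /ndist -natrB //; congr (_%:R); lia.
have E0 : 0 <= (ndist i i0)%:R * d by rewrite mulr_ge0 // ltW.
rewrite mulrBl mulrDl; rewrite E mulrBl in E0 *.
apply/andP; split; first by rewrite -normrN; apply: le_trans (ler_norm _); lra.
by rewrite ler_norml; apply/andP; split; lra.
Qed.

Lemma far_weight (e d D : R) n : 0 < e -> 0 < d -> 2 / 5 * (n.+3%:R * d) <= D ->
  e * d ^+ 3 / D ^+ 3 <= 125 / 8 * e * weight R n.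
Proof.
move=> e0 d0 Dn.
have n3 : 0 < n.+3%:R * d by rewrite mulr_gt0.
have D0 : 0 < D by lra.
have h1 : (2 / 5 * (n.+3%:R * d)) ^+ 3 <= D ^+ 3.
  by apply: lerXn2r => //; rewrite nnegrE; lra.
have h2 : (D ^+ 3)^-1 <= ((2 / 5 * (n.+3%:R * d)) ^+ 3)^-1.
  by rewrite lef_pV2 // posrE exprn_gt0 //; lra.
have X0 : 0 < e * d ^+ 3 by rewrite mulr_gt0 ?exprn_gt0.
apply: le_trans (ler_wpM2l (ltW X0) h2) _.
have -> : e * d ^+ 3 / (2 / 5 * (n.+3%:R * d)) ^+ 3 = 125 / 8 * e * (n.+3%:R ^+ 3)^-1.
  have n3' : n.+3%:R != 0 :> R by rewrite pnatr_eq0.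
  by move: (n.+3%:R : R) n3' => m m0; field; rewrite m0 gt_eqF.
apply: ler_wpM2l; last exact: weight_far.
lra.
Qed.

(** One constant covers the near and the far estimate, whatever e, d and the cell. Behind an
    existential its numerals stay out of the summation. *)
Lemma mergelyan_const : exists2 c : R, 0 < c & forall (e d D : R) n, 0 < e -> 0 < d ->
  ((n <= 22)%N -> (240 * 100) * e <= c * e * weight R n) /\
  (2 / 5 * (n.+3%:R * d) <= D ->
    4000 * (e * d ^+ 3 / D ^+ 3) <= c * e * weight R n).
Proof.
exists ((240 * 100) * (138 * 100)); first lra.
move=> e d D n e0 d0; split=> [/weight_near h|h].
  have h2 : 0 < (240 * 100) * e by lra.
  have := ler_wpM2l (ltW h2) h.
  set w := weight R n; lra.
have h1 := far_weight e0 d0 h.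
have h2 : 0 <= e * weight R n by rewrite mulr_ge0 ?weight_ge0 // ltW.
move: h1; set X := e * d ^+ 3 / D ^+ 3; move: h2; set w := weight R n; lra.
Qed.

Lemma trunc_grid (B d x : R) : 0 < d -> 0 <= x + B ->
  - B + (Num.truncn ((x + B) / d))%:R * d <= x /\
  x <= - B + (Num.truncn ((x + B) / d))%:R * d + d.
Proof.
move=> d0 xB; set n := Num.truncn _.
have /andP[h1 h2] : n%:R <= (x + B) / d < n.+1%:R.
  by apply: truncn_itv; rewrite divr_ge0 // ltW.
rewrite ler_pdivlMr // in h1; rewrite ltr_pdivrMr // -natr1 mulrDl mul1r in h2.
by split; lra.
Qed.

Lemma grid_near_far (d g a b : R) (x y : R) : 0 < d ->
  (a - 2^-1) * d <= x <= (a + 2^-1) * d -> (b - 2^-1) * d <= y <= (b + 2^-1) * d ->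
  x <= g -> y <= g ->
  (g < 10 * d -> a < 11 /\ b < 11) /\ (10 * d <= g -> 2 / 5 * ((a + b + 3) * d) <= g).
Proof.
move=> d0 /andP[x1 x2] /andP[y1 y2] xg yg; split=> h; last lra.
by split; rewrite -(ltr_pM2r d0); lra.
Qed.

(** The weights sum to at most 2 on a grid of any size, so c is absolute and the mesh can be refined
    freely. *)
Lemma mergelyan_core : exists2 c : R, 0 < c &
  forall (K : set C) (f : C -> C) (e d L : R),
  compact K -> connected (~` K) -> continuous f -> 0 < e -> 0 < d ->
  (forall z, K^° z -> derivable f z 1) ->
  (forall z w, modulus (z - w) <= 12 * d -> modulus (f z - f w) <= e) ->
  0 < L -> (forall z, K z -> modulus z <= L) -> (forall z, L <= modulus z -> f z = 0) ->
  exists F, poly_approx K F /\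
    forall z, K z -> modulus (F z - f z) <= 2 * c * e.
Proof.
have [c1 c10 Hc] := mergelyan_const.
exists c1; first exact: c10.
move=> K f e d L cK cnK cf e0 d0 holf oscf L0 KL fL.
(* The margin 3 d puts the outer boundary where f vanishes and keeps K at least 2 d inside it, as
   [rect_capped] requires. *)
pose B := L + 3 * d.
pose N := (Num.truncn (2 * B / d)).+1.
pose t (n : nat) : R := - B + n%:R * d.
have tS n : t n.+1 = t n + d by rewrite /t -natr1; ring.
have t0 : t 0%N = - B by rewrite /t mul0r addr0.
have B0 : 0 < B by rewrite /B; lra.
have tN : B <= t N.
  have /andP[_ h] : (Num.truncn (2 * B / d))%:R <= 2 * B / d < N%:R.
    by apply: truncn_itv; rewrite divr_ge0 ?mulr_ge0 ?ltW.
  by rewrite ltr_pdivrMr // in h; rewrite /t; lra.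
pose c i j : C := cpl (t i + d / 2) (t j + d / 2).
pose Jk i j (z : C) := rect (t i) (t i.+1) (t j) (t j.+1) (fun w => f w * capped d z w).
pose J1 i j (z : C) := rect (t i) (t i.+1) (t j) (t j.+1) (capped d z).
have tle n : t n <= t n.+1 by rewrite tS lerDl ltW.
pose k2 : C := cpl 0 (2 * pi).
have pi2 := pi_ge2 R.
have mk2 : 1 <= modulus k2.
  by apply: le_trans (im_le_modulus _); rewrite /= ger0_norm; lra.
have k20 : k2 != 0 by rewrite -modulus_gt0; lra.
have kV : modulus k2^-1 <= 1 by rewrite modulusV invf_le1 //; lra.
have bnd z : K z -> [/\ - B <= re z - 2 * d, re z + 2 * d <= t N,
    - B <= im z - 2 * d & im z + 2 * d <= t N].
  move=> Kz; have rz := le_trans (re_le_modulus z) (KL z Kz).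
  have iz := le_trans (im_le_modulus z) (KL z Kz).
  rewrite ler_norml in rz; rewrite ler_norml in iz.
  move: rz iz tN => /andP[r1 r2] /andP[i1 i2]; move: (t N) => TN; rewrite /B => tN.
  by split; lra.
have xyB z : K z -> 0 <= re z + B /\ 0 <= im z + B.
  by move=> /bnd[b1 _ b3 _]; split; lra.
have ck z : continuous (capped d z) by exact: continuous_capped.
have cfk z := continuous_mulC cf (ck z).
have S1 z : K z -> \sum_(i < N) \sum_(j < N) J1 i j z = k2.
  move=> /bnd[b1 b2 b3 b4]; rewrite (rect_grid _ _ (ck z) tle) t0.
  exact: (rect_capped d0 b1 b2 b3 b4).
have SJ z : \sum_(i < N) \sum_(j < N) Jk i j z = 0.
  rewrite (rect_grid _ _ (cfk z) tle).
  rewrite -[RHS](rect_cst (t 0%N) (t N) (t 0%N) (t N) 0).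
  rewrite t0; apply: rect_ext => [||w /andP[_ /or4P H]]; [lra|lra|].
  rewrite fL ?mul0r //.
  have LB : L <= B by rewrite /B; lra.
  have a1 := re_le_modulus w; have a2 := im_le_modulus w.
  rewrite !ler_norml in a1 a2; move: a1 a2 => /andP[a1 a2] /andP[a3 a4].
  by case: H => /eqP H; rewrite H in a1 a2 a3 a4; lra.
have /choice[Q HQ] : forall ij : nat * nat, exists Q : C -> C, poly_approx K Q /\
  forall z : C, K z ->
    (modulus (z - c ij.1 ij.2) < 10 * d ->
      modulus (Jk ij.1 ij.2 z - f z * J1 ij.1 ij.2 z - Q z) <= (240 * 100) * e) /\
    (10 * d <= modulus (z - c ij.1 ij.2) ->
      modulus (Jk ij.1 ij.2 z - f z * J1 ij.1 ij.2 z - Q z)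
      <= 4000 * (e * d ^+ 3 / modulus (z - c ij.1 ij.2) ^+ 3)).
  move=> [i j]; rewrite /Jk /J1 !tS.
  exact: (square_approx cK cnK cf e0 d0 holf oscf (erefl _)).
pose S z := \sum_(i < N) \sum_(j < N) Q (nat_of_ord i, nat_of_ord j) z.
have HS : poly_approx K S.
  apply: poly_approx_sum => i _; apply: poly_approx_sum => j _.
  by have [] := HQ (nat_of_ord i, nat_of_ord j).
have [M M0 KM] := compact_modulus_bounded cK.
exists (fun z => - k2^-1 * S z); split.
  by apply: (poly_approxM KM (@poly_approx_cst R K (- k2^-1)) HS).
move=> z Kz.
pose T i j := Jk i j z - f z * J1 i j z - Q (i, j) z.
(* The kernels integrate to 2 pi i in total and f times the kernel to 0, so the sum of the Q is - 2
   pi i f(z) up to the errors [T]. *)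
have ST : \sum_(i < N) \sum_(j < N) T i j = - f z * k2 - S z.
  rewrite /T; under eq_bigr => i _ do rewrite !sumrB -mulr_sumr.
  by rewrite !sumrB -mulr_sumr (S1 z Kz) SJ sub0r mulNr.
have -> : - k2^-1 * S z - f z = k2^-1 * (- f z * k2 - S z) by field.
rewrite -ST modulusM.
apply: (@le_trans _ _ (modulus (\sum_(i < N) \sum_(j < N) T i j))).
  exact: (ler_piMl (modulus_ge0 _) kV).
have [xB yB] := xyB z Kz.
have := trunc_grid d0 xB; have := trunc_grid d0 yB.
(* The cell (i0, j0) contains z; distances to the other cells are counted from it. *)
set i0 := Num.truncn ((re z + B) / d); set j0 := Num.truncn ((im z + B) / d).
move=> [y1 y2] [x1 x2].
have TE i j : modulus (T i j) <= c1 * e * weight R (ndist i i0 + ndist j j0).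
  have gx := grid_dist i d0 x1 x2.
  have gy := grid_dist j d0 y1 y2.
  rewrite -/(t i) in gx; rewrite -/(t j) in gy.
  have g5 := re_le_modulus (z - c i j); have g6 := im_le_modulus (z - c i j).
  rewrite reB in g5; rewrite imB in g6.
  have [_ /(_ z Kz) [near far]] := HQ (i, j); rewrite /= -/(T i j) in near far.
  have [h1 h2] := grid_near_far d0 gx gy g5 g6.
  have [w1 w2] := Hc e d (modulus (z - c i j)) (ndist i i0 + ndist j j0)%N e0 d0.
  have [far10|near10] := leP (10 * d) (modulus (z - c i j)).
    apply: le_trans (far far10) _; apply: w2.
    have E (a b : nat) : (a + b).+3%:R = a%:R + b%:R + 3 :> R by rewrite -addn3 !natrD.
    by rewrite E; exact: h2.
  apply: le_trans (near near10) _; apply: w1.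
  have [] := h1 near10; rewrite !ltr_nat !ltnS => a1 a2.
  exact: leq_trans (leq_add a1 a2) _.
have W := sum_weight_grid R N i0 j0.
apply: (@le_trans _ _ (\sum_(i < N) \sum_(j < N) c1 * e * weight R (ndist i i0 + ndist j j0))).
  apply: le_trans (modulus_sum _ _ _) _; apply: ler_sum => i _.
  by apply: le_trans (modulus_sum _ _ _) _; apply: ler_sum => j _; exact: TE.
under eq_bigr => i _ do rewrite -mulr_sumr.
rewrite -mulr_sumr.
have -> : 2 * c1 * e = c1 * e * 2 by ring.
by rewrite ler_pM2l // mulr_gt0.
Qed.

End MergelyanCore.

(** * Extension, cutoff and the passage to a continuous function on K *)

Section Mergelyan.
Variable R : realType.
Local Notation C := (Cplx R).

Lemma closed_modulusP (A : set C) : closed A -> forall z, ~ A z ->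
  exists2 e : R, 0 < e & forall y, A y -> e <= modulus (y - z).
Proof.
move=> /closed_openC /open_modulusP H z /H[e e0 He]; exists e => // y Ay.
by rewrite leNgt; apply/negP => /He.
Qed.

(** Around each point of A take balls of radius at most half its distance to B, and conversely; two
    such balls cannot meet, by the triangle inequality. *)
Lemma normal_Cplx : normal_space C.
Proof.
apply/(@normal_openP R) => A B cA cB AB0.
have opn (X Y : set C) : open [set z | exists2 a, X a & exists2 e : R, 0 < e &
    modulus (z - a) < e /\ forall b, Y b -> 2 * e <= modulus (b - a)].
  apply/open_modulusP => z [a Xa [e e0 [za H]]]; exists (e - modulus (z - a)).
    by rewrite subr_gt0.
  move=> y yz; exists a => //; exists e => //; split=> //.
  by have := modulus_triangle z y a; lra.
have sub (X Y : set C) : closed Y -> X `&` Y = set0 -> X `<=` [set z | exists2 a, X a &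
    exists2 e : R, 0 < e & modulus (z - a) < e /\ forall b, Y b -> 2 * e <= modulus (b - a)].
  move=> cY XY z Xz; exists z => //.
  have nYz : ~ Y z by move=> Yz; have : (X `&` Y) z by []; rewrite XY.
  have [e e0 He] := closed_modulusP cY nYz; exists (e / 2); first by rewrite divr_gt0.
  rewrite subrr modulus0; split=> [|b Yb]; first by rewrite divr_gt0.
  by have := He b Yb; lra.
eexists; eexists; split; [exact: (opn A B)|exact: (opn B A)|exact: sub|
  by apply: sub => //; rewrite setIC|].
rewrite -subset0 => z [[a Aa [e e0 [za Ha]]] [b Bb [e' e'0 [zb Hb]]]].
have h1 := Ha b Bb; have h2 := Hb a Aa.
have h3 := modulus_triangle z a b; rewrite (modulusC b a) in h1.
by rewrite (modulusC a z) in h3; exfalso; clear -za zb h1 h2 h3; lra.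
Qed.

Lemma tietze_C (K : set C) (h : C -> C) : compact K -> {within K, continuous h} ->
  exists2 f : C -> C, continuous f & forall z, K z -> f z = h z.
Proof.
move=> cK ch.
have clK : closed K by apply: compact_closed => //; exact: norm_hausdorff.
have [B B0 HB] : exists2 B : R, 0 < B & forall z, K z -> modulus (h z) <= B.
  have [B B0 HB] := compact_modulus_bounded (continuous_compact ch cK).
  by exists B => // z Kz; apply: HB; exists z.
have cr : {within K, continuous (fun z => re (h z) : R^o)}.
  by move=> x; apply: continuous_comp (ch x) _; exact: re_continuous.
have ci : {within K, continuous (fun z => im (h z) : R^o)}.
  by move=> x; apply: continuous_comp (ch x) _; exact: im_continuous.
have [|g1 [E1 c1 _]] := continuous_bounded_extension normal_Cplx clK B0 cr.
  by move=> z Kz; apply: le_trans (re_le_modulus _) (HB z Kz).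
have [|g2 [E2 c2 _]] := continuous_bounded_extension normal_Cplx clK B0 ci.
  by move=> z Kz; apply: le_trans (im_le_modulus _) (HB z Kz).
exists (fun z => cpl (g1 z) (g2 z)); last first.
  by move=> z Kz; apply: C_eqP => /=; rewrite -?E1 -?E2 ?inE.
move=> z; apply/continuous_modulusP => e e0.
have e2 : 0 < e / 2 by rewrite divr_gt0.
have /(c1 z)/nbhs_modulusP[d1 d10 H1] : nbhs (g1 z) (ball (g1 z) (e / 2)) by exact: nbhsx_ballx.
have /(c2 z)/nbhs_modulusP[d2 d20 H2] : nbhs (g2 z) (ball (g2 z) (e / 2)) by exact: nbhsx_ballx.
exists (Num.min d1 d2); first by rewrite lt_min d10.
move=> y; rewrite lt_min => /andP[/H1 h1 /H2 h2].
rewrite /ball /= distrC in h1; rewrite /ball /= distrC in h2.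
apply: le_lt_trans (modulus_le_re_im _) _; rewrite reB imB /=.
by rewrite [ltRHS]splitr; exact: ltrD.
Qed.

Lemma compact_support_unif (f : C -> C) (L : R) : 0 < L -> continuous f ->
  (forall z, L <= modulus z -> f z = 0) -> forall e : R, 0 < e ->
  exists2 d : R, 0 < d & forall z w, modulus (z - w) <= d -> modulus (f z - f w) <= e.
Proof.
move=> L0 cf fL e e0.
have e2 : 0 < e / 2 by rewrite divr_gt0.
have /compact_near_coveringP H := @compact_cdisc R (L + 1).
have := H R (0^'+) (fun d x => forall y, modulus (y - x) <= d -> modulus (f y - f x) <= e) _.
case=> [x _|d /= d0 Hd].
  have /continuous_modulusP/(_ _ e2)[d d0 Hd] := cf x.
  exists ([set y | modulus (y - x) < d / 2], [set t | 0 < t < d / 2]).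
    split; first by apply/nbhs_modulusP; exists (d / 2); rewrite ?divr_gt0.
    exists (d / 2) => /=; first by rewrite divr_gt0.
    move=> t; rewrite /ball /= sub0r normrN => ht t0; rewrite t0 /=.
    by apply: le_lt_trans ht; exact: ler_norm.
  move=> [y t] /= [hy /andP[t0 ht]] w hw.
  have h1 : modulus (f y - f x) < e / 2 by apply: Hd; lra.
  have h2 : modulus (f w - f x) < e / 2.
    by apply: Hd; have := modulus_triangle y w x; lra.
  by have := modulus_triangle (f x) (f w) (f y); rewrite (modulusC (f x)); lra.
pose t := Num.min 1 (d / 2).
have t0 : 0 < t by rewrite lt_min ltr01 divr_gt0.
have td : t < d by rewrite /t gt_min; apply/orP; right; lra.
have := Hd t; rewrite /ball /= sub0r normrN gtr0_norm // => /(_ td t0) Ht.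
exists t => // z w zw.
have [h|h] := leP (modulus w) (L + 1); first exact: Ht.
(* As t <= 1, if w is beyond L + 1 then z is beyond L, and both values are 0. *)
have t1 : t <= 1 by rewrite /t ge_min lexx.
rewrite !fL ?subrr ?modulus0 ?ltW //; first lra.
have := modulus_geB w (w - z); have -> : w - (w - z) = z by ring.
by rewrite (modulusC w z); lra.
Qed.

(** Equal to 1 for |z| <= L - 1 and to 0 for |z| >= L. *)
Definition cutoff (L : R) (z : C) : C := cpl (Num.min 1 (Num.max 0 (L - modulus z))) 0.

Lemma clamp_lip (a b : R) :
  `|Num.min 1 (Num.max 0 a) - Num.min 1 (Num.max 0 b)| <= `|a - b|.
Proof.
have E (x : R) : Num.min 1 (Num.max 0 x) = if x <= 0 then 0 else if x <= 1 then x else 1.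
  have [x0|x0] := leP x 0; first by rewrite min_r.
  by have [x1|x1] := leP x 1; rewrite ?min_r ?min_l // ltW.
have h1 := ler_norm (a - b); have h2 := lerNnormlW (lexx `|a - b|).
rewrite !E ler_norml; apply/andP.
by split; case: (leP a 0) => ?; case: (leP b 0) => ?; case: (leP a 1) => ?; case: (leP b 1) => ?; lra.
Qed.

Lemma continuous_cutoff L : continuous (cutoff L).
Proof.
move=> z; apply/continuous_modulusP => e e0; exists e => // y yz.
apply: le_lt_trans yz.
have -> : cutoff L y - cutoff L z = cpl (Num.min 1 (Num.max 0 (L - modulus y)) -
    Num.min 1 (Num.max 0 (L - modulus z))) 0.
  by apply: C_eqP; rewrite ?reB ?imB /= ?subr0.
rewrite modulus_cpl0.
have h1 := modulus_geB y z; have h2 := modulus_geB z y; rewrite (modulusC z y) in h2.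
apply: le_trans (clamp_lip _ _) _.
by rewrite ler_norml; apply/andP; split; lra.
Qed.

Theorem mergelyan (K : set C) (h : C -> C) : compact K -> connected (~` K) ->
  {within K, continuous h} -> holomorphic_on K^° h -> poly_approx K h.
Proof.
move=> cK cnK ch hol.
have [c c0 core] := mergelyan_core R.
have [M M0 KM] := compact_modulus_bounded cK.
have [f0 cf0 Ef0] := tietze_C cK ch.
pose L := M + 1.
pose f z := cutoff L z * f0 z.
have cf : continuous f by exact: (continuous_mulC (@continuous_cutoff L) cf0).
have fK z : K z -> f z = h z.
  move=> Kz; rewrite /f /cutoff min_l ?Ef0 //; first exact: mul1r.
  by rewrite le_max; apply/orP; right; rewrite /L; have := KM z Kz; lra.
have fL z : L <= modulus z -> f z = 0.
  move=> Lz; rewrite /f /cutoff max_l ?subr_le0 // min_r ?ler01 //; exact: mul0r.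
have L0 : 0 < L by rewrite /L; lra.
have KL z : K z -> modulus z <= L by move=> /KM; rewrite /L; lra.
have holf z : K^° z -> derivable f z 1.
  move=> Kz; have [e e0 He] := (nbhs_modulusP _ _).1 Kz.
  apply: (derivable_nearC e0 _ (hol z Kz)) => y /He Ky.
  by rewrite fK.
apply: poly_approx_lim => e e0.
(* The bound 2 * c * e1 of the core lemma is e / 2, which leaves a strict inequality. *)
pose e1 := e / (4 * c).
have e10 : 0 < e1 by rewrite divr_gt0 // mulr_gt0.
have [d d0 Hd] := compact_support_unif L0 cf fL e10.
have d12 : 0 < d / 12 by rewrite divr_gt0.
have osc z w : modulus (z - w) <= 12 * (d / 12) -> modulus (f z - f w) <= e1.
  by have -> : 12 * (d / 12) = d by [field]; exact: Hd.
have [F [HF FE]] := core K f e1 (d / 12) L cK cnK cf e10 d12 holf osc L0 KL fL.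
exists F; split; first exact: HF.
move=> z Kz; rewrite -(fK z Kz); apply: le_lt_trans (FE z Kz) _.
have -> : 2 * c * e1 = e / 2 by rewrite /e1; field; rewrite gt_eqF.
by rewrite ltr_pdivrMr // ltr_pMr // ltr1n.
Qed.

End Mergelyan.

(** * Connectedness of the exterior of a disc *)

Section Exterior.
Variable R : realType.
Local Notation C := (Cplx R).

Lemma derivable_hornerC (q : {poly C}) z : derivable (horner q) z 1.
Proof.
elim/poly_ind : q => [|q c IH].
  have -> : horner 0 = (fun=> 0 : C) by apply/funext => w; rewrite horner0.
  exact: derivable_cst.
have -> : horner (q * 'X + c%:P) = (horner q * id) + cst c.
  by apply/funext => w; rewrite hornerMXaddC.
apply: derivableD; last exact: derivable_cst.
by apply: derivableM; [exact: IH|exact: derivable_id].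
Qed.

Definition convex_C (A : set C) := forall z w (t : R), A z -> A w -> 0 <= t <= 1 ->
  A (z + cpl t 0 * (w - z)).

Lemma convex_connected (A : set C) z w : convex_C A -> A z -> A w ->
  exists B : set C, [/\ connected B, B `<=` A, B z & B w].
Proof.
move=> cA Az Aw; exists ((fun t => z + cpl t 0 * (w - z)) @` `[0, 1]); split.
- apply: connected_continuous_connected; first exact: segment_connected.
  apply: continuous_subspaceT => t U /nbhs_modulusP[e e0 HU].
  have d0 : 0 < e / (modulus (w - z) + 1) by rewrite divr_gt0 // ltr_wpDl ?modulus_ge0.
  apply/nbhs_ballP; exists (e / (modulus (w - z) + 1)) => // s.
  rewrite /ball /= distrC ltr_pdivlMr; last by rewrite ltr_wpDl ?modulus_ge0.
  move=> hs; apply: HU; apply: le_lt_trans hs.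
  have -> : z + cpl s 0 * (w - z) - (z + cpl t 0 * (w - z)) = cpl (s - t) 0 * (w - z).
    have -> : cpl (s - t) 0 = cpl s 0 - cpl t 0 :> C.
      by apply: C_eqP; rewrite ?reB ?imB /= ?subrr.
    by ring.
  by rewrite modulusM modulus_cpl0 ler_wpM2l // lerDl.
- by move=> _ [t /= t01 <-]; apply: cA => //; move: t01; rewrite in_itv.
- exists 0; first by rewrite /= in_itv /= lexx ler01.
  by apply: C_eqP; rewrite !(reD, imD, reM, imM) /=; ring.
- exists 1; first by rewrite /= in_itv /= lexx ler01.
  by apply: C_eqP; rewrite !(reD, imD, reM, imM, reN, imN) /=; ring.
Qed.

(** For a unit vector u and m >= 0, the open half-plane beyond the tangent at m u to the circle of
    radius m. *)
Let half (u : C) (m : R) : set C := [set z | m < re z * re u + im z * im u].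

Let half_convex u m : convex_C (half u m).
Proof.
move=> z w t; rewrite /half /= !(reD, imD, reM, imM, reN, imN) /=.
set a := _ + _; set b := _ + _ => hz hw /andP[t0 t1].
suff : m < (1 - t) * a + t * b by congr (_ < _); rewrite /a /b; ring.
have a0 : 0 < a - m by rewrite subr_gt0.
have b0 : 0 < b - m by rewrite subr_gt0.
have h1 : 0 <= (1 - t) * (a - m) by rewrite mulr_ge0 ?subr_ge0 // ltW.
have h2 : 0 <= t * (b - m) by rewrite mulr_ge0 // ltW.
have [t2|t2] := leP t 2^-1.
  have : 0 < (1 - t) * (a - m) by rewrite mulr_gt0 //; lra.
  lra.
have : 0 < t * (b - m) by rewrite mulr_gt0 //; lra.
lra.
Qed.

Let half_exterior u m : 0 <= m -> modulus u <= 1 -> half u m `<=` ~` cdisc m.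
Proof.
move=> m0 u1 z; rewrite /half /cdisc /= => hz zm.
have hu := modulus_sqr u; have hzz := modulus_sqr z.
have : (re z * re u + im z * im u) ^+ 2 <= modulus z ^+ 2 * modulus u ^+ 2.
  rewrite hu hzz -subr_ge0.
  have -> : (re z ^+ 2 + im z ^+ 2) * (re u ^+ 2 + im u ^+ 2) -
    (re z * re u + im z * im u) ^+ 2 = (re z * im u - im z * re u) ^+ 2 by ring.
  exact: sqr_ge0.
rewrite -exprMn ler_sqr ?nnegrE ?mulr_ge0 ?modulus_ge0 //; last first.
  by apply: le_trans m0 (ltW hz).
have := ler_pM (modulus_ge0 z) (modulus_ge0 u) zm u1; lra.
Qed.

(** This opens closed discs to Mergelyan's theorem and to the universal property. A point z of the
    exterior lies in the half-plane directed by z / |z|; half-planes are convex and avoid the disc,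
    and at most three of them join z to [b]. *)
Lemma connected_cdiscC (m : R) : 0 <= m -> connected (~` cdisc m).
Proof.
move=> m0; pose A := ~` cdisc m : set C.
pose joined z w := exists B : set C, [/\ connected B, B `<=` A, B z & B w].
have jT z w v : joined z w -> joined w v -> joined z v.
  move=> [B [cB BA Bz Bw]] [D [cD DA Dw Dv]]; exists (B `|` D); split.
  - by apply: connectedU => //; exists w.
  - by move=> x [/BA|/DA].
  - by left.
  - by right.
have jH u z w : modulus u <= 1 -> half u m z -> half u m w -> joined z w.
  move=> u1 hz hw; have [B [cB BA Bz Bw]] := convex_connected (@half_convex u m) hz hw.
  by exists B; split=> // x /BA; exact: half_exterior.
pose b : C := cpl (m + 1) 0.
have mcpl x y : modulus (cpl x y) <= 1 <-> x ^+ 2 + y ^+ 2 <= 1.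
  rewrite modulusE /=; split=> [|h].
    rewrite -(@ler_sqr _ (Num.sqrt _)) ?nnegrE ?sqrtr_ge0 // sqr_sqrtr ?expr1n //.
    by rewrite addr_ge0 ?sqr_ge0.
  by rewrite -sqrtr1 ler_sqrt.
have e1 : modulus (cpl 1 0 : C) <= 1 by apply/mcpl; rewrite expr0n expr1n addr0.
have ei : modulus (cpl 0 1 : C) <= 1 by apply/mcpl; rewrite expr0n expr1n add0r.
have bH : half (cpl 1 0) m b by rewrite /half /=; lra.
pose b' : C := cpl (m + 1) (m + 1).
have jb' : joined b' b by apply: (jH _ _ _ e1) => //; rewrite /half /=; lra.
have jup z : half (cpl 0 1) m z -> joined z b.
  by move=> hz; apply: jT jb'; apply: (jH _ _ _ ei) => //; rewrite /half /=; lra.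
have jz z : A z -> joined z b.
  move=> Az; have mz : m < modulus z by rewrite ltNge; apply/negP.
  have z0 : 0 < modulus z by lra.
  have [u [uu u1 hz]] : exists u : C,
      [/\ re u ^+ 2 + im u ^+ 2 = 1, modulus u <= 1 & half u m z].
    have nz : modulus z != 0 by rewrite gt_eqF.
    have uu : (re z / modulus z) ^+ 2 + (im z / modulus z) ^+ 2 = 1.
      by rewrite !expr_div_n -mulrDl -modulus_sqr divff // expf_neq0.
    exists (cpl (re z / modulus z) (im z / modulus z)); split; first exact: uu.
      by apply/mcpl; rewrite uu.
    by rewrite /half /= !mulrA -mulrDl -!expr2 -modulus_sqr expr2 mulfK.
  have [h|h] := leP (re u) (-1); last first.
    have h1 : 0 < 1 + re u by lra.
    (* This t puts w = t (u + 1) at height m + 1 in the direction u and in the direction 1, hence in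
       both half-planes. *)
    pose t := (m + 1) / (1 + re u).
    have tE : t * (1 + re u) = m + 1 by rewrite /t mulfVK // gt_eqF.
    pose w : C := cpl (t * (re u + 1)) (t * im u).
    apply: (@jT _ w).
      apply: (jH _ _ _ u1 hz); rewrite /half /=.
      have -> : t * (re u + 1) * re u + t * im u * im u =
        t * (re u ^+ 2 + im u ^+ 2 + re u) by ring.
      by rewrite uu tE; lra.
    apply: (jH _ _ _ e1) bH; rewrite /half /= (addrC _ 1) tE; lra.
  have im2 := sqr_ge0 (im u).
  have re1' : re u = -1 by nra.
  have im0 : im u = 0.
    by apply/eqP; rewrite -sqrf_eq0; apply/eqP; move: uu; rewrite re1'; nra.
  (* For u = -1 the half-planes of u and of 1 are disjoint, and the path passes through that of
     i. *)
  pose w : C := cpl (- (m + 1)) (m + 1).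
  apply: (@jT _ w); first by apply: (jH _ _ _ u1 hz); rewrite /half re1' im0 /=; lra.
  by apply: jup; rewrite /half /=; lra.
have /choice[B HB] : forall z, exists B : set C, A z -> [/\ connected B, B `<=` A, B z & B b].
  move=> z; have [Az|nA] := pselect (A z); last by exists set0.
  by have [B HB] := jz z Az; exists B.
have -> : ~` cdisc m = \bigcup_(z in A) B z.
  apply/seteqP; split => z Az; first by exists z => //; have [] := HB z Az.
  by move: Az => [w Aw Bz]; have [_ BA _ _] := HB w Aw; exact: BA.
apply: bigcup_connected.
  by exists b => z Az; have [] := HB z Az.
by move=> z Az; have [] := HB z Az.
Qed.

End Exterior.

(** * Universal elements of a space of power series *)

Section Universality.
Variable R : realType.
Local Notation C := (Cplx R).

Lemma rat_approx (x e : R) : 0 < e -> exists q : rat, `|ratr q - x| < e.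
Proof.
move=> e0; have : x - e < x + e by lra.
move=> /rat_in_itvoo[q]; rewrite in_itv /= => /andP[h1 h2]; exists q.
by rewrite ltr_norml; apply/andP; split; lra.
Qed.

(* An enumeration of the polynomials with coefficients in Q(i). *)
Definition rpoly (a : nat) : {poly C} :=
  \poly_(k < size (odflt [::] (unpickle a : option (seq (rat * rat)))))
    (let s := odflt [::] (unpickle a) in
     cpl (ratr (nth (0, 0) s k).1) (ratr (nth (0, 0) s k).2)).

(** The bound on the size turns closeness of coefficients into uniform closeness on discs. *)
Lemma rpoly_dense (p : {poly C}) (e : R) : 0 < e -> exists a,
  (size (rpoly a) <= size p)%N /\ forall k, modulus ((rpoly a)`_k - p`_k) < e.
Proof.
move=> e0; have e2 : 0 < e / 2 by rewrite divr_gt0.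
have /choice[s Hs] : forall k, exists qr : rat * rat,
    modulus (cpl (ratr qr.1) (ratr qr.2) - p`_k) < e.
  move=> k; have [q Hq] := rat_approx (re p`_k) e2.
  have [r Hr] := rat_approx (im p`_k) e2; exists (q, r).
  apply: le_lt_trans (modulus_le_re_im _) _; rewrite reB imB /= [ltRHS]splitr.
  exact: ltrD.
exists (pickle (mkseq s (size p))).
rewrite /rpoly pickleK /= size_mkseq; split; first exact: size_poly.
move=> k; rewrite coef_poly; case: ltnP => kp; first by rewrite nth_mkseq.
by rewrite nth_default // subrr modulus0.
Qed.

Lemma horner_close (p q : {poly C}) (m e : R) (z : C) : 0 <= e -> 0 <= m ->
  modulus z <= m -> (size q <= size p)%N -> (forall k, modulus (q`_k - p`_k) <= e) ->
  modulus (q.[z] - p.[z]) <= e * \sum_(k < size p) m ^+ k.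
Proof.
move=> e0 m0 zm qp H.
rewrite (@horner_coef_wide _ (size p) q) // horner_coef -sumrB.
apply: le_trans (modulus_sum _ _ _) _; rewrite mulr_sumr; apply: ler_sum => k _.
rewrite -mulrBl modulusM modulusX; apply: ler_pM => //; try exact: modulus_ge0.
  by rewrite exprn_ge0 ?modulus_ge0.
by rewrite lerXn2r ?nnegrE ?modulus_ge0.
Qed.

Lemma rpoly_dense_disc (p : {poly C}) (m e : R) : 0 <= m -> 0 < e ->
  exists a, forall z, modulus z <= m -> modulus ((rpoly a).[z] - p.[z]) < e.
Proof.
move=> m0 e0; pose S := \sum_(k < size p) m ^+ k.
have S0 : 0 <= S by apply: sumr_ge0 => k _; exact: exprn_ge0.
have e1 : 0 < e / (S + 1) by rewrite divr_gt0 // ltr_wpDl.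
have [a [a1 a2]] := rpoly_dense p e1; exists a => z zm.
apply: le_lt_trans (horner_close (ltW e1) m0 zm a1 (fun k => ltW (a2 k))) _.
rewrite -/S mulrAC ltr_pdivrMr; last by rewrite ltr_wpDl.
by rewrite ltr_pM2l // ltrDl.
Qed.

(** A polynomial, a class of blocks and a counter that makes every such pair recur infinitely often.
    Numbers encoding nothing are read as (0, 0, 0). *)
Definition code (i : nat) : nat * nat * nat := odflt (0, 0, 0)%N (unpickle i).
Definition code_poly i := (code i).1.1.
Definition code_class i := (code i).1.2.

(** Codes of (a, l, m) for varying m are distinct, so they cannot all lie below N. *)
Lemma code_surj a l N : exists i, [/\ (N <= i)%N, code_poly i = a & code_class i = l].
Proof.
have [i iN] : exists m : nat, (N <= pickle (a, l, m))%N.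
  apply: contrapT => H.
  have lt (m : nat) : (pickle (a, l, m) < N)%N by rewrite ltnNge; apply/negP => h; apply: H; exists m.
  pose g (m : 'I_N.+1) : 'I_N := Ordinal (lt m).
  have gi : injective g.
    by move=> x y /(congr1 val) /= /(pcan_inj pickleK) [/val_inj].
  by have := leq_card g gi; rewrite !card_ord ltnn.
exists (pickle (a, l, i)); split=> //; by rewrite /code_poly /code_class /code pickleK.
Qed.

Variables (mu : nat -> nat) (alpha : nat -> C).
Hypothesis mu_incr : increasing_seq mu.
Hypothesis alpha0 : forall n, alpha n != 0.

Lemma mu_ge n : (n <= mu n)%N.
Proof.
elim: n => // n IH; apply: leq_ltn_trans IH _.
by have := mu_incr n.+1 n; rewrite !leEnat ltnn ltnNge => ->.
Qed.

(* The polynomial B with alpha_n S_n(B^(n)) = p, when the degree of p is at most n. *)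
Definition block (n : nat) (p : {poly C}) : {poly C} :=
  \poly_(k < n + size p) (if (n <= k)%N then
     p`_(k - n) * (k - n)`!%:R / (k`!%:R * alpha n) else 0).

Lemma coef_block n p k : (block n p)`_k = if (n <= k)%N then
     p`_(k - n) * (k - n)`!%:R / (k`!%:R * alpha n) else 0.
Proof.
rewrite coef_poly; case: ltnP => // h; case: leqP => // nk.
by rewrite nth_default ?mul0r // -(leq_add2l n) subnKC.
Qed.

Lemma fact_neq0 n : n`!%:R != 0 :> C.
Proof. by rewrite pnatr_eq0 -lt0n fact_gt0. Qed.

(** The interface shared by formal series and H(D_r). [small i p] is the growth condition under
    which p may serve as the i-th block, and [realize] sums any subfamily of such blocks. *)
Variable V : preTopologicalLmodType C.
Variable coef : V -> nat -> C.
Variable S : nat -> V -> C -> C.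
Variable emb : {poly C} -> V.
Variable small : nat -> {poly C} -> Prop.

(** By the second condition, coefficient k of a sum of blocks involves only indices i <= k; hence
    the finite sums over [i < k.+1]. *)
Definition admissible (B : nat -> {poly C}) :=
  (forall i, small i (B i)) /\ forall i k, (B i)`_k != 0 -> (i <= k)%N.

Hypothesis coef_linear : forall a u v k, coef (a *: u + v) k = a * coef u k + coef v k.
Hypothesis coef_inj : forall u, (forall k, coef u k = 0) -> u = 0.
Hypothesis coef_cont : forall u k (e : R), 0 < e ->
  nbhs u [set v | modulus (coef v k - coef u k) < e].
Hypothesis S_coef : forall n u z, S n u z =
  \sum_(k < n.+1) coef u (n + k) * ((n + k)`!%:R / k`!%:R) * z ^+ k.
Hypothesis coef_emb : forall p k, coef (emb p) k = p`_k.
Hypothesis small_block : forall i p, exists N, forall n, (N <= n)%N -> small i (block n p).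
Hypothesis realize : forall B (L : pred nat), admissible B ->
  exists u, forall k, coef u k = \sum_(i < k.+1 | L i) (B i)`_k.
(** The data p, e and i0 depend on B and O alone, so a rational polynomial q and a class of blocks
    starting after i0 can be selected afterwards. *)
Hypothesis emb_dense : forall B, admissible B -> forall O : set V, open O -> O !=set0 ->
  exists (p : {poly C}) (e : R) i0, 0 < e /\ forall (q : {poly C}) (L : pred nat) u,
    (size q <= size p)%N -> (forall k, modulus (q`_k - p`_k) < e) ->
    (forall i, L i -> (i0 <= i)%N) ->
    (forall k, coef u k = \sum_(i < k.+1 | L i) (B i)`_k) -> O (emb q + u).

Lemma coefvD u v k : coef (u + v) k = coef u k + coef v k.
Proof. by have := coef_linear 1 u v k; rewrite scale1r mul1r. Qed.

Lemma coefv0 k : coef 0 k = 0.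
Proof. by apply: (@addrI _ (coef 0 k)); rewrite -coefvD !addr0. Qed.

Lemma coefvZ a u k : coef (a *: u) k = a * coef u k.
Proof. by have := coef_linear a u 0 k; rewrite addr0 coefv0 addr0. Qed.

Lemma coefv_sum (n : nat) (c : 'I_n -> C) (v : 'I_n -> V) k :
  coef (\sum_(i < n) c i *: v i) k = \sum_(i < n) c i * coef (v i) k.
Proof.
elim: n c v => [|n IH] c v; first by rewrite !big_ord0 coefv0.
by rewrite !big_ord_recr /= coefvD IH coefvZ.
Qed.

Lemma positions_exist : exists n : nat -> nat, [/\ forall i, range mu (n i),
  forall i, (size (rpoly (code_poly i)) <= n i)%N,
  forall i, (2 * n i < n i.+1)%N & forall i, small i (block (n i) (rpoly (code_poly i)))].
Proof.
have /choice[g Hg] : forall im : nat * nat, exists n, [/\ range mu n,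
    (size (rpoly (code_poly im.1)) <= n)%N, (2 * im.2 < n)%N &
    small im.1 (block n (rpoly (code_poly im.1)))].
  move=> [i m] /=; have [N HN] := small_block i (rpoly (code_poly i)).
  set s := size _; exists (mu (N + s + (2 * m).+1)%N).
  have h := mu_ge (N + s + (2 * m).+1)%N.
  split; [by eexists|lia|lia|apply: HN; lia].
pose fix n i := if i is j.+1 then g (i, n j) else g (0%N, 0%N).
exists n; split.
- by case=> [|i] /=; [case: (Hg (0, 0)%N)|case: (Hg (i.+1, n i))].
- by case=> [|i] /=; [case: (Hg (0, 0)%N)|case: (Hg (i.+1, n i))].
- by move=> i /=; case: (Hg (i.+1, n i)).
- by case=> [|i] /=; [case: (Hg (0, 0)%N)|case: (Hg (i.+1, n i))].
Qed.

Lemma nbhs_coefs u N (e : R) : 0 < e ->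
  nbhs u [set v | forall k, (k < N)%N -> modulus (coef v k - coef u k) < e].
Proof.
move=> e0; elim: N => [|N IH]; first by apply: filterS filterT => v _ k.
apply: filterS (filterI IH (coef_cont u N e0)) => v [/= H1 H2] k.
by rewrite ltnS leq_eqVlt => /predU1P[->|/H1].
Qed.

Definition continuous_functional (L : V -> C) := forall u (e : R), 0 < e ->
  nbhs u [set v | modulus (L v - L u) < e].

Lemma functionalD L M : continuous_functional L -> continuous_functional M ->
  continuous_functional (fun u => L u + M u).
Proof.
move=> HL HM u e e0; have e2 : 0 < e / 2 by rewrite divr_gt0.
apply: filterS (filterI (HL u _ e2) (HM u _ e2)) => v [/= h1 h2].
have -> : L v + M v - (L u + M u) = (L v - L u) + (M v - M u) by ring.
by have := modulusD (L v - L u) (M v - M u); lra.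
Qed.

Lemma functionalZ a L : continuous_functional L ->
  continuous_functional (fun u => L u * a).
Proof.
move=> HL u e e0; have e2 : 0 < e / (modulus a + 1).
  by rewrite divr_gt0 // ltr_wpDl ?modulus_ge0.
apply: filterS (HL u _ e2) => v /=.
rewrite -mulrBl modulusM ltr_pdivlMr; last by rewrite ltr_wpDl ?modulus_ge0.
by apply: le_lt_trans; rewrite ler_wpM2l ?modulus_ge0 // lerDl.
Qed.

Lemma functional_sum n (L : nat -> V -> C) : (forall i, continuous_functional (L i)) ->
  continuous_functional (fun u => \sum_(i < n) L i u).
Proof.
move=> HL; elim: n => [|n IH] u e e0.
  by apply: filterS filterT => v _ /=; rewrite !big_ord0 subrr modulus0.
apply: filterS (functionalD IH (HL n) u e0) => v /=.
by rewrite !big_ord_recr.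
Qed.

Lemma closed_functional_eq (L M : nat -> V -> C) : (forall k, continuous_functional (L k)) ->
  (forall k, continuous_functional (M k)) -> closed [set u | forall k, L k u = M k u].
Proof.
move=> HL HM u cu k; apply/eqP; rewrite -subr_eq0; apply/negPn/negP => d0.
have HN := functionalD (HL k) (functionalZ (-1) (HM k)).
have mu0 : 0 < modulus (L k u + M k u * -1) by rewrite mulrN1 modulus_gt0.
have [v [Fv /=]] := cu _ (HN u _ mu0).
by rewrite (Fv k) mulrN1 subrr sub0r modulusN ltxx.
Qed.

(** A bound e strictly below 1 / (m + 1) leaves room for perturbations, which makes the set open. *)
Definition near_poly (a m s : nat) : set V := [set u | exists t (e : R),
  [/\ range mu t, (s <= t)%N, e < m.+1%:R^-1 &
    forall z : C, modulus z <= m%:R -> modulus (alpha t * S t u z - (rpoly a).[z]) <= e]].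

Lemma S_close u v t (m d : R) (z : C) : 0 <= m -> 0 <= d -> modulus z <= m ->
  (forall k, (k < t + t.+1)%N -> modulus (coef v k - coef u k) < d) ->
  modulus (alpha t * S t v z - alpha t * S t u z) <=
    d * (modulus (alpha t) * \sum_(k < t.+1) modulus ((t + k)`!%:R / k`!%:R : C) * m ^+ k).
Proof.
move=> m0 d0 zm H; rewrite -mulrBr modulusM mulrCA; apply: ler_wpM2l; first exact: modulus_ge0.
rewrite !S_coef -sumrB; apply: le_trans (modulus_sum _ _ _) _; rewrite mulr_sumr.
apply: ler_sum => k _; rewrite -mulrBl -mulrBl !modulusM modulusX -!mulrA.
apply: ler_pM; [exact: modulus_ge0| |by apply/ltW/H; rewrite ltn_add2l|].
  by rewrite !mulr_ge0 ?exprn_ge0 ?modulus_ge0.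
do 2 (apply: ler_wpM2l; first exact: modulus_ge0).
by rewrite lerXn2r ?nnegrE ?modulus_ge0.
Qed.

(** For fixed t only the coefficients of index at most 2 t matter, and changing them slightly uses
    up only half of the room left by e. *)
Lemma open_near_poly a m s : open (near_poly a m s).
Proof.
rewrite openE => u [t [e [mt st em H]]].
set E : R := m.+1%:R^-1 in em.
pose A : R := modulus (alpha t) * \sum_(k < t.+1) modulus ((t + k)`!%:R / k`!%:R : C) * m%:R ^+ k.
have A0 : 0 <= A.
  rewrite mulr_ge0 ?modulus_ge0 // sumr_ge0 // => k _.
  by rewrite mulr_ge0 ?modulus_ge0 ?exprn_ge0.
pose d := (E - e) / 2 / (A + 1).
have d0 : 0 < d by rewrite /d !divr_gt0 ?subr_gt0 // ltr_wpDl.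
apply: filterS (nbhs_coefs u (t + t.+1) d0) => v /= Hv.
exists t, (e + (E - e) / 2); split=> //; first by rewrite -/E; lra.
move=> z zm.
have -> : alpha t * S t v z - (rpoly a).[z] =
  (alpha t * S t u z - (rpoly a).[z]) + (alpha t * S t v z - alpha t * S t u z) by ring.
apply: le_trans (modulusD _ _) _; apply: lerD; first exact: H.
apply: le_trans (S_close (ler0n _ m) (ltW d0) zm Hv) _.
rewrite -/A /d mulrAC ler_pdivrMr; last by rewrite ltr_wpDl.
by rewrite ler_pM2l ?divr_gt0 ?subr_gt0 // lerDl.
Qed.

Definition poly_universal (u : V) := forall a m s, near_poly a m s u.

Lemma poly_universalP u (q : {poly C}) (m e : R) s : poly_universal u -> 0 < e ->
  exists t, [/\ range mu t, (s <= t)%N & forall z : C, modulus z <= m ->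
    modulus (alpha t * S t u z - q.[z]) < e].
Proof.
move=> Hu e0; have e2 : 0 < e / 2 by rewrite divr_gt0.
pose m' := (Num.truncn `|m| + Num.truncn (2 / e)).+1.
have [t1 t2] : m <= m'%:R /\ m'.+1%:R^-1 <= e / 2.
  have /andP[_ h1] := truncn_itv (normr_ge0 m).
  have /andP[_ h2] : (Num.truncn (2 / e))%:R <= 2 / e < (Num.truncn (2 / e)).+1%:R.
    by apply: truncn_itv; rewrite divr_ge0 // ltW.
  split.
    apply: le_trans (ler_norm m) _; apply: le_trans (ltW h1) _.
    by rewrite ler_nat /m' ltnS leq_addr.
  rewrite -[leRHS]invrK lef_pV2 ?posrE ?invr_gt0 //.
  rewrite invf_div; apply: le_trans (ltW h2) _.
  by rewrite ler_nat /m' ltnS; lia.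
have [a Ha] := rpoly_dense_disc q (ler0n R m') e2.
have [t [e' [mt st em H]]] := Hu a m' s.
exists t; split=> // z zm; have zm' := le_trans zm t1.
apply: le_lt_trans (modulus_triangle (rpoly a).[z] _ _) _.
rewrite [ltRHS]splitr; apply: ler_ltD; last exact: Ha.
by apply: le_trans (H z zm') _; apply: le_trans (ltW em) t2.
Qed.

Lemma poly_universal_W u : poly_universal u -> universal_set S mu alpha u.
Proof.
move=> Hu K h cK cnK ch hol.
have [M M0 KM] := compact_modulus_bounded cK.
have happ := mergelyan cK cnK ch hol.
have /choice[g Hg] : forall js : nat * nat, exists t, [/\ range mu t, (js.2 < t)%N &
    forall z, K z -> modulus (alpha t * S t u z - h z) <= js.1.+1%:R^-1].
  move=> [j s] /=; have e0 : 0 < (j.+1%:R^-1 : R) / 2 by rewrite divr_gt0 ?invr_gt0.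
  have [q Hq] := happ _ e0.
  have [t [mt st H]] := poly_universalP q M s.+1 Hu e0.
  exists t; split=> // z Kz; apply: le_trans (modulus_triangle q.[z] _ _) _.
  by rewrite [leRHS]splitr; apply: lerD; apply: ltW; [exact: H (KM z Kz)|exact: Hq].
(* Each index is chosen after the previous one, with error at most 1 / (j + 1) at step j. *)
pose fix lam j := if j is i.+1 then g (j, lam i) else g (0, 0)%N.
have lam_lt i : (lam i < lam i.+1)%N by case: (Hg (i.+1, lam i)).
have lamE j : exists s, lam j = g (j, s) by case: j => [|j]; eexists.
exists lam; split.
- apply: le_mono => i j; rewrite ltEnat /=; elim: j => // j IH.
  by rewrite ltnS leq_eqVlt => /predU1P[->|/IH lij]; [exact: lam_lt|exact: ltn_trans lij (lam_lt j)].
- by move=> _ [j _ <-]; have [s ->] := lamE j; case: (Hg (j, s)).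
- set F := (X in X @ _ --> _).
  have F0 j : 0 <= F j <= j.+1%:R^-1.
    have [s E] := lamE j; have [_ _ H] := Hg (j, s).
    rewrite /F; have [->|/set0P[z0 Kz0]] := eqVneq K set0.
      by rewrite image_set0 sup0 lexx invr_ge0 ler0n.
    have ub : ubound [set modulus (alpha (lam j) * S (lam j) u z - h z) | z in K] j.+1%:R^-1.
      by move=> _ [z Kz <-]; rewrite E; exact: H.
    apply/andP; split; last by apply: ge_sup => //; eexists; exists z0.
    apply: le_trans (modulus_ge0 (alpha (lam j) * S (lam j) u z0 - h z0)) _.
    apply: sup_upper_bound; last by exists z0.
    by split; [eexists; exists z0|exists j.+1%:R^-1].
  apply: (@squeeze_cvgr _ _ _ _ (fun=> 0) (@harmonic R) F).
  + by near=> j; exact: F0.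
  + exact: cvg_cst.
  + exact: cvg_harmonic.
Unshelve. all: by end_near.
Qed.

(** * Sums of disjoint blocks *)

Section Blocks.
Variable n : nat -> nat.
Hypothesis n_mu : forall i, range mu (n i).
Hypothesis n_size : forall i, (size (rpoly (code_poly i)) <= n i)%N.
Hypothesis n_gap : forall i, (2 * n i < n i.+1)%N.
Hypothesis n_small : forall i, small i (block (n i) (rpoly (code_poly i))).

Let B i := block (n i) (rpoly (code_poly i)).

Lemma n_lt i j : (i < j)%N -> (2 * n i < n j)%N.
Proof.
elim: j => // j IH; rewrite ltnS leq_eqVlt => /predU1P[->|/IH h]; first exact: n_gap.
by have := n_gap j; lia.
Qed.

Lemma n_ge i : (i <= n i)%N.
Proof. by elim: i => // i IH; have := n_gap i; lia. Qed.

Lemma block_supp i k : (B i)`_k != 0 -> (n i <= k <= 2 * n i)%N.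
Proof.
rewrite coef_block; case: leqP => [nk|_]; last by rewrite eqxx.
move=> h; rewrite mul2n -addnn -leq_subLR /=.
have : (k - n i < size (rpoly (code_poly i)))%N.
  by rewrite ltnNge; apply: contraNN h => h; rewrite nth_default // !mul0r.
by have := n_size i; lia.
Qed.

Lemma admissible_blocks : admissible B.
Proof.
split=> // i k /block_supp /andP[h _]; exact: leq_trans (n_ge i) h.
Qed.

(** The supports [n_i, 2 n_i] are disjoint, so no other block contributes at the indices of block
    i. *)
Lemma sum_blocks (w : nat -> C) i k : (n i <= k <= 2 * n i)%N ->
  \sum_(j < k.+1) w j * (B j)`_k = w i * (B i)`_k.
Proof.
move=> /andP[k1 k2].
have ik : (i < k.+1)%N by rewrite ltnS (leq_trans (n_ge i)).
rewrite (bigD1 (Ordinal ik)) //= big1 ?addr0 // => j ji.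
have [->|/block_supp/andP[j1 j2]] := eqVneq (B j)`_k 0; first by rewrite mulr0.
have [ltij|ltji|eqij] := ltngtP i j.
- by have := n_lt ltij; lia.
- by have := n_lt ltji; lia.
- by move: ji; rewrite -(inj_eq val_inj) /= eqij eqxx.
Qed.

Lemma sum_blocks_cond (P : pred nat) i k : (n i <= k <= 2 * n i)%N ->
  \sum_(j < k.+1 | P j) (B j)`_k = (P i)%:R * (B i)`_k.
Proof.
move=> h; rewrite -(sum_blocks (fun j => (P j)%:R) h) big_mkcond /=.
by apply: eq_bigr => j _; case: (P j); rewrite ?mul1r ?mul0r.
Qed.

Lemma S_block u (g : C) i z : (forall k, (n i <= k <= 2 * n i)%N -> coef u k = g * (B i)`_k) ->
  alpha (n i) * S (n i) u z = g * (rpoly (code_poly i)).[z].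
Proof.
move=> H; rewrite S_coef.
rewrite (@horner_coef_wide _ (n i).+1); last exact: leq_trans (n_size i) (leqnSn _).
rewrite !mulr_sumr; apply: eq_bigr => k _.
have kn : (n i <= n i + k <= 2 * n i)%N by have := ltn_ord k; lia.
rewrite (H _ kn) coef_block leq_addr addKn.
have := fact_neq0 (n i + k); have := fact_neq0 k; have := alpha0 (n i).
by move=> a1 a2 a3; field; rewrite a1 a2 a3.
Qed.

(** To approach p, take a late block of class l whose polynomial is close to p / g. The bound K
    disregards an initial stretch of coefficients, where u may be arbitrary. *)
Lemma class_universal u l (g : C) K : g != 0 ->
  (forall i, code_class i = l -> (K <= n i)%N ->
     forall k, (n i <= k <= 2 * n i)%N -> coef u k = g * (B i)`_k) ->
  poly_universal u.
Proof.
move=> g0 H a m s.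
have gp : 0 < modulus g by rewrite modulus_gt0.
have e0 : 0 < (m.+1%:R^-1 / 2) / modulus g :> R by rewrite !divr_gt0 ?invr_gt0.
have [a' Ha'] := rpoly_dense_disc (g^-1 *: rpoly a) (ler0n R m) e0.
have [i [iK ia il]] := code_surj a' l (K + s)%N.
have ni := n_ge i.
exists (n i), (m.+1%:R^-1 / 2); split=> //; first by lia.
  by rewrite ltr_pdivrMr // ltr_pMr ?invr_gt0 // ltr1n.
have iK' : (K <= n i)%N by lia.
move=> z zm; rewrite (S_block z (H i il iK')) ia.
have -> : g * (rpoly a').[z] - (rpoly a).[z] = g * ((rpoly a').[z] - (g^-1 *: rpoly a).[z]).
  by rewrite hornerZ; field.
by rewrite modulusM mulrC -ler_pdivlMr // ltW // Ha'.
Qed.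

(** Every class contains the block of a polynomial close to 1, whose constant coefficient is
    nonzero. This pivot will make the multiplier of a class a continuous linear functional. *)
Lemma pivot_exists : exists pv : nat -> nat * nat, forall l,
  code_class (pv l).1 = l /\ (B (pv l).1)`_((pv l).2) != 0.
Proof.
suff /choice[pv Hpv] : forall l, exists ik : nat * nat,
  code_class ik.1 = l /\ (B ik.1)`_(ik.2) != 0 by exists pv.
move=> l.
have [a [_ Ha]] := rpoly_dense 1 (ltr01 : 0 < 1 :> R).
have [i [_ ia il]] := code_surj a l 0.
exists (i, n i + 0)%N; split=> //=.
rewrite coef_block leq_addr addKn ia; have := Ha 0%N; rewrite coefC eqxx => h.
have p0 : (rpoly a)`_0 != 0.
  by apply: contraTneq h => ->; rewrite sub0r modulusN modulus1 ltxx.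
rewrite !mulf_neq0 ?fact_neq0 // invr_neq0 // mulf_neq0 ?fact_neq0 //.
Qed.

Section Pivots.
Variable pv : nat -> nat * nat.
Hypothesis pv_class : forall l, code_class (pv l).1 = l.
Hypothesis pv_neq0 : forall l, (B (pv l).1)`_((pv l).2) != 0.

Let mult l u := coef u (pv l).2 / (B (pv l).1)`_((pv l).2).

(* The closed subspace: within each class of blocks, the coefficients of u are a
   constant multiple, read off at the pivot, of those of the blocks. *)
Definition block_space : set V := [set u | forall k,
  coef u k = \sum_(i < k.+1) mult (code_class i) u * (B i)`_k].

Lemma mult_linear l a u v : mult l (a *: u + v) = a * mult l u + mult l v.
Proof. by rewrite /mult coef_linear mulrDl mulrA. Qed.

Lemma block_space_submod : submod_closed (mem block_space).
Proof.
split.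
  apply/mem_set => k; rewrite coefv0 big1 // => i _.
  by rewrite /mult coefv0 !mul0r.
move=> a u v /set_mem Hu /set_mem Hv; apply/mem_set => k.
rewrite coef_linear Hu Hv mulr_sumr -big_split /=.
by apply: eq_bigr => i _; rewrite mult_linear mulrDl mulrA.
Qed.

Lemma coef_functional k : continuous_functional (fun u => coef u k).
Proof. by move=> u e e0; exact: coef_cont. Qed.

Lemma block_space_closed : closed block_space.
Proof.
apply: (@closed_functional_eq (fun k u => coef u k)
  (fun k u => \sum_(i < k.+1) mult (code_class i) u * (B i)`_k)) => k.
  exact: coef_functional.
apply: (@functional_sum _ (fun i u => mult (code_class i) u * (B i)`_k)) => i.
by do 2 apply: functionalZ; exact: coef_functional.
Qed.

(** If all multipliers vanished, so would all coefficients; a nonzero multiplier makes u universal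
    through its class. *)
Lemma block_space_universal u : block_space u -> u <> 0 -> poly_universal u.
Proof.
move=> Hu u0.
have [l gl] : exists l, mult l u != 0.
  apply: contrapT => H; apply/u0/coef_inj => k; rewrite Hu big1 // => i _.
  have [->|h] := eqVneq (mult (code_class i) u) 0; first by rewrite mul0r.
  by exfalso; apply: H; exists (code_class i).
apply: (class_universal (l := l) (K := 0%N) gl) => i il _ k /sum_blocks E.
by rewrite Hu (E (fun j => mult (code_class j) u)) il.
Qed.

Section Generators.
Variable f : nat -> V.
Hypothesis coef_f : forall l k, coef (f l) k = \sum_(i < k.+1 | code_class i == l) (B i)`_k.

Lemma coef_f_block l i k : (n i <= k <= 2 * n i)%N ->
  coef (f l) k = (code_class i == l)%:R * (B i)`_k.
Proof. by move=> h; rewrite coef_f (sum_blocks_cond (fun j => code_class j == l) h). Qed.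

Lemma mult_f l l' : mult l' (f l) = (l' == l)%:R.
Proof.
rewrite /mult (coef_f_block l (block_supp (pv_neq0 l'))) pv_class.
by rewrite mulfK // pv_neq0.
Qed.

Lemma block_space_f l : block_space (f l).
Proof.
move=> k; rewrite coef_f big_mkcond /=; apply: eq_bigr => i _.
by rewrite mult_f; case: eqP => _; rewrite ?mul1r ?mul0r.
Qed.

Lemma f_neq0 l : f l <> 0.
Proof.
move=> h; have := mult_f l l; rewrite h /mult coefv0 mul0r eqxx => /eqP.
by rewrite eq_sym oner_eq0.
Qed.

Lemma mult_sum l N (c : 'I_N -> C) (v : 'I_N -> V) :
  mult l (\sum_(i < N) c i *: v i) = \sum_(i < N) c i * mult l (v i).
Proof.
by rewrite /mult coefv_sum mulr_suml; apply: eq_bigr => i _; rewrite mulrA.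
Qed.

(** If N vectors spanned the f_l, a left kernel vector of the (N + 1) x N coefficient matrix would
    give a relation among N + 1 of the f_l; applying the multipliers shows that its coefficients are
    all 0. *)
Lemma block_space_infinite_dimensional : infinite_dimensional block_space.
Proof.
move=> [N [v [_ Hv]]].
have /choice[c Hc] : forall l : nat, exists c : 'I_N -> C, f l = \sum_(i < N) c i *: v i.
  by move=> l; apply: Hv; exact: block_space_f.
pose A : 'M[C]_(N.+1, N) := \matrix_(l, i) c l i.
have : (0 < \rank (kermx A))%N.
  by rewrite mxrank_ker subn_gt0 ltnS rank_leq_col.
rewrite lt0n mxrank_eq0 => /rowV0Pn[x /sub_kermxP xA x0].
move/negP: x0; apply; apply/eqP/rowP => l; rewrite mxE.
have z0 : \sum_(j < N.+1) x 0 j *: f j = 0.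
  under eq_bigr => j _ do rewrite Hc scaler_sumr.
  rewrite exchange_big /= big1 // => i _.
  under eq_bigr => j _ do rewrite scalerA.
  rewrite -scaler_suml; have /rowP/(_ i) := xA; rewrite !mxE => E.
  rewrite [X in X *: _](_ : _ = 0) ?scale0r // -[RHS]E.
  by apply: eq_bigr => j _; rewrite mxE.
have := mult_sum l (fun j => x 0 j) (fun j : 'I_N.+1 => f j).
rewrite z0 /mult coefv0 mul0r => E; rewrite [RHS]E (bigD1 l) //= big1 ?addr0.
  by have := mult_f l l; rewrite /mult eqxx => ->; rewrite mulr1.
move=> j jl; have := mult_f j l; rewrite /mult => ->.
by rewrite eq_sym (inj_eq val_inj) (negbTE jl) mulr0.
Qed.

(** The index l has two roles: it encodes a polynomial, for density, and it labels the class of the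
    tail f_l, so that tails of distinct generators have disjoint supports. *)
Let g l := emb (rpoly (code_poly l)) + f l.

Definition generated : set V := [set u | exists N (c : nat -> C),
  u = \sum_(l < N) c l *: g l].

Lemma generated_submod : submod_closed (mem generated).
Proof.
split; first by apply/mem_set; exists 0%N, (fun=> 0); rewrite big_ord0.
move=> a u v /set_mem[N [c ->]] /set_mem[M [d ->]]; apply/mem_set.
exists (maxn N M), (fun l => a * (if (l < N)%N then c l else 0) + (if (l < M)%N then d l else 0)).
have E P (e : nat -> C) : (P <= maxn N M)%N -> \sum_(l < P) e l *: g l =
    \sum_(l < maxn N M) (if (l < P)%N then e l else 0) *: g l.
  move=> PM; rewrite (big_ord_widen _ (fun l => e l *: g l) PM) big_mkcond /=.
  by apply: eq_bigr => l _; case: ifP => // _; rewrite scale0r.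
rewrite (E _ _ (leq_maxl N M)) (E _ _ (leq_maxr N M)) scaler_sumr -big_split /=.
by apply: eq_bigr => l _; rewrite scalerA -scalerDl.
Qed.

(** Beyond the degrees of the finitely many polynomials involved, u coincides on the blocks of class
    l with c_l times these blocks. *)
Lemma generated_universal u : generated u -> u <> 0 -> poly_universal u.
Proof.
move=> [N [c uE]] u0.
have [l lN cl] : exists2 l, (l < N)%N & c l != 0.
  apply: contrapT => H; apply: u0; rewrite uE big1 // => l _.
  have [->|h] := eqVneq (c l) 0; first by rewrite scale0r.
  by exfalso; apply: H; exists l.
pose K := \max_(j < N) size (rpoly (code_poly j)).
apply: (class_universal (l := l) (K := K) cl) => i il Ki k nk.
rewrite uE (coefv_sum (fun j : 'I_N => c j) (fun j : 'I_N => g j)).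
rewrite (bigD1 (Ordinal lN)) //= big1 ?addr0.
  rewrite coefvD coef_emb nth_default ?add0r.
    by rewrite (coef_f_block _ nk) il eqxx mul1r.
  apply: leq_trans (leq_trans Ki _); last by case/andP: nk.
  exact: (leq_bigmax (F := fun j : 'I_N => size (rpoly (code_poly j))) (Ordinal lN)).
move=> j jl; rewrite coefvD coef_emb nth_default ?add0r.
  rewrite (coef_f_block _ nk) il; case: eqP => [E|_]; last by rewrite mul0r mulr0.
  by move: jl; rewrite -(inj_eq val_inj) /= E eqxx.
apply: leq_trans (leq_trans Ki _); last by case/andP: nk.
exact: (leq_bigmax (F := fun j : 'I_N => size (rpoly (code_poly j))) j).
Qed.

(** A later block of class l with the polynomial of the pivot has a nonzero coefficient beyond the
    degree of the polynomial part, where only f_l contributes. *)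
Lemma generator_neq0 l : g l <> 0.
Proof.
move=> h.
have [i [iK ia il]] := code_surj (code_poly (pv l).1) l (size (rpoly (code_poly l))).
set k := ((pv l).2 - n (pv l).1 + n i)%N.
have /andP[p1 p2] := block_supp (pv_neq0 l).
have B0 : (B i)`_k != 0.
  move: (pv_neq0 l); rewrite !coef_block p1 leq_addl /k addnK ia.
  case: (eqVneq ((rpoly (code_poly (pv l).1))`_((pv l).2 - n (pv l).1)) 0) => [->|h1 _].
    by rewrite !mul0r eqxx.
  by rewrite !mulf_neq0 ?fact_neq0 // invr_neq0 // mulf_neq0 ?fact_neq0.
have nk := block_supp B0.
have := coefvD (emb (rpoly (code_poly l))) (f l) k; rewrite -/(g l) h coefv0 coef_emb.
rewrite nth_default; last first.
  by apply: leq_trans iK (leq_trans (n_ge i) _); case/andP: nk.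
rewrite add0r (coef_f_block _ nk) il eqxx mul1r => /eqP.
by rewrite eq_sym (negbTE B0).
Qed.

Lemma generator_dense (O : set V) : open O -> O !=set0 -> exists l, O (g l).
Proof.
move=> oO O0; have [p [e [i0 [e0 H]]]] := emb_dense admissible_blocks oO O0.
have [a [a1 a2]] := rpoly_dense p e0.
(* A label l above the classes of the first i0 blocks, so that every block of class l has index at
   least i0; at the same time l encodes a polynomial close to p. *)
have [l [ll la _]] := code_surj a 0 (\max_(i < i0) code_class i).+1.
exists l; apply: (H _ (fun i => code_class i == l)) => //; rewrite ?la //.
- move=> i /eqP il; rewrite leqNgt; apply/negP => ii.
  move: ll; rewrite ltnNge => /negP; apply; rewrite -il.
  exact: (leq_bigmax (F := fun i : 'I_i0 => code_class i) (Ordinal ii)).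
Qed.

End Generators.
End Pivots.
End Blocks.

Lemma universal_set_near_poly u a m s :
  universal_set S mu alpha u -> near_poly a m s u.
Proof.
move=> Wu; pose q := rpoly a.
have hq (z : C) : derivable (horner q) z 1 by exact: derivable_hornerC.
have cq : {within cdisc m%:R, continuous (horner q)}.
  apply: continuous_subspaceT => z.
  by have /derivable_has_derivP[l Hl] := hq z; exact: has_deriv_continuous Hl.
have [lam [incr lam_mu lim]] := Wu (cdisc m%:R) (horner q) (@compact_cdisc R _)
  (connected_cdiscC (ler0n R m)) cq (fun z _ => hq z).
have e0 : 0 < (m.+1%:R^-1 : R) / 2 by rewrite divr_gt0 ?invr_gt0.
have /cvgrPdist_le/(_ _ e0)[N _ HN] := lim.
have lam_ge j : (j <= lam j)%N.
  elim: j => // j IH; apply: leq_ltn_trans IH _.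
  by have := incr j.+1 j; rewrite !leEnat ltnn ltnNge => ->.
pose j := (N + s)%N; exists (lam j), (m.+1%:R^-1 / 2); split.
- by apply: lam_mu; exists j.
- by apply: leq_trans (lam_ge j); rewrite leq_addl.
- by rewrite ltr_pdivrMr // ltr_pMr ?invr_gt0 // ltr1n.
move=> z zm; have := HN j (leq_addr _ _).
rewrite /= sub0r normrN => /(le_trans (ler_norm _)); apply: le_trans.
apply: sup_upper_bound; last by exists z.
split; first by eexists; exists z.
(* The difference is a polynomial in z, hence bounded on the disc, so the supremum does dominate
   each value. *)
pose P := alpha (lam j) *: (\poly_(k < (lam j).+1)
  (coef u (lam j + k) * ((lam j + k)`!%:R / k`!%:R))) - q.
have [b _ Hb] := horner_bounded P (ler0n R m).
exists b => _ [w wm <-]; have := Hb w wm.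
by rewrite /P hornerD hornerN hornerZ horner_poly S_coef.
Qed.

Theorem universality : (exists u, universal_set S mu alpha u) /\
  large_set (universal_set S mu alpha).
Proof.
have [n [n_mu n_size n_gap n_small]] := positions_exist.
have adm := admissible_blocks n_size n_gap n_small.
have [pv Hpv] := pivot_exists n.
have pv_class l := (Hpv l).1; have pv0 l := (Hpv l).2.
have /choice[f Hf] : forall l : nat, exists u, forall k, coef u k =
    \sum_(i < k.+1 | code_class i == l) (block (n i) (rpoly (code_poly i)))`_k.
  by move=> l; exact: (realize (fun i => code_class i == l) adm).
have fF l := block_space_f n_size n_gap pv_class pv0 Hf l.
(* A countable intersection of open sets, indexed by the codes of the triples (a, m, s). *)
have WE : universal_set S mu alpha =
    \bigcap_i near_poly (code i).1.1 (code i).1.2 (code i).2.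
  apply/seteqP; split => u; first by move=> Wu i _; exact: universal_set_near_poly.
  move=> Hu; apply: poly_universal_W => a m s.
  by have := Hu (pickle (a, m, s)) I; rewrite /code pickleK.
split.
  exists (f 0%N); apply: poly_universal_W.
  apply: (block_space_universal n_mu n_size n_gap (fF 0%N)).
  exact: (f_neq0 n_size n_gap pv_class pv0 Hf).
split.
- split.
    move=> O O0 oO; have [l Ol] := generator_dense n_size n_gap n_small Hf oO O0.
    eexists; split; first exact: Ol.
    apply: poly_universal_W; apply: (generated_universal n_mu n_size n_gap Hf).
      exists l.+1, (fun j => (j == l)%:R); rewrite big_ord_recr /= eqxx scale1r.
      rewrite big1 ?add0r // => j _; rewrite ltn_eqF ?scale0r //; exact: ltn_ord.
    exact: (generator_neq0 n_size n_gap pv0 Hf).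
  rewrite WE; exists (fun i => near_poly (code i).1.1 (code i).1.2 (code i).2) => // i.
  exact: open_near_poly.
- exists (generated f); split.
  + exact: generated_submod.
  + move=> O O0 oO; have [l Ol] := generator_dense n_size n_gap n_small Hf oO O0.
    eexists; split; first exact: Ol.
    exists l.+1, (fun j => (j == l)%:R); rewrite big_ord_recr /= eqxx scale1r.
    rewrite big1 ?add0r // => j _; rewrite ltn_eqF ?scale0r //; exact: ltn_ord.
  + move=> u [Du u0]; apply: poly_universal_W.
    exact: (generated_universal n_mu n_size n_gap Hf Du u0).
- exists (block_space n pv); split.
  + exact: block_space_submod.
  + exact: block_space_closed.
  + exact: (block_space_infinite_dimensional n_size n_gap pv_class pv0 Hf).
  + move=> u [Fu u0]; apply: poly_universal_W.
    exact: (block_space_universal n_mu n_size n_gap Fu u0).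
Qed.

End Universality.

(** * The space of formal power series *)

Section FormalSeries.
Variable R : realType.
Local Notation C := (Cplx R).

Lemma iter_fps_deriv (a : fps R) n k :
  iter n (@fps_deriv R) a k = a (n + k)%N * ((n + k)`!%:R / k`!%:R).
Proof.
elim: n k => [|n IH] k; first by rewrite /= add0n divff ?mulr1 // fact_neq0.
rewrite iterS /fps_deriv IH addnS addSn -[LHS]mulr_natr -mulrA; congr (_ * _).
have h := fact_neq0 R k; have h2 : (k.+1%:R : C) != 0 by rewrite pnatr_eq0.
rewrite (factS k) (natrM _ k.+1).
by move: (k.+1%:R : C) (k`!%:R : C) h2 h => x y x0 y0; field; rewrite x0 y0.
Qed.

Lemma fps_coef_cont (a : fps R) k (e : R) : 0 < e ->
  nbhs a [set b : fps R | modulus (b k - a k) < e].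
Proof.
move=> e0; have := @proj_continuous nat (fun=> C) k a.
by move=> /(_ [set y | modulus (y - a k) < e]); apply; apply/nbhs_modulusP; exists e.
Qed.

(** The sets that contain such a coefficient neighbourhood of a form a filter; it converges
    pointwise to a, so it contains every neighbourhood of a. *)
Lemma fps_nbhs (a : fps R) (O : set (fps R)) : nbhs a O ->
  exists N (e : R), 0 < e /\
    forall b : fps R, (forall k, (k < N)%N -> modulus (b k - a k) < e) -> O b.
Proof.
pose F : set_system (nat -> C) := [set A | exists N (e : R), 0 < e /\
  forall b : fps R, (forall k, (k < N)%N -> modulus (b k - a k) < e) -> A b].
have FF : Filter F.
  split.
  - by exists 0%N, 1.
  - move=> A B [N [e [e0 H]]] [N' [e' [e'0 H']]]; exists (maxn N N'), (Num.min e e').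
    rewrite lt_min e0; split=> // b Hb; split.
      by apply: H => k kN; have := Hb k; rewrite lt_min leq_max kN => /(_ isT)/andP[].
    by apply: H' => k kN; have := Hb k; rewrite lt_min leq_max kN orbT => /(_ isT)/andP[].
  - by move=> A B AB [N [e [e0 H]]]; exists N, e; split=> // b /H/AB.
have : {ptws, F --> (a : nat -> C)}.
  apply/pointwise_cvgP => k A /nbhs_modulusP[e e0 HA].
  by exists k.+1, e; split=> // b Hb; apply/HA/Hb.
by move=> h /h.
Qed.

Lemma fps_universality (mu : nat -> nat) (alpha : nat -> C) :
  increasing_seq mu -> (forall n, alpha n != 0) ->
  let W := universal_set (@fps_S R) mu alpha in (exists f : fps R, W f) /\ large_set W.
Proof.
move=> mu_incr alpha0.
pose coef (a : fps R) := a : nat -> C.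
pose emb (p : {poly C}) : fps R := fun k => p`_k.
apply: (@universality R mu alpha mu_incr alpha0 (fps R) coef (@fps_S R) emb (fun _ _ => True)).
- by [].
- by move=> u u0; apply/funext.
- exact: fps_coef_cont.
- move=> n u z; apply: eq_bigr => k _.
  by rewrite iter_fps_deriv.
- by [].
- by move=> i p; exists 0%N.
- by move=> B L _; eexists (fun k => \sum_(i < k.+1 | L i) (B i)`_k).
- move=> B _ O oO [a Oa]; have /fps_nbhs[N [e [e0 H]]] : nbhs a O by exact: open_nbhs_nbhs.
  (* Only coefficients below N count: p truncates a there, and the blocks kept start at index N or
     later. *)
  exists (\poly_(k < N) a k), e, N; split=> // q L u _ Hq HL Hu; apply: H => k kN.
  have -> : (emb q + u) k = q`_k + u k by [].
  rewrite [u k]Hu big1 ?addr0; last first.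
    by move=> i /HL Ni; have := ltn_ord i; lia.
  by have := Hq k; rewrite coef_poly kN.
Qed.

End FormalSeries.

(** * Taylor coefficients and the space of holomorphic functions *)

Section PolyDerivatives.
Variable R : realType.
Local Notation C := (Cplx R).
Implicit Types (p q : {poly C}) (f : C -> C).

(** The limit is the supremum of the lower bounds x i - c i, which retains the rate c. *)
Lemma real_squeeze (x c : nat -> R) : (forall i, 0 <= c i) ->
  (forall i j, (i <= j)%N -> `|x i - x j| <= c i) -> exists l, forall i, `|x i - l| <= c i.
Proof.
move=> c0 H.
have lu i j : x i - c i <= x j + c j.
  have [ij|/ltnW ji] := leqP i j.
    by have := H _ _ ij; rewrite ler_norml => /andP[_ h]; have := c0 j; lra.
  by have := H _ _ ji; rewrite ler_norml => /andP[h _]; have := c0 i; lra.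
have hs : has_sup (range (fun i => x i - c i)).
  by split; [exists (x 0%N - c 0%N), 0%N|exists (x 0%N + c 0%N) => _ [i _ <-]].
exists (sup (range (fun i => x i - c i))) => i.
have h1 : x i - c i <= sup (range (fun i => x i - c i)).
  by apply: sup_upper_bound => //; exists i.
have h2 : sup (range (fun i => x i - c i)) <= x i + c i.
  by apply: ge_sup; [case: hs|move=> _ [j _ <-]].
by rewrite ler_norml; apply/andP; split; lra.
Qed.

Lemma complex_squeeze (x : nat -> C) (c : nat -> R) : (forall i, 0 <= c i) ->
  (forall i j, (i <= j)%N -> modulus (x i - x j) <= c i) ->
  exists l, forall i, modulus (x i - l) <= 2 * c i.
Proof.
move=> c0 H.
have [a Ha] : exists a, forall i, `|re (x i) - a| <= c i.
  by apply: real_squeeze => // i j /H; rewrite -reB; apply: le_trans; exact: re_le_modulus.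
have [b Hb] : exists b, forall i, `|im (x i) - b| <= c i.
  by apply: real_squeeze => // i j /H; rewrite -imB; apply: le_trans; exact: im_le_modulus.
exists (cpl a b) => i; apply: le_trans (modulus_le_re_im _) _; rewrite reB imB /=.
by have := Ha i; have := Hb i; lra.
Qed.

Lemma prim_root_exists (N : nat) : (0 < N)%N -> exists w : C, N.-primitive_root w.
Proof.
move=> N0; pose p : {poly C} := 'X^N - 1.
have [s Dp] := closed_field_poly_normal p.
rewrite (monicP _) ?monicXnsubC // scale1r in Dp.
have rn1 : all N.-unity_root s by apply/allP => z; rewrite -root_prod_XsubC -Dp.
have sz_s : (N < (size s).+1)%N by rewrite -(size_prod_XsubC s id) -Dp size_XnsubC.
have us : uniq s.
  by rewrite -separable_prod_XsubC -Dp separable_Xn_sub_1 // pnatr_eq0 -lt0n.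
by have /hasP[z _ Hz] := has_prim_root N0 rn1 us sz_s; exists z.
Qed.

(* Averaging [p] over the N-th roots of unity isolates a single coefficient. *)
Lemma cauchy_poly p (rho b : R) : 0 <= rho ->
  (forall z, modulus z <= rho -> modulus p.[z] <= b) ->
  forall k, modulus p`_k * rho ^+ k <= b.
Proof.
move=> r0 Hb k.
(* With N above k and the size of p, an exponent i + (N - k) with i < N is a multiple of N only for
   i = k. *)
pose N := (size p + k).+1.
have [w Hw] := prim_root_exists (ltn0Sn (size p + k)).
have mw : modulus w = 1.
  have : modulus w ^+ N = 1 by rewrite -modulusX (prim_expr_order Hw) modulus1.
  by move/eqP; rewrite pexpr_eq1 ?modulus_ge0 // => /eqP.
have mrho : modulus (cpl rho 0 : C) = rho by rewrite modulus_cpl0 ger0_norm.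
have orth (i : 'I_N) : \sum_(j < N) (w ^+ j) ^+ i * (w ^+ j) ^+ (N - k) =
    if i == k :> nat then N%:R else 0 :> C.
  have E : \sum_(j < N) (w ^+ j) ^+ i * (w ^+ j) ^+ (N - k) =
      \sum_(j < N) (w ^+ (i + (N - k))) ^+ j.
    by apply: eq_bigr => j _; rewrite -exprD -!exprM mulnC.
  have kN : (k < N)%N by rewrite /N ltnS leq_addl.
  rewrite E; case: eqP => [->|ik].
    rewrite subnKC ?(ltnW kN) // (prim_expr_order Hw).
    by under eq_bigr do rewrite expr1n; rewrite sumr_const card_ord.
  have w1 : w ^+ (i + (N - k)) != 1.
    rewrite -(prim_order_dvd Hw); apply/negP => /dvdnP[m Hm].
    have := ltn_ord i; case: m Hm => [|[|m]] Hm; lia.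
  apply: (mulfI (_ : w ^+ (i + (N - k)) - 1 != 0)); first by rewrite subr_eq0.
  rewrite mulr0 -subrX1 -exprM mulnC exprM (prim_expr_order Hw) expr1n subrr //.
have pN : (size p <= N)%N by rewrite /N ltnW // ltnS leq_addr.
have E : \sum_(j < N) p.[cpl rho 0 * w ^+ j] * (w ^+ j) ^+ (N - k) =
    N%:R * (p`_k * cpl rho 0 ^+ k).
  under eq_bigr => j _ do rewrite (horner_coef_wide _ pN) mulr_suml.
  rewrite exchange_big /=.
  have E2 (i : 'I_N) : \sum_(j < N) p`_i * (cpl rho 0 * w ^+ j) ^+ i * (w ^+ j) ^+ (N - k) =
      p`_i * cpl rho 0 ^+ i * (if i == k :> nat then N%:R else 0).
    by rewrite -orth mulr_sumr; apply: eq_bigr => j _; rewrite exprMn !mulrA.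
  under eq_bigr => i _ do rewrite E2.
  have kN : (k < N)%N by rewrite /N ltnS leq_addl.
  rewrite (bigD1 (Ordinal kN)) //= eqxx big1 ?addr0; first by rewrite mulrC.
  by move=> i; rewrite -(inj_eq val_inj) /= => /negbTE ->; rewrite mulr0.
have N0 : 0 < N%:R :> R by rewrite ltr0n.
rewrite -(ler_pM2l N0).
have -> : N%:R * (modulus p`_k * rho ^+ k) = modulus (N%:R * (p`_k * cpl rho 0 ^+ k)).
  by rewrite !modulusM modulusX mrho modulus_nat.
rewrite -E; apply: le_trans (modulus_sum _ _ _) _.
apply: (@le_trans _ _ (\sum_(j < N) b)); last first.
  by rewrite sumr_const card_ord mulr_natl.
apply: ler_sum => j _.
rewrite modulusM !modulusX mw !expr1n mulr1; apply: Hb.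
by rewrite modulusM modulusX mw expr1n mulr1 mrho.
Qed.

Lemma geom_sum (n : nat) : \sum_(i < n) (2^-1 : R) ^+ i <= 2.
Proof.
have -> : \sum_(i < n) (2^-1 : R) ^+ i = 2 - 2 * 2^-1 ^+ n.
  elim: n => [|n IH]; first by rewrite big_ord0 expr0 mulr1 subrr.
  by rewrite big_ord_recr /= IH exprS; field.
by rewrite gerBl mulr_ge0 // exprn_ge0.
Qed.

Lemma taylor_poly p (z : C) : exists q, [/\ forall h, q.[h] = p.[z + h],
  q`_0 = p.[z] & q`_1 = p^`().[z]].
Proof.
exists (p \Po ('X + z%:P)); split.
- by move=> h; rewrite horner_comp hornerD hornerX hornerC addrC.
- by rewrite -horner_coef0 horner_comp hornerD hornerX hornerC add0r.
- have := deriv_comp p ('X + z%:P); rewrite derivD derivX derivC addr0 mulr1 => E.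
  have : (p \Po ('X + z%:P))^`()`_0 = p^`().[z].
    by rewrite E -horner_coef0 horner_comp hornerD hornerX hornerC add0r.
  by rewrite coef_deriv mulr1n.
Qed.

Lemma deriv_poly_bound p (z : C) (d b : R) : 0 < d ->
  (forall h, modulus h <= d -> modulus p.[z + h] <= b) -> modulus p^`().[z] <= b / d.
Proof.
move=> d0 H; have [q [qE _ q1]] := taylor_poly p z.
rewrite ler_pdivlMr // -q1 -(expr1 d); apply: cauchy_poly (ltW d0) _ 1%N => h hd.
by rewrite qE; exact: H.
Qed.

(** By the Cauchy estimates for p(z + .), the term of degree i + 2 is at most b (|h| / d)^2 2^-i;
    the geometric sum gives the factor 2. *)
Lemma poly_remainder p (z : C) (d b : R) : 0 < d ->
  (forall h, modulus h <= d -> modulus p.[z + h] <= b) ->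
  forall h, modulus h <= d / 2 ->
  modulus (p.[z + h] - p.[z] - p^`().[z] * h) <= 2 * b * (modulus h / d) ^+ 2.
Proof.
move=> d0 H h hd; have [q [qE q0 q1]] := taylor_poly p z.
have Hq k : modulus q`_k * d ^+ k <= b.
  by apply: cauchy_poly (ltW d0) _ k => x xd; rewrite qE; exact: H.
have b0 : 0 <= b by apply: le_trans (Hq 0%N); rewrite mulr_ge0 ?modulus_ge0 ?exprn_ge0 // ltW.
have sq : (size q <= (size q).+2)%N by rewrite leqW.
have -> : p.[z + h] - p.[z] - p^`().[z] * h =
    \sum_(i < size q) q`_i.+2 * h ^+ i.+2.
  have E : q.[h] = q`_0 + (q`_1 * h + \sum_(i < size q) q`_i.+2 * h ^+ i.+2).
    by rewrite (horner_coef_wide _ sq) 2!big_ord_recl /= expr0 mulr1 expr1.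
  by rewrite -qE -q0 -q1 E; ring.
apply: le_trans (modulus_sum _ _ _) _.
set t := modulus h / d.
have t0 : 0 <= t by rewrite divr_ge0 ?modulus_ge0 // ltW.
have t2 : t <= 2^-1 by rewrite ler_pdivrMr //; lra.
apply: (@le_trans _ _ (\sum_(i < size q) b * t ^+ 2 * 2^-1 ^+ i)); last first.
  rewrite -mulr_sumr.
  have -> : 2 * b * t ^+ 2 = b * t ^+ 2 * 2 by ring.
  by apply: ler_wpM2l (geom_sum _); rewrite mulr_ge0 ?sqr_ge0.
apply: ler_sum => i _; rewrite modulusM modulusX.
have -> : modulus h = t * d by rewrite /t mulfVK // gt_eqF.
rewrite exprMn mulrCA [t ^+ _ * _]mulrC.
apply: (@le_trans _ _ (b * t ^+ i.+2)).
  by apply: ler_wpM2r; [exact: exprn_ge0|exact: Hq].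
rewrite -addn2 exprD [t ^+ i * _]mulrC mulrA; apply: ler_wpM2l; first by rewrite mulr_ge0 ?sqr_ge0.
by apply: lerXn2r => //; rewrite nnegrE.
Qed.

End PolyDerivatives.

(** * Derivatives of uniform limits of polynomials *)

Section ApproxDerivative.
Variable R : realType.
Local Notation C := (Cplx R).
Implicit Types (p q : {poly C}) (f : C -> C).

Definition near_on (rho e : R) p f := forall w : C, modulus w <= rho -> modulus (p.[w] - f w) <= e.

Lemma half_pow_gt0 i : 0 < (2^-1 : R) ^+ i.
Proof. by rewrite exprn_gt0 // invr_gt0. Qed.

Lemma half_pow_le i j : (i <= j)%N -> (2^-1 : R) ^+ j <= 2^-1 ^+ i.
Proof. by move=> ij; apply: ler_wiXn2l; rewrite ?invr_ge0 // invf_le1 // ler1n. Qed.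

Lemma le_half_pow (x y c : R) : (forall j, x <= y + c * 2^-1 ^+ j) -> x <= y.
Proof.
move=> H; apply/ler_addgt0Pr => e e0; have [n Hn] := exp2_small c e0.
by apply: le_trans (H n) _; rewrite lerD2l ltW.
Qed.

Lemma near_on_deriv (rho d e : R) f (z : C) p q (e' : R) : 0 < d -> modulus z + d <= rho ->
  near_on rho e p f -> near_on rho e' q f ->
  modulus (p^`().[z] - q^`().[z]) <= (e + e') / d.
Proof.
move=> d0 zd Hp Hq.
have -> : p^`().[z] - q^`().[z] = (p - q)^`().[z] by rewrite derivB hornerD hornerN.
apply: deriv_poly_bound => // h hd; rewrite hornerD hornerN.
have zh : modulus (z + h) <= rho by have := modulusD z h; lra.
have := modulus_triangle (f (z + h)) p.[z + h] q.[z + h].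
by have := Hp _ zh; have := Hq _ zh; rewrite (modulusC (f _)); lra.
Qed.

(** The derivatives of a sequence of approximants are Cauchy, and the quadratic remainder bound is
    uniform along it, so it passes to the limit. The second clause holds for every approximant,
    which lets the estimate be iterated. *)
Lemma approx_deriv (rho d : R) f (z : C) : 0 < d -> modulus z + d <= rho ->
  poly_approx (cdisc rho) f -> exists l, has_deriv f z l /\
    forall p e, near_on rho e p f -> modulus (p^`().[z] - l) <= e / d.
Proof.
move=> d0 zd Hf.
have /choice[P HP] : forall i, exists p, near_on rho (2^-1 ^+ i) p f.
  by move=> i; have [p Hp] := Hf _ (half_pow_gt0 i); exists p => w /Hp /ltW.
have c0 i : 0 <= 2 * 2^-1 ^+ i / d.
  by apply: divr_ge0; [apply: mulr_ge0; [|exact: ltW (half_pow_gt0 i)]|exact: ltW].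
have [l Hl] : exists l, forall i, modulus ((P i)^`().[z] - l) <= 2 * (2 * 2^-1 ^+ i / d).
  apply: (@complex_squeeze R (fun i => (P i)^`().[z])) => // i j ij.
  apply: le_trans (near_on_deriv d0 zd (HP i) (HP j)) _.
  rewrite ler_pM2r ?invr_gt0 //; have := half_pow_le ij; lra.
exists l; split; last first.
  move=> p e Hp; apply: (@le_half_pow _ _ (5 / d)) => j.
  apply: le_trans (modulus_triangle (P j)^`().[z] _ _) _.
  apply: le_trans (lerD (near_on_deriv d0 zd Hp (HP j)) (Hl j)) _.
  have -> : (e + 2^-1 ^+ j) / d + 2 * (2 * 2^-1 ^+ j / d) = e / d + 5 / d * 2^-1 ^+ j by ring.
  by [].
have [b b0 Hb] := poly_approx_bounded (m := rho) (fun w h => h) Hf.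
have Pb i h : modulus h <= d -> modulus (P i).[z + h] <= b + 1.
  move=> hd; have zh : modulus (z + h) <= rho by have := modulusD z h; lra.
  have h1 := HP i _ zh; have h2 := Hb _ zh; have h3 := half_pow_le (leq0n i).
  rewrite expr0 in h3; have := modulus_geB (P i).[z + h] (f (z + h)); lra.
have rem h : modulus h <= d / 2 ->
    modulus (f (z + h) - f z - l * h) <= 2 * (b + 1) * (modulus h / d) ^+ 2.
  move=> hd; apply: (@le_half_pow _ _ (2 + 4 / d * modulus h)) => j.
  have h1 := @poly_remainder R (P j) z d (b + 1) d0 (Pb j) h hd.
  have zh : modulus (z + h) <= rho by have := modulusD z h; lra.
  have zr : modulus z <= rho by lra.
  have -> : f (z + h) - f z - l * h =
    ((P j).[z + h] - (P j).[z] - (P j)^`().[z] * h) +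
    (((P j).[z] - f z) - ((P j).[z + h] - f (z + h)) + ((P j)^`().[z] - l) * h) by ring.
  apply: le_trans (modulusD _ _) _; apply: lerD; first exact: h1.
  apply: le_trans (modulusD _ _) _.
  have -> : (2 + 4 / d * modulus h) * 2^-1 ^+ j =
    (2^-1 ^+ j + 2^-1 ^+ j) + 2 * (2 * 2^-1 ^+ j / d) * modulus h by ring.
  apply: lerD.
    by apply: le_trans (modulusB _ _) _; apply: lerD; [exact: HP|exact: HP].
  by rewrite modulusM; apply: ler_wpM2r; [exact: modulus_ge0|exact: Hl].
move=> e e0.
have K0 : 0 < 2 * (b + 1) / d ^+ 2 by rewrite divr_gt0 ?exprn_gt0 ?mulr_gt0 // ltr_wpDl // ltW.
exists (Num.min (d / 2) (e / (2 * (b + 1) / d ^+ 2))).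
  by rewrite lt_min; apply/andP; split; [rewrite divr_gt0|exact: divr_gt0 e0 K0].
move=> y; rewrite lt_min => /andP[/ltW y1 y2].
have -> : f y = f (z + (y - z)) by congr f; ring.
apply: le_trans (rem _ y1) _.
rewrite ltr_pdivlMr // mulrC in y2.
have -> : 2 * (b + 1) * (modulus (y - z) / d) ^+ 2 =
   (2 * (b + 1) / d ^+ 2 * modulus (y - z)) * modulus (y - z).
  by move: (modulus (y - z)) => t; field; rewrite gt_eqF.
by apply: ler_wpM2r; [exact: modulus_ge0|exact: ltW].
Qed.

Lemma approx_derive1 (rho d e : R) f p : 0 < d -> 
  poly_approx (cdisc rho) f -> near_on rho e p f ->
  near_on (rho - d) (e / d) p^`() (derive1 f).
Proof.
move=> d0 Hf Hp w wd.
have [l [Hl H]] : exists l, has_deriv f w l /\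
    forall p e, near_on rho e p f -> modulus (p^`().[w] - l) <= e / d.
  by apply: approx_deriv => //; lra.
by rewrite (has_deriv_derive1 Hl); exact: H.
Qed.

Lemma poly_approx_derive1 (rho d : R) f : 0 < d ->
  poly_approx (cdisc rho) f -> poly_approx (cdisc (rho - d)) (derive1 f).
Proof.
move=> d0 Hf e e0; have e1 : 0 < e * d / 2 by rewrite !divr_gt0 ?mulr_gt0.
have [p Hp] := Hf _ e1; exists p^`() => z zr.
have Hp' : near_on rho (e * d / 2) p f by move=> w /Hp /ltW.
apply: le_lt_trans (approx_derive1 d0 Hf Hp' zr) _.
have -> : e * d / 2 / d = e / 2 by field; rewrite gt_eqF.
by rewrite ltr_pdivrMr // ltr_pMr // ltr1n.
Qed.

(** Each derivative costs half of the radius; c depends on k and rho, not on f, p or e. *)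
Lemma approx_derive1n k (rho : R) : 0 < rho -> exists2 c : R, 0 < c &
  forall f p e, poly_approx (cdisc rho) f -> near_on rho e p f ->
    modulus (p^`(k).[0] - derive1n k f 0) <= c * e.
Proof.
elim: k rho => [|k IH] rho r0.
  exists 1 => // f p e _ Hp; rewrite mul1r derivn0; apply: Hp.
  by rewrite modulus0 ltW.
have r2 : 0 < rho / 2 by rewrite divr_gt0.
have [c c0 Hc] := IH _ r2; exists (c / (rho / 2)); first by rewrite divr_gt0.
move=> f p e Hf Hp; rewrite derivSn.
have -> : derive1n k.+1 f 0 = derive1n k (derive1 f) 0 by rewrite /derive1n iterSr.
have rE : rho - rho / 2 = rho / 2 by field.
have H1 := approx_derive1 r2 Hf Hp; have H2 := poly_approx_derive1 r2 Hf.
rewrite rE in H1 H2.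
have -> : c / (rho / 2) * e = c * (e / (rho / 2)) by ring.
exact: Hc H2 H1.
Qed.

Definition taylor_coef f k : C := derive1n k f 0 / k`!%:R.

(** A second approximant q tends to f: the constant of [approx_derive1n] multiplies a vanishing
    error, and the sharp Cauchy estimate for p - q remains. *)
Lemma taylor_coef_close (rho e : R) f p k : 0 < rho ->
  poly_approx (cdisc rho) f -> near_on rho e p f ->
  modulus (p`_k - taylor_coef f k) * rho ^+ k <= e.
Proof.
move=> r0 Hf Hp.
have [c c0 Hc] := approx_derive1n k r0.
have kf : modulus (k`!%:R : C) = k`!%:R by rewrite modulus_nat.
have k1 : 1 <= k`!%:R :> R by rewrite ler1n fact_gt0.
have kn : (k`!%:R : C) != 0 by exact: fact_neq0.
apply: (@le_half_pow _ _ (1 + c * rho ^+ k)) => j.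
have [q Hq] := Hf _ (half_pow_gt0 j).
have Hq' : near_on rho (2^-1 ^+ j) q f by move=> w /Hq /ltW.
have h1 : modulus (q`_k - taylor_coef f k) <= c * 2^-1 ^+ j.
  have -> : q`_k - taylor_coef f k = (q^`(k).[0] - derive1n k f 0) / k`!%:R.
    rewrite /taylor_coef horner_coef0 coef_derivn addn0 ffactnn -mulr_natr.
    by field.
  rewrite modulusM modulusV kf ler_pdivrMr; last by lra.
  apply: le_trans (Hc _ _ _ Hf Hq') _; rewrite ler_peMr //.
  by rewrite mulr_ge0 // ltW // half_pow_gt0.
have h2 : modulus (p - q)`_k * rho ^+ k <= e + 2^-1 ^+ j.
  apply: (cauchy_poly (ltW r0)) => z zr; rewrite hornerD hornerN.
  have := modulus_triangle (f z) p.[z] q.[z]; have := Hp z zr; have := Hq' z zr.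
  by rewrite (modulusC (f z)); lra.
have rk : 0 <= rho ^+ k by rewrite exprn_ge0 // ltW.
have h3 : modulus (p`_k - taylor_coef f k) <= modulus (p - q)`_k + c * 2^-1 ^+ j.
  apply: le_trans (modulus_triangle q`_k _ _) _.
  by rewrite coefB; apply: lerD.
apply: le_trans (ler_wpM2r rk h3) _.
have -> : (1 + c * rho ^+ k) * 2^-1 ^+ j = 2^-1 ^+ j + c * 2^-1 ^+ j * rho ^+ k by ring.
by rewrite mulrDl addrA; apply: lerD.
Qed.

End ApproxDerivative.

(** * Coefficients and topology of H(D_r) *)

Section HolSpace.
Variable R : realType.
Local Notation C := (Cplx R).
Variable r : \bar R.
Hypothesis r_gt0 : (0 < r)%E.
Implicit Types (p q : {poly C}) (f g u : hol r).

Lemma ereal_between (x : R) : (x%:E < r)%E -> exists2 y : R, x < y & (y%:E < r)%E.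
Proof.
case: r => [s||] //; last by exists (x + 1); rewrite ?ltrDl ?ltry.
by rewrite lte_fin => xs; exists ((x + s) / 2); rewrite ?lte_fin; lra.
Qed.

Lemma radii_exist : exists rho : nat -> R, (forall i, 0 < rho i /\ ((rho i)%:E < r)%E) /\
  forall x : R, (x%:E < r)%E -> exists N, forall i, (N <= i)%N -> x <= rho i.
Proof.
case: r r_gt0 => [s||] //; last first.
  move=> _; exists (fun i => i.+1%:R); split=> [i|x _]; first by rewrite ltr0n ltry.
  exists (Num.truncn `|x|) => i iN; apply: le_trans (ler_norm x) _.
  have /andP[_ /ltW h] := truncn_itv (normr_ge0 x).
  by apply: le_trans h _; rewrite ler_nat ltnS.
rewrite lte_fin => s0; exists (fun i => s * (1 - i.+2%:R^-1)); split=> [i|x].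
  have h : 0 < i.+2%:R^-1 :> R by rewrite invr_gt0.
  have h1 : i.+2%:R^-1 < 1 :> R by rewrite invf_lt1 // ltr1n.
  rewrite lte_fin; split; first by rewrite mulr_gt0 // subr_gt0.
  by rewrite gtr_pMr // gtrBl.
rewrite lte_fin => xs; exists (Num.truncn (s / (s - x))) => i iN.
have sx : 0 < s - x by rewrite subr_gt0.
have /andP[_ h] : (Num.truncn (s / (s - x)))%:R <= s / (s - x) < (Num.truncn (s / (s - x))).+1%:R.
  by apply: truncn_itv; rewrite divr_ge0 // ltW.
have h2 : s / (s - x) < i.+2%:R.
  by apply: lt_le_trans h _; rewrite ler_nat ltnS (leq_trans iN).
rewrite ltr_pdivrMr // mulrC -ltr_pdivrMr // in h2.
by rewrite mulrBr mulr1 lerBrDl -lerBrDr; exact: ltW.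
Qed.

Lemma cdisc_disc (rho : R) (z : C) : (rho%:E < r)%E -> cdisc rho z -> disc r z.
Proof. by rewrite /disc /cdisc /= => h zw; apply: le_lt_trans h; rewrite lee_fin. Qed.

Lemma open_disc (z : C) : disc r z -> exists2 d : R, 0 < d & forall y, modulus (y - z) < d -> disc r y.
Proof.
move=> /ereal_between[s zs sr]; exists (s - modulus z); first by rewrite subr_gt0.
move=> y yz; apply: (cdisc_disc sr); rewrite /cdisc /=.
by have := modulus_geB y z; lra.
Qed.

Lemma holP f : hol_set r (\val f).
Proof. exact: set_mem (valP f). Qed.

Lemma hol_eq f g : (forall z, disc r z -> \val f z = \val g z) -> f = g.
Proof.
move=> H; apply: val_inj; apply/funext => z.
have [Dz|nDz] := pselect (disc r z); first exact: H.
by rewrite (holP f).2 // (holP g).2.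
Qed.

Lemma hol_of (h : C -> C) : holomorphic_on (disc r) h ->
  exists f : hol r, forall z, disc r z -> \val f z = h z.
Proof.
move=> hh; pose g z := if ((modulus z)%:E < r)%E then h z else 0.
have gE z : disc r z -> g z = h z by rewrite /disc /g /= => ->.
have Hg : hol_pred r g.
  apply/mem_set; split=> z Dz; last by rewrite /g ifF //; apply/negP.
  have [d d0 Hd] := open_disc Dz.
  by apply: (derivable_nearC d0 _ (hh z Dz)) => y /Hd /gE.
by exists (exist _ g Hg).
Qed.

(** The source of the facts below on Taylor coefficients: they are read off these polynomial
    approximants. *)
Lemma hol_approx f (rho : R) : 0 <= rho -> (rho%:E < r)%E -> poly_approx (cdisc rho) (\val f).
Proof.
move=> r0 rr; have [hf _] := holP f.
apply: mergelyan.
- exact: compact_cdisc.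
- exact: connected_cdiscC.
- apply/within_continuous_modulusP => z Kz e e0.
  have /derivable_has_derivP[l Hl] := hf z (cdisc_disc rr Kz).
  have /continuous_modulusP/(_ e e0)[d d0 Hd] := has_deriv_continuous Hl.
  by exists d => // y _ /Hd.
- by move=> z /interior_subset Kz; apply: hf; exact: cdisc_disc Kz.
Qed.

Definition hol_coef f k : C := taylor_coef (\val f) k.

Lemma hol_coef_close f (rho e : R) p k : 0 < rho -> (rho%:E < r)%E ->
  near_on rho e p (\val f) -> modulus (p`_k - hol_coef f k) * rho ^+ k <= e.
Proof. by move=> r0 rr Hp; apply: taylor_coef_close => //; apply: hol_approx => //; exact: ltW. Qed.

Lemma modulus_small_eq (x y : C) (c : R) :
  (forall e : R, 0 < e -> modulus (x - y) <= c * e) -> x = y.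
Proof.
move=> H; apply/eqP; rewrite -subr_eq0 -modulus_eq0; apply/eqP/le_anti.
rewrite modulus_ge0 andbT; apply: (@le_half_pow R _ _ c) => j.
by rewrite add0r; apply: H; exact: half_pow_gt0.
Qed.

Lemma hol_coef_unique f k (c : C) (b : R) :
  (forall (rho e : R), 0 < rho -> (rho%:E < r)%E -> 0 < e ->
    exists p, near_on rho (b * e) p (\val f) /\ modulus (p`_k - c) <= b * e) ->
  hol_coef f k = c.
Proof.
have [s s0 sr] := ereal_between r_gt0.
move=> H; apply: (@modulus_small_eq _ _ (b / s ^+ k + b)) => e e0.
have [p [Hp pc]] := H s e s0 sr e0.
have := hol_coef_close k s0 sr Hp; rewrite -ler_pdivlMr ?exprn_gt0 // => h.
have := modulus_triangle p`_k (hol_coef f k) c; rewrite (modulusC (hol_coef f k) p`_k).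
have -> : (b / s ^+ k + b) * e = b * e / s ^+ k + b * e by ring.
by move: h pc; lra.
Qed.

(** If p and q approximate f and g up to e, then a p + q approximates a f + g up to (|a| + 1) e, and
    coefficients of polynomials are linear. *)
Lemma hol_coef_linear (a : C) f g k :
  hol_coef (a *: f + g) k = a * hol_coef f k + hol_coef g k.
Proof.
have [s s0 sr] := ereal_between r_gt0.
pose b := (modulus a + 1) * (1 + (s ^+ k)^-1).
have sk : 0 < (s ^+ k)^-1 by rewrite invr_gt0 exprn_gt0.
have a0 := modulus_ge0 a.
apply: (@modulus_small_eq _ _ (2 * b)) => e e0.
have [p Hp] := hol_approx f (ltW s0) sr e0; have [q Hq] := hol_approx g (ltW s0) sr e0.
have Hp' : near_on s e p (\val f) by move=> w /Hp /ltW.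
have Hq' : near_on s e q (\val g) by move=> w /Hq /ltW.
have Hpq : near_on s ((modulus a + 1) * e) (a *: p + q) (\val (a *: f + g)).
  move=> w ws; have -> : \val (a *: f + g) w = a * \val f w + \val g w by [].
  rewrite hornerD hornerZ.
  have -> : a * p.[w] + q.[w] - (a * \val f w + \val g w) =
    a * (p.[w] - \val f w) + (q.[w] - \val g w) by ring.
  apply: le_trans (modulusD _ _) _; rewrite modulusM mulrDl mul1r.
  by apply: lerD; [apply: ler_wpM2l => //; exact: Hp'|exact: Hq'].
have h1 := hol_coef_close k s0 sr Hp'; have h2 := hol_coef_close k s0 sr Hq'.
have h3 := hol_coef_close k s0 sr Hpq.
rewrite -!ler_pdivlMr ?exprn_gt0 // in h1 h2 h3.
have -> : hol_coef (a *: f + g) k - (a * hol_coef f k + hol_coef g k) =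
  - ((a *: p + q)`_k - hol_coef (a *: f + g) k) + (a * (p`_k - hol_coef f k) +
   (q`_k - hol_coef g k)) by rewrite coefD coefZ; ring.
apply: le_trans (modulusD _ _) _; rewrite modulusN.
have h4 := modulusD (a * (p`_k - hol_coef f k)) (q`_k - hol_coef g k).
rewrite modulusM in h4.
have h5 := ler_wpM2l a0 h1.
have h6 : 0 < (modulus a + 1) * e by rewrite mulr_gt0 //; lra.
have -> : 2 * b * e = 2 * ((modulus a + 1) * e) + 2 * ((modulus a + 1) * e / s ^+ k).
  by rewrite /b; ring.
have h7 : modulus a * (e / s ^+ k) + e / s ^+ k = (modulus a + 1) * e / s ^+ k by ring.
lra.
Qed.

Lemma geom_bound (t : R) n : 0 <= t -> t < 1 -> \sum_(i < n) t ^+ i <= (1 - t)^-1.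
Proof.
move=> t0 t1; have h : 0 < 1 - t by lra.
rewrite -[leRHS]mul1r ler_pdivlMr // mulrC.
have -> : (1 - t) * \sum_(i < n) t ^+ i = 1 - t ^+ n.
  have := subrX1 t n; set s := \sum_(i < n) _ => E.
  have -> : (1 - t) * s = - ((t - 1) * s) by ring.
  by rewrite -E; ring.
by rewrite gerBl exprn_ge0.
Qed.

(** For s between |z| and r, an approximant up to e has coefficients at most e s^-k, so its value at
    z is at most e times a geometric sum. *)
Lemma hol_coef_inj f : (forall k, hol_coef f k = 0) -> f = 0.
Proof.
move=> f0; apply: hol_eq => z Dz; have -> : \val (0 : hol r) z = 0 by [].
have [s zs sr] := ereal_between Dz.
have s0 : 0 < s by apply: le_lt_trans zs; exact: modulus_ge0.
pose t := modulus z / s.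
have t0 : 0 <= t by rewrite divr_ge0 ?modulus_ge0 // ltW.
have t1 : t < 1 by rewrite ltr_pdivrMr // mul1r.
apply: (@modulus_small_eq _ _ (1 + (1 - t)^-1)) => e e0; rewrite subr0.
have [p Hp] := hol_approx f (ltW s0) sr e0.
have Hp' : near_on s e p (\val f) by move=> w /Hp /ltW.
have pz : modulus p.[z] <= e * (1 - t)^-1.
  rewrite horner_coef; apply: le_trans (modulus_sum _ _ _) _.
  apply: (@le_trans _ _ (e * \sum_(i < size p) t ^+ i)); last first.
    by apply: ler_wpM2l; [exact: ltW|exact: geom_bound].
  rewrite mulr_sumr; apply: ler_sum => i _; rewrite modulusM modulusX.
  have := hol_coef_close i s0 sr Hp'; rewrite f0 subr0 => h.
  have -> : modulus z = s * t by rewrite /t mulrC mulfVK // gt_eqF.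
  by rewrite exprMn mulrA; apply: ler_wpM2r => //; exact: exprn_ge0.
have h1 : modulus (p.[z] - \val f z) <= e by apply: Hp'; exact: ltW.
have := modulus_geB (\val f z) p.[z]; rewrite (modulusC (\val f z)).
by rewrite mulrDl mul1r (mulrC _ e); lra.
Qed.

Lemma hol_coef_emb f p k : (forall z, disc r z -> \val f z = p.[z]) -> hol_coef f k = p`_k.
Proof.
move=> H; apply: (@hol_coef_unique _ _ _ 1) => s e s0 sr e0; exists p; split.
  by move=> w ws; rewrite H ?subrr ?modulus0 ?mul1r ?ltW //; exact: cdisc_disc ws.
by rewrite subrr modulus0 mul1r ltW.
Qed.

Lemma hol_nbhs_basic f (rho e : R) : (rho%:E < r)%E -> 0 < e ->
  nbhs f [set g : hol r | forall z, modulus z <= rho -> modulus (\val g z - \val f z) < e].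
Proof.
move=> rr e0.
pose E : set (C * C) := [set xy | modulus (xy.2 - xy.1) < e].
have entE : entourage E.
  rewrite -entourage_ballE; exists (cpl e 0) => /=; first by rewrite /= (ltr_cpl 0 e).
  by move=> [x y]; rewrite /ball /= /E /= (normC_modulus (x - y)) ltr_cpl modulusC.
have fam : [set K | compact K /\ K `<=` disc r] (cdisc rho).
  by split; [exact: compact_cdisc|move=> z; exact: cdisc_disc].
have := @fam_nbhs C C [set K | compact K /\ K `<=` disc r] (cdisc rho) E (\val f) entE fam.
move=> /(@initial_continuous (hol r) (compact_convergence r) (\val)).
done.
Qed.

Lemma compact_sub_disc (K : set C) : compact K -> K `<=` disc r ->
  exists rho : R, [/\ 0 < rho, (rho%:E < r)%E & K `<=` cdisc rho].
Proof.
have [rho [rho1 rho2]] := radii_exist.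
move=> /compact_near_coveringP H Kr.
have [|N _ HN] := H nat \oo (fun i z => modulus z <= rho i) _; last first.
  by exists (rho N); have [? ?] := rho1 N; split=> // z; apply: HN => /=.
move=> z Kz; have [s zs /rho2[N HN]] := ereal_between (Kr z Kz).
exists ([set y | modulus y < s], [set i | (N <= i)%N]).
  split; last by exists N.
  apply/nbhs_modulusP; exists (s - modulus z); first by rewrite subr_gt0.
  by move=> y yz /=; have := modulus_geB y z; lra.
by move=> [y i] /= [ys Ni]; apply: le_trans (ltW ys) (HN i Ni).
Qed.

(** As for formal series: the filter of these basic neighbourhoods converges to f uniformly on
    compact sets, so it contains every neighbourhood of f. *)
Lemma hol_nbhs_sub f (O : set (hol r)) : nbhs f O -> exists rho e : R,
  [/\ 0 < rho, (rho%:E < r)%E, 0 < e & forall g,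
    (forall z, modulus z <= rho -> modulus (\val g z - \val f z) < e) -> O g].
Proof.
pose F : set_system (C -> C) := [set A | exists rho e : R,
  [/\ 0 < rho, (rho%:E < r)%E, 0 < e & forall g : C -> C,
    (forall z, modulus z <= rho -> modulus (g z - \val f z) < e) -> A g]].
have FF : Filter F.
  split.
  - by have [s s0 sr] := ereal_between r_gt0; exists s, 1.
  - move=> A B [s [e [s0 sr e0 H]]] [s' [e' [s'0 s'r e'0 H']]].
    exists (Num.max s s'), (Num.min e e'); split.
    + by rewrite lt_max s0.
    + by rewrite /Num.max; case: ifP.
    + by rewrite lt_min e0.
    + move=> g Hg; split.
        by apply: H => z zs; have := Hg z; rewrite le_max zs lt_min => /(_ isT)/andP[].
      by apply: H' => z zs; have := Hg z; rewrite le_max zs orbT lt_min => /(_ isT)/andP[].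
  - by move=> A B AB [s [e [s0 sr e0 H]]]; exists s, e; split=> // g /H/AB.
have Fc : {family [set K | compact K /\ K `<=` disc r], F --> (\val f : C -> C)}.
  apply/fam_cvgP => K [cK Kr] A /uniform_nbhs[E [entE EA]].
  have [s [s0 sr Ks]] := compact_sub_disc cK Kr.
  move: entE; rewrite -entourage_ballE => -[e /= e0 He].
  have Ie : im e = 0 by move: (e0); rewrite ltC_re_im /= => /andP[/eqP -> _].
  have Re0 : 0 < re e by move: (e0); rewrite ltC_re_im /= => /andP[_].
  exists s, (re e); split=> // g Hg; apply: EA => z Kz; apply: He.
  rewrite /ball /= (cplE e) Ie (normC_modulus (\val f z - g z)) ltr_cpl modulusC.
  by apply: Hg; exact: Ks.
move=> [U [[W oW <-] Wf WO]].
have : nbhs (\val f : compact_convergence r) W by apply: open_nbhs_nbhs; split.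
move=> /Fc [s [e [s0 sr e0 H]]]; exists s, e; split=> // g Hg.
by apply: WO; exact: H.
Qed.

End HolSpace.

(** * Universality in H(D_r) *)

Section HolUniversality.
Variable R : realType.
Local Notation C := (Cplx R).

Definition weighted_norm (rho : R) (p : {poly C}) : R :=
  \sum_(k < size p) modulus p`_k * rho ^+ k.

Lemma horner_weighted (rho : R) (p : {poly C}) (z : C) :
  modulus z <= rho -> modulus p.[z] <= weighted_norm rho p.
Proof.
move=> zr; rewrite horner_coef; apply: le_trans (modulus_sum _ _ _) _.
apply: ler_sum => k _; rewrite modulusM modulusX; apply: ler_wpM2l; first exact: modulus_ge0.
by apply: lerXn2r => //; rewrite nnegrE ?modulus_ge0 // (le_trans (modulus_ge0 z)).
Qed.

Lemma sum_half_pow m n : \sum_(m <= i < n) (2^-1 : R) ^+ i <= 2 * 2^-1 ^+ m.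
Proof.
have [mn|/ltnW nm] := leqP m n; last first.
  by rewrite big_geq // mulr_ge0 // exprn_ge0.
rewrite -{1}[m]add0n big_addn big_mkord.
have -> : \sum_(i < n - m) (2^-1 : R) ^+ (i + m) = 2^-1 ^+ m * \sum_(i < n - m) 2^-1 ^+ i.
  by rewrite mulr_sumr; apply: eq_bigr => i _; rewrite exprD mulrC.
by rewrite mulrC; apply: ler_wpM2r (geom_sum R _); exact: exprn_ge0.
Qed.

Variable r : \bar R.
Hypothesis r_gt0 : (0 < r)%E.
Variable rho : nat -> R.
Hypothesis rho_in : forall i, 0 < rho i /\ ((rho i)%:E < r)%E.
Hypothesis rho_cofinal : forall x : R, (x%:E < r)%E -> exists N, forall i, (N <= i)%N -> x <= rho i.

(** The i-th block is at most 2^-i on the i-th disc of the exhaustion, so any subfamily is summable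
    on every disc of radius below r. *)
Definition hol_small (i : nat) (p : {poly C}) := weighted_norm (rho i) p <= 2^-1 ^+ i.

(** The partial sums converge at a geometric rate, uniformly on each disc, and a uniform limit of
    polynomials is derivable. The final tail bound serves density. *)
Lemma hol_realize (B : nat -> {poly C}) (L : pred nat) : admissible hol_small B ->
  exists u : hol r, (forall k, hol_coef u k = \sum_(i < k.+1 | L i) (B i)`_k) /\
    forall (x : R) i0, (forall i, (i0 <= i)%N -> x <= rho i) -> (forall i, L i -> (i0 <= i)%N) ->
    (x%:E < r)%E -> forall z, modulus z <= x -> modulus (\val u z) <= 2 * 2^-1 ^+ i0.
Proof.
move=> [Bs B0].
pose P n : {poly C} := \sum_(0 <= i < n | L i) B i.
have step (x : R) N z : (forall i, (N <= i)%N -> x <= rho i) -> modulus z <= x ->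
    forall m n, (N <= m)%N -> (m <= n)%N -> modulus ((P m).[z] - (P n).[z]) <= 2 * 2^-1 ^+ m.
  move=> HN zx m n Nm mn.
  have -> : (P m).[z] - (P n).[z] = - \sum_(m <= i < n | L i) (B i).[z].
    rewrite /P (@big_cat_nat _ _ _ m 0 n) //= hornerD opprD addrA subrr sub0r.
    by rewrite horner_sum.
  rewrite modulusN; apply: le_trans (modulus_sum _ _ _) _.
  apply: le_trans (sum_half_pow m n).
  rewrite big_nat_cond [leRHS]big_nat_cond [leLHS]big_mkcondr [leRHS]big_mkcondr /=.
  rewrite big_nat_cond [leRHS]big_nat_cond.
  apply: ler_sum => i /andP[/andP[mi _] _].
  case: (L i); last by rewrite exprn_ge0.
  apply: le_trans (Bs i); apply: horner_weighted.
  by apply: le_trans zx (HN i (leq_trans Nm mi)).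
(* The limit is chosen once for each z but the rate holds for all x and N, which makes it uniform on
   discs. *)
have /choice[h Hh] : forall z : C, exists l, disc r z -> forall (x : R) N,
    modulus z <= x -> (forall i, (N <= i)%N -> x <= rho i) ->
    forall n, (N <= n)%N -> modulus ((P n).[z] - l) <= 2 * 2^-1 ^+ n.
  move=> z; have [Dz|nD] := pselect (disc r z); last by exists 0.
  have [N0 HN0] := rho_cofinal Dz.
  have [l Hl] : exists l, forall i, modulus ((P (N0 + i)%N).[z] - l) <= 2 * (2 * 2^-1 ^+ (N0 + i)).
    apply: (@complex_squeeze R (fun i => (P (N0 + i)%N).[z]) (fun i => 2 * 2^-1 ^+ (N0 + i))).
      by move=> i; rewrite mulr_ge0 // exprn_ge0.
    move=> i j ij; apply: (step _ _ _ HN0 (lexx _)); first exact: leq_addr.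
    by rewrite leq_add2l.
  exists l => _ x N zx HN n Nn; apply: (@le_half_pow R _ _ 4) => j.
  have nm : (n <= N0 + (n + j))%N by lia.
  apply: le_trans (modulus_triangle (P (N0 + (n + j))%N).[z] _ _) _.
  apply: lerD; first exact: (step _ _ _ HN zx).
  apply: le_trans (Hl _) _.
  have jn : (j <= N0 + (n + j))%N by lia.
  by have := half_pow_le R jn; lra.
have happ (x : R) : (x%:E < r)%E -> poly_approx (cdisc x) h.
  move=> xr e e0; have [N HN] := rho_cofinal xr; have [n Hn] := exp2_small 2 e0.
  exists (P (N + n)%N) => z zx.
  apply: le_lt_trans (Hh z (cdisc_disc xr zx) x N zx HN _ (leq_addr _ _)) _.
  apply: le_lt_trans Hn; rewrite ler_pM2l //; apply: half_pow_le; exact: leq_addl.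
have hholo : holomorphic_on (disc r) h.
  move=> z Dz; have [s zs sr] := ereal_between Dz; apply/derivable_has_derivP.
  have d0 : 0 < s - modulus z by rewrite subr_gt0.
  have [|l [Hl _]] := @approx_deriv R s (s - modulus z) h z d0 _ (happ s sr).
    by rewrite addrC subrK.
  by exists l.
have [u uh] := hol_of hholo.
exists u; split=> [k|x i0 Hx HL xr z zx].
  apply: (@hol_coef_unique R r r_gt0 _ _ _ 1) => s e s0 sr e0.
  have [N HN] := rho_cofinal sr; have [n Hn] := exp2_small 2 e0.
  (* With at least k + 1 blocks, coefficient k of the partial sum is already exact. *)
  exists (P (N + n + k.+1)%N); split.
    move=> w ws; rewrite mul1r uh; last exact: cdisc_disc ws.
    apply: le_trans (Hh w (cdisc_disc sr ws) s N ws HN _ _) _; first by lia.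
    apply: le_trans (ltW Hn); rewrite ler_pM2l //; apply: half_pow_le; lia.
  rewrite mul1r /P coef_sum (@big_cat_nat _ _ _ k.+1) //=; last by lia.
  rewrite big_mkord [X in _ + X - _]big1_seq ?addr0 ?subrr ?modulus0 ?(ltW e0) //.
  move=> i /andP[_]; rewrite mem_index_iota => /andP[ki _].
  by apply/eqP; apply: contraTT ki => /B0; rewrite -ltnNge ltnS.
rewrite uh; last exact: cdisc_disc zx.
have := Hh z (cdisc_disc xr zx) x i0 zx Hx i0 (leqnn _).
have -> : P i0 = 0.
  rewrite /P big1_seq // => i /andP[Li]; rewrite mem_index_iota => /andP[_ ii].
  by have := HL i Li; rewrite leqNgt ii.
by rewrite horner0 sub0r modulusN.
Qed.

Variables (mu : nat -> nat) (alpha : nat -> C).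
Hypothesis mu_incr : increasing_seq mu.
Hypothesis alpha0 : forall n, alpha n != 0.
Hypothesis r_radius : r = radius_of_convergence (fun n => (n`!%:R * `|alpha n|)^-1).

(** The series converges at some z with |z| > x, so its terms there tend to 0 and dominate those at
    x. *)
Lemma radius_terms (x e : R) : 0 < x -> (x%:E < r)%E -> 0 < e ->
  exists N, forall n, (N <= n)%N -> x ^+ n / (n`!%:R * modulus (alpha n)) < e.
Proof.
move=> x0; rewrite r_radius => /ereal_sup_gt[_ [z cz <-]]; rewrite lte_fin => xz e0.
have /cvg_series_cvg_0 c0 := cz.
have /c0 : nbhs (0 : C) [set y | modulus y < e].
  by apply/nbhs_modulusP; exists e => // y; rewrite subr0.
move=> [N _ HN]; exists N => n Nn; apply: le_lt_trans (HN n Nn).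
rewrite modulusM modulusV modulusM modulus_nat modulusX.
have -> : modulus `|alpha n| = modulus (alpha n) by rewrite /modulus normr_id.
rewrite mulrC; apply: ler_wpM2l; first by rewrite invr_ge0 mulr_ge0 ?modulus_ge0.
by apply: lerXn2r; rewrite ?nnegrE ?modulus_ge0 ?(ltW x0) // ltW.
Qed.

(** Since (n + j)! >= n!, the weighted norm of the block is at most A x^n / (n! |alpha_n|), with A
    depending on p and x only. *)
Lemma hol_small_block i (p : {poly C}) :
  exists N, forall n, (N <= n)%N -> hol_small i (block alpha n p).
Proof.
have [x0 xr] := rho_in i; set x := rho i in x0 xr.
pose A := \sum_(j < size p) modulus p`_j * j`!%:R * x ^+ j.
have A0 : 0 <= A.
  by apply: sumr_ge0 => j _; rewrite !mulr_ge0 ?modulus_ge0 ?exprn_ge0 // ltW.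
have e0 : 0 < 2^-1 ^+ i / (A + 1) by rewrite divr_gt0 ?half_pow_gt0 // ltr_wpDl.
have [N HN] := radius_terms x0 xr e0; exists N => n Nn.
rewrite /hol_small /weighted_norm -/x.
apply: (@le_trans _ _ (\sum_(k < n + size p) modulus (block alpha n p)`_k * x ^+ k)).
  have sz : (size (block alpha n p) <= n + size p)%N by exact: size_poly.
  rewrite (big_ord_widen _ (fun k => modulus (block alpha n p)`_k * x ^+ k) sz) big_mkcond /=.
  apply: ler_sum => k _; case: ifP => // _.
  by rewrite mulr_ge0 ?modulus_ge0 ?exprn_ge0 // ltW.
rewrite big_split_ord /= big1 ?add0r; last first.
  by move=> k _; rewrite coef_block leqNgt ltn_ord modulus0 mul0r.
set T := x ^+ n / (n`!%:R * modulus (alpha n)).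
have T0 : 0 <= T.
  by rewrite divr_ge0 ?exprn_ge0 ?mulr_ge0 ?modulus_ge0 // ltW.
apply: (@le_trans _ _ (A * T)); last first.
  have h := HN n Nn; rewrite -/T ltr_pdivlMr in h; last by rewrite ltr_wpDl.
  by apply: le_trans (ltW h); rewrite mulrC; apply: ler_wpM2l => //; rewrite lerDl.
rewrite /A mulr_suml; apply: ler_sum => j _.
rewrite coef_block leq_addr addKn !modulusM modulusV modulusM !modulus_nat exprD.
have a0 : 0 < modulus (alpha n) by rewrite modulus_gt0.
have nf (m : nat) : 0 < m`!%:R :> R by rewrite ltr0n fact_gt0.
have h : ((n + j)`!%:R * modulus (alpha n))^-1 <= (n`!%:R * modulus (alpha n))^-1.
  rewrite lef_pV2 ?posrE ?mulr_gt0 //; apply: ler_wpM2r; first exact: ltW.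
  by rewrite ler_nat; apply: leq_fact; rewrite leq_addr.
have -> : modulus p`_j * j`!%:R / ((n + j)`!%:R * modulus (alpha n)) * (x ^+ n * x ^+ j) =
  (modulus p`_j * j`!%:R * x ^+ j * x ^+ n) * ((n + j)`!%:R * modulus (alpha n))^-1 by ring.
rewrite /T mulrA; apply: ler_wpM2l => //.
by rewrite !mulr_ge0 ?modulus_ge0 ?exprn_ge0 // ltW.
Qed.

Lemma hol_S_coef n (u : hol r) z : hol_S n u z =
  \sum_(k < n.+1) hol_coef u (n + k) * ((n + k)`!%:R / k`!%:R) * z ^+ k.
Proof.
apply: eq_bigr => k _; rewrite /hol_coef /taylor_coef; congr (_ * _).
have -> : derive1n k (derive1n n (\val u)) 0 = derive1n (n + k) (\val u) 0.
  by rewrite /derive1n -iterD addnC.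
have h := fact_neq0 R (n + k); have h2 := fact_neq0 R k.
by move: (derive1n _ _ _) ((n + k)`!%:R : C) (k`!%:R : C) h h2 => a x y x0 y0; field; rewrite ?x0 ?y0.
Qed.

Lemma hol_coef_cont (u : hol r) k (e : R) : 0 < e ->
  nbhs u [set v : hol r | modulus (hol_coef v k - hol_coef u k) < e].
Proof.
move=> e0; have [s s0 sr] := ereal_between r_gt0.
have sk : 0 < s ^+ k by rewrite exprn_gt0.
(* p is within d of u and 2 d of v, so the two coefficient errors are at most e / 4 and e / 2. *)
pose d := e * s ^+ k / 4.
have d0 : 0 < d by rewrite divr_gt0 ?mulr_gt0.
have [p Hp] := hol_approx u (ltW s0) sr d0.
have Hp' : near_on s d p (\val u) by move=> w /Hp /ltW.
apply: filterS (hol_nbhs_basic u sr d0) => v /= Hv.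
have Hpv : near_on s (2 * d) p (\val v).
  move=> w ws; have := modulus_triangle (\val u w) p.[w] (\val v w).
  by have := Hp' w ws; have := Hv w ws; rewrite (modulusC (\val u w) (\val v w)); lra.
have h1 := hol_coef_close k s0 sr Hp'; have h2 := hol_coef_close k s0 sr Hpv.
rewrite -!ler_pdivlMr // in h1 h2.
have E : d / s ^+ k = e / 4 by rewrite /d; field; rewrite gt_eqF.
have E2 : 2 * d / s ^+ k = e / 2 by rewrite /d; field; rewrite gt_eqF.
rewrite E in h1; rewrite E2 in h2.
have := modulus_triangle p`_k (hol_coef v k) (hol_coef u k).
by rewrite (modulusC (hol_coef v k) p`_k); lra.
Qed.

Lemma hol_emb_exists : exists emb : {poly C} -> hol r,
  forall p z, disc r z -> \val (emb p) z = p.[z].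
Proof.
have /choice[emb embE] : forall p : {poly C}, exists u : hol r, forall z, disc r z -> \val u z = p.[z].
  by move=> p; apply: hol_of => z _; exact: derivable_hornerC.
by exists emb.
Qed.

Lemma hol_emb_dense (emb : {poly C} -> hol r) :
  (forall p z, disc r z -> \val (emb p) z = p.[z]) ->
  forall B, admissible hol_small B -> forall O : set (hol r), open O -> O !=set0 ->
  exists (p : {poly C}) (e : R) i0, 0 < e /\ forall (q : {poly C}) (L : pred nat) u,
    (size q <= size p)%N -> (forall k, modulus (q`_k - p`_k) < e) ->
    (forall i, L i -> (i0 <= i)%N) ->
    (forall k, hol_coef u k = \sum_(i < k.+1 | L i) (B i)`_k) -> O (emb q + u).
Proof.
move=> embE B adm O oO [h Oh].
have [s [e [s0 sr e0 H]]] : exists s e : R, [/\ 0 < s, (s%:E < r)%E, 0 < e & forall g : hol r,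
    (forall z, modulus z <= s -> modulus (\val g z - \val h z) < e) -> O g].
  by apply: (hol_nbhs_sub r_gt0); exact: open_nbhs_nbhs.
(* A quarter of e for each of three errors: q against p, p against h, and the tail u. *)
have e4 : 0 < e / 4 by rewrite divr_gt0.
have [p Hp] := hol_approx h (ltW s0) sr e4.
pose T := \sum_(k < size p) s ^+ k.
have T0 : 0 <= T by apply: sumr_ge0 => k _; rewrite exprn_ge0 // ltW.
pose e' := e / 4 / (T + 1).
have e'0 : 0 < e' by rewrite divr_gt0 // ltr_wpDl.
have e'T : e' * T <= e / 4.
  rewrite /e' mulrAC ler_pdivrMr; last by rewrite ltr_wpDl.
  by rewrite ler_pM2l // lerDl.
have [N HN] := rho_cofinal sr; have [n Hn] := exp2_small 2 e4.
exists p, e', (N + n)%N; split=> // q L u qp Hq HL Hu.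
have [u' [u'c u'b]] := hol_realize L adm.
(* u is given by its coefficients only; they identify it with the sum from [hol_realize], whose size
   is controlled. *)
have uE : u = u'.
  have E : (-1 : C) *: u' + u = 0.
    apply: hol_coef_inj => k.
    by rewrite (hol_coef_linear r_gt0) Hu u'c mulN1r addNr.
  by apply/eqP; rewrite -subr_eq0 addrC -scaleN1r E.
apply: H => z zs; have Dz := cdisc_disc sr zs.
have -> : \val (emb q + u) z = \val (emb q) z + \val u z by [].
rewrite embE // uE.
have h1 := horner_close (ltW e'0) (ltW s0) zs qp (fun k => ltW (Hq k)).
have h2 := Hp z zs.
have h3 : modulus (\val u' z) <= 2 * 2^-1 ^+ (N + n).
  apply: (u'b s _ _ HL sr z zs) => i Ni; apply: HN; lia.
have h4 : (2^-1 : R) ^+ (N + n) <= 2^-1 ^+ n by apply: half_pow_le; exact: leq_addl.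
have -> : q.[z] + \val u' z - \val h z =
  (q.[z] - p.[z]) + ((p.[z] - \val h z) + \val u' z) by ring.
have h5 := modulusD (q.[z] - p.[z]) ((p.[z] - \val h z) + \val u' z).
have h6 := modulusD (p.[z] - \val h z) (\val u' z).
rewrite -/T in h1.
move: h1 h2 h3 h4 h5 h6 e'T Hn; lra.
Qed.

Lemma hol_universality :
  let W := universal_set (@hol_S R r) mu alpha in (exists f : hol r, W f) /\ large_set W.
Proof.
have [emb embE] := hol_emb_exists.
apply: (@universality R mu alpha mu_incr alpha0 (hol r) (@hol_coef R r) (@hol_S R r) emb hol_small).
- by move=> *; exact: hol_coef_linear.
- exact: hol_coef_inj.
- exact: hol_coef_cont.
- exact: hol_S_coef.
- by move=> p k; apply: hol_coef_emb => // z; exact: embE.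
- exact: hol_small_block.
- by move=> B L adm; have [u [uc _]] := hol_realize L adm; exists u.
- exact: hol_emb_dense.
Qed.

End HolUniversality.

(** At z = 0 the partial sums are constant from the first term on. A radius other than 0 is
    therefore positive. *)
Lemma radius_of_convergence_ge0 (R : realType) (a : nat -> Cplx R) :
  (0 <= radius_of_convergence a)%E.
Proof.
apply: ereal_sup_ubound; exists 0; last by rewrite modulus0.
apply: (@is_cvg_near_cst _ _ (a 0%N)).
exists 1%N => // n /= n0; rewrite /series /= -(prednK n0) big_nat_recl //= expr0 mulr1.
by rewrite big1_seq ?addr0 // => i _; rewrite exprS mul0r mulr0.
Qed.

Unset Implicit Arguments.

Theorem theorem5p1 (R : realType) (mu : nat -> nat) (alpha : nat -> Cplx R) :
  increasing_seq mu -> (forall n, (0 < mu n)%N) ->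
  (forall n, alpha n != 0) ->
  let r := radius_of_convergence (fun n => (n`!%:R * `|alpha n|)^-1) in
  (r = 0%E ->
     let W := universal_set (@fps_S R) mu alpha in
     (exists f : fps R, W f) /\ large_set W) /\
  (r <> 0%E ->
     let W := universal_set (@hol_S R r) mu alpha in
     (exists f : hol r, W f) /\ large_set W).
Proof.
move=> mu_incr _ alpha0 r; split=> [_|rE]; first exact: fps_universality.
have r0 : (0 < r)%E by rewrite lt_def radius_of_convergence_ge0 andbT; apply/eqP.
have [rho [rho_in rho_cofinal]] := radii_exist r0.
exact: (hol_universality r0 rho_in rho_cofinal mu_incr alpha0 (erefl r)).
Qed.
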